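(* Let $R=\mathbb{C}\langle x,y\rangle/(x^5-yxy,\; y^2-xyx)$. Let $\mathbb{B}_3$ be the blow-up of $\mathbb{P}^2_{\mathbb{C}}$ at three non-collinear points, let $\mathcal{L}=\mathcal{O}(E)$ be the invertible $\mathcal{O}_{\mathbb{B}_3}$-module corresponding to a $(-1)$-curve $E$ on $\mathbb{B}_3$, and let $\sigma$ be an order $6$ automorphism of $\mathbb{B}_3$ that cyclically permutes the six $(-1)$-curves on $\mathbb{B}_3$. Then $R$ is isomorphic to the twisted homogeneous coordinate ring $$B(\mathbb{B}_3,\mathcal{L},\sigma):=\bigoplus_{n\ge 0}H^0(\mathbb{B}_3,\mathcal{L}_n),\qquad \mathcal{L}_n:=\mathcal{L}\otimes\sigma^*\mathcal{L}\otimes\cdots\otimes(\sigma^* )^{n-1}\mathcal{L}.$$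
   Context: Everything is over $\mathbb{C}$. $\mathbb{C}\langle x,y\rangle$ is the free associative algebra; $R$ is $\mathbb{Z}$-graded by $\deg x=1$, $\deg y=2$. $\mathbb{B}_3$ is the degree six del Pezzo surface; it contains exactly six $(-1)$-curves, forming a hexagon. ''Cyclically permutes'' means $\sigma$ acts on the set of these six curves as a $6$-cycle. In the twisted homogeneous coordinate ring, $\mathcal{L}_0=\mathcal{O}_{\mathbb{B}_3}$ and the product of $a\in H^0(\mathbb{B}_3,\mathcal{L}_m)$ and $b\in H^0(\mathbb{B}_3,\mathcal{L}_n)$ is the image of $a\otimes(\sigma^* )^m(b)$ in $H^0(\mathbb{B}_3,\mathcal{L}_m\otimes(\sigma^* )^m\mathcal{L}_n)=H^0(\mathbb{B}_3,\mathcal{L}_{m+n})$. *)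

(* Defs.v *)
From HB Require Import structures.
From mathcomp Require Import all_boot all_order all_algebra.
From mathcomp Require Import boolp classical_sets reals complex.
From mathcomp Require Import monalg mpoly.

Set Implicit Arguments.
Unset Strict Implicit.
Unset Printing Implicit Defensive.
Import GRing.Theory.
Local Open Scope ring_scope.
Local Open Scope classical_set_scope.
Local Open Scope quotient_scope.

(* A point of (P^n)^k is a k x (n+1) matrix whose rows are homogeneous
   coordinates.  Each point is represented by its unique matrix in which the
   first nonzero entry of every row is 1, so that equality of points is
   equality of matrices. *)
Definition normalized_point (C : closedFieldType) k n (A : 'M[C]_(k, n.+1)) :=
  forall i, exists j, A i j = 1 /\ forall j' : 'I_n.+1, (j' < j)%N -> A i j' = 0.

Record variety (C : closedFieldType) := Variety {
  vk : nat;
  vn : nat;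
  vmem : set 'M[C]_(vk, vn.+1)
}.
Arguments Variety {C} vk vn vmem.

Definition pt (C : closedFieldType) (X : variety C) :=
  {A : 'M[C]_(vk X, (vn X).+1) | normalized_point A /\ vmem A}.

Section Functions.
Variables (C : closedFieldType) (X : variety C).
Implicit Types (U V W Z : set (pt X)) (f g : pt X -> C) (a b : pt X).

Definition cform := {mpoly C[vk X * (vn X).+1]}.

Definition mxeval (F : cform) (A : 'M[C]_(vk X, (vn X).+1)) : C :=
  F.@[fun t => mxvec A 0 t].

Definition ev (F : cform) (a : pt X) : C := mxeval F (sval a).

(* As C is infinite, this says that F is homogeneous of degree [d i] in the
   i-th group of variables, for each i. *)
Definition mhomog (d : 'I_(vk X) -> nat) (F : cform) :=
  forall (c : 'I_(vk X) -> C) (A : 'M[C]_(vk X, (vn X).+1)),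
    mxeval F (\matrix_(i, j) (c i * A i j)) = (\prod_i c i ^+ d i) * mxeval F A.

(* The sets where a multihomogeneous form does not vanish are a basis of the
   Zariski topology. *)
Definition zopen U :=
  forall a, U a -> exists d F, [/\ mhomog d F, ev F a != 0
                               & forall b, ev F b != 0 -> U b].

Definition zclosed Z := zopen (~` Z).

Definition zdense U := forall V, zopen V -> V !=set0 -> U `&` V !=set0.

Definition regular_on U f :=
  forall a, U a -> exists V d F G,
    [/\ zopen V, V a & V `<=` U] /\
    [/\ mhomog d F, mhomog d G
      & forall b, V b -> ev G b != 0 /\ f b = ev F b / ev G b].

Definition odense U := zopen U /\ zdense U.

Definition gen_eq f g := exists2 U, odense U & forall a, U a -> f a = g a.

Definition gen_regular f := exists2 U, odense U & regular_on U f.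

Lemma mxevalM F G A : mxeval (F * G) A = mxeval F A * mxeval G A.
Proof. by rewrite /mxeval mevalM. Qed.

Lemma mxevalD F G A : mxeval (F + G) A = mxeval F A + mxeval G A.
Proof. by rewrite /mxeval mevalD. Qed.

Lemma mxevalC c A : mxeval c%:MP A = c.
Proof. by rewrite /mxeval mevalC. Qed.

Lemma mhomogM d e F G : mhomog d F -> mhomog e G ->
  mhomog (fun i => (d i + e i)%N) (F * G).
Proof.
move=> hF hG c A; rewrite !mxevalM hF hG mulrACA -big_split /=.
by congr (_ * _); apply: eq_bigr => i _; rewrite exprD.
Qed.

Lemma mhomogD d F G : mhomog d F -> mhomog d G -> mhomog d (F + G).
Proof. by move=> hF hG c A; rewrite !mxevalD hF hG mulrDr. Qed.

Lemma mhomogC c : mhomog (fun=> 0%N) c%:MP.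
Proof. by move=> e A; rewrite !mxevalC big1 ?mul1r // => i _; rewrite expr0. Qed.

Lemma zopenT : zopen setT.
Proof.
move=> a _; exists (fun=> 0%N), 1%:MP; split=> //; first exact: mhomogC.
by rewrite /ev mxevalC oner_eq0.
Qed.

Lemma zopenI U V : zopen U -> zopen V -> zopen (U `&` V).
Proof.
move=> oU oV a [Ua Va]; have [d [F [hF Fa FU]]] := oU a Ua.
have [e [G [hG Ga GV]]] := oV a Va.
exists (fun i => (d i + e i)%N), (F * G); split; first exact: mhomogM.
  by rewrite /ev mxevalM mulf_neq0.
move=> b; rewrite /ev mxevalM mulf_eq0 negb_or => /andP[Fb Gb].
by split; [apply: FU | apply: GV].
Qed.

Lemma odenseT : odense setT.
Proof. by split; [exact: zopenT | move=> V _ [a Va]; exists a]. Qed.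

Lemma odenseI U V : odense U -> odense V -> odense (U `&` V).
Proof.
move=> [oU dU] [oV dV]; split; first exact: zopenI.
by move=> W oW W0; rewrite -setIA; apply: dU; [exact: zopenI | exact: dV].
Qed.

Lemma regular_onS U V f : zopen V -> V `<=` U -> regular_on U f ->
  regular_on V f.
Proof.
move=> oV VU rf a Va; have [W [d [F [G [[oW Wa WU] [hF hG fE]]]]]] := rf a (VU a Va).
exists (W `&` V), d, F, G; split.
  by split; [exact: zopenI | by [] | exact: subIsetr].
by split=> // b [Wb _]; exact: fE.
Qed.

Lemma regular_on_cst U c : zopen U -> regular_on U (fun=> c).
Proof.
move=> oU a Ua; exists U, (fun=> 0%N), c%:MP, 1%:MP; split; first by split.
split; [exact: mhomogC | exact: mhomogC |].
by move=> b _; rewrite /ev !mxevalC oner_eq0 divr1.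
Qed.

Lemma regular_onD U f g : regular_on U f -> regular_on U g ->
  regular_on U (fun a => f a + g a).
Proof.
move=> rf rg a Ua; have [V [d [F [G [[oV Va VU] [hF hG fE]]]]]] := rf a Ua.
have [V' [d' [F' [G' [[oV' Va' VU'] [hF' hG' gE]]]]]] := rg a Ua.
exists (V `&` V'), (fun i => (d i + d' i)%N), (F * G' + F' * G), (G * G').
split.
  by split; [exact: zopenI | by [] | by move=> b [/VU]].
split.
- by apply: mhomogD; [exact: mhomogM | rewrite mulrC; exact: mhomogM].
- exact: mhomogM.
move=> b [Vb Vb']; have [Gb ->] := fE b Vb; have [Gb' ->] := gE b Vb'.
rewrite /ev mxevalD !mxevalM; split; first by rewrite mulf_neq0.
by rewrite addf_div.
Qed.

Lemma regular_onM U f g : regular_on U f -> regular_on U g ->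
  regular_on U (fun a => f a * g a).
Proof.
move=> rf rg a Ua; have [V [d [F [G [[oV Va VU] [hF hG fE]]]]]] := rf a Ua.
have [V' [d' [F' [G' [[oV' Va' VU'] [hF' hG' gE]]]]]] := rg a Ua.
exists (V `&` V'), (fun i => (d i + d' i)%N), (F * F'), (G * G').
split.
  by split; [exact: zopenI | by [] | by move=> b [/VU]].
split.
- exact: mhomogM.
- exact: mhomogM.
move=> b [Vb Vb']; have [Gb ->] := fE b Vb; have [Gb' ->] := gE b Vb'.
by rewrite /ev !mxevalM mulf_div; split; first by rewrite mulf_neq0.
Qed.

Lemma gen_regular_cst c : gen_regular (fun=> c).
Proof. by exists setT; [exact: odenseT | exact: regular_on_cst zopenT]. Qed.

Lemma gen_regular2 f g : gen_regular f -> gen_regular g ->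
  exists U, [/\ odense U, regular_on U f & regular_on U g].
Proof.
move=> [U dU rU] [V dV rV]; have dW := odenseI dU dV.
exists (U `&` V); split=> //.
  by apply: regular_onS rU; [exact: dW.1 | exact: subIsetl].
by apply: regular_onS rV; [exact: dW.1 | exact: subIsetr].
Qed.

Lemma gen_regularD f g : gen_regular f -> gen_regular g ->
  gen_regular (fun a => f a + g a).
Proof.
move=> rf rg; have [U [dU rUf rUg]] := gen_regular2 rf rg.
by exists U => //; exact: regular_onD.
Qed.

Lemma gen_regularM f g : gen_regular f -> gen_regular g ->
  gen_regular (fun a => f a * g a).
Proof.
move=> rf rg; have [U [dU rUf rUg]] := gen_regular2 rf rg.
by exists U => //; exact: regular_onM.
Qed.

Lemma gen_eq_refl f : gen_eq f f.
Proof. by exists setT => //; exact: odenseT. Qed.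

Lemma gen_eq_sym f g : gen_eq f g -> gen_eq g f.
Proof. by move=> [U dU e]; exists U => // a /e. Qed.

Lemma gen_eq_trans g f h : gen_eq f g -> gen_eq g h -> gen_eq f h.
Proof.
move=> [U dU e] [V dV e']; exists (U `&` V); first exact: odenseI.
by move=> a [Ua Va]; rewrite e // e'.
Qed.

Record ratrep := RatRep { rr_fun :> pt X -> C; rr_reg : gen_regular rr_fun }.

HB.instance Definition _ := gen_eqMixin ratrep.
HB.instance Definition _ := gen_choiceMixin ratrep.

Definition ratrep_eq (f g : ratrep) := `[< gen_eq f g >].

Lemma ratrep_eq_equiv : equiv_class_of ratrep_eq.
Proof.
split=> [f|f g|g f h].
- by apply/asboolP; exact: gen_eq_refl.
- by apply/asboolP/asboolP; exact: gen_eq_sym.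
- by move=> /asboolP fg /asboolP gh; apply/asboolP; exact: gen_eq_trans gh.
Qed.

Canonical ratrep_equiv := EquivRelPack ratrep_eq_equiv.

(* Rational functions on X: functions regular on a dense open subset, modulo
   equality on a dense open subset.  This is the function field of X when X is
   irreducible. *)
Definition ratfun := {eq_quot ratrep_eq}.
HB.instance Definition _ := EqQuotient.on ratfun.
HB.instance Definition _ := Choice.on ratfun.
Implicit Types (u v w : ratfun).

Definition ratclass f (rf : gen_regular f) : ratfun := \pi_ratfun (RatRep rf).

(* The rational function u is given on the dense open set U by f. *)
Definition represents (u : ratfun) U f :=
  [/\ odense U, regular_on U f & gen_eq (repr u) f].

Lemma ratclass_eq f g (rf : gen_regular f) (rg : gen_regular g) :
  ratclass rf = ratclass rg <-> gen_eq f g.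
Proof.
split=> [fg|fg].
  by have /asboolP := introT (eqmodP ratrep_equiv (RatRep rf) (RatRep rg)) fg.
by apply: (elimT (eqmodP ratrep_equiv (RatRep rf) (RatRep rg))); apply/asboolP.
Qed.

Lemma ratclassK (u : ratfun) : ratclass (rr_reg (repr u)) = u.
Proof. by rewrite -[RHS]reprK /ratclass; case: (repr u). Qed.

Lemma gen_eq_repr f (rf : gen_regular f) : gen_eq (repr (ratclass rf)) f.
Proof. exact: (ratclass_eq (rr_reg _) rf).1 (ratclassK _). Qed.

Lemma ratfun_eq (u v : ratfun) : gen_eq (repr u) (repr v) -> u = v.
Proof.
by move=> uv; rewrite -[u]ratclassK -[v]ratclassK; apply/ratclass_eq.
Qed.

(* These operations are locked so that unification does not unfold them. *)
Definition rf_cst c : ratfun := locked (ratclass (gen_regular_cst c)).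
Definition rf_add (u v : ratfun) : ratfun :=
  locked (ratclass (gen_regularD (rr_reg (repr u)) (rr_reg (repr v)))).
Definition rf_mul (u v : ratfun) : ratfun :=
  locked (ratclass (gen_regularM (rr_reg (repr u)) (rr_reg (repr v)))).
Definition rf_opp (u : ratfun) : ratfun := rf_mul (rf_cst (-1)) u.

Lemma gen_eq2 f f' g g' (op : C -> C -> C) : gen_eq f f' -> gen_eq g g' ->
  gen_eq (fun a => op (f a) (g a)) (fun a => op (f' a) (g' a)).
Proof.
move=> [U dU e] [V dV e']; exists (U `&` V); first exact: odenseI.
by move=> a [Ua Va]; rewrite e // e'.
Qed.

Lemma repr_cst c : gen_eq (repr (rf_cst c)) (fun=> c).
Proof. rewrite /rf_cst -lock; exact: gen_eq_repr. Qed.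

Lemma repr_add u v : gen_eq (repr (rf_add u v)) (fun a => repr u a + repr v a).
Proof. rewrite /rf_add -lock; exact: gen_eq_repr. Qed.

Lemma repr_mul u v : gen_eq (repr (rf_mul u v)) (fun a => repr u a * repr v a).
Proof. rewrite /rf_mul -lock; exact: gen_eq_repr. Qed.

Lemma gen_eq_fun f f' g g' : gen_eq f f' -> gen_eq g g' -> f' =1 g' ->
  gen_eq f g.
Proof.
move=> ff gg e; apply: gen_eq_trans ff _; apply: gen_eq_trans (gen_eq_sym gg).
by rewrite (funext e); exact: gen_eq_refl.
Qed.

Lemma repr_addP u v f g : gen_eq (repr u) f -> gen_eq (repr v) g ->
  gen_eq (repr (rf_add u v)) (fun a => f a + g a).
Proof.
by move=> uf vg; apply: gen_eq_trans (repr_add u v) _; exact: gen_eq2.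
Qed.

Lemma repr_mulP u v f g : gen_eq (repr u) f -> gen_eq (repr v) g ->
  gen_eq (repr (rf_mul u v)) (fun a => f a * g a).
Proof.
by move=> uf vg; apply: gen_eq_trans (repr_mul u v) _; exact: gen_eq2.
Qed.

Lemma rf_addA : associative rf_add.
Proof.
move=> u v w; apply: ratfun_eq; apply: gen_eq_fun.
- exact: repr_addP (gen_eq_refl _) (repr_add _ _).
- exact: repr_addP (repr_add _ _) (gen_eq_refl _).
- by move=> a; rewrite addrA.
Qed.

Lemma rf_addC : commutative rf_add.
Proof.
move=> u v; apply: ratfun_eq; apply: gen_eq_fun; try exact: repr_add.
by move=> a; rewrite addrC.
Qed.

Lemma rf_add0 : left_id (rf_cst 0) rf_add.
Proof.
move=> u; apply: ratfun_eq; apply: gen_eq_fun.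
- exact: repr_addP (repr_cst _) (gen_eq_refl _).
- exact: gen_eq_refl.
- by move=> a; rewrite add0r.
Qed.

Lemma rf_addN : left_inverse (rf_cst 0) rf_opp rf_add.
Proof.
move=> u; apply: ratfun_eq; apply: gen_eq_fun.
- apply: repr_addP (gen_eq_refl _).
  exact: repr_mulP (repr_cst _) (gen_eq_refl _).
- exact: repr_cst.
- by move=> a; rewrite mulN1r addNr.
Qed.

Lemma rf_mulA : associative rf_mul.
Proof.
move=> u v w; apply: ratfun_eq; apply: gen_eq_fun.
- exact: repr_mulP (gen_eq_refl _) (repr_mul _ _).
- exact: repr_mulP (repr_mul _ _) (gen_eq_refl _).
- by move=> a; rewrite mulrA.
Qed.

Lemma rf_mulC : commutative rf_mul.
Proof.
move=> u v; apply: ratfun_eq; apply: gen_eq_fun; try exact: repr_mul.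
by move=> a; rewrite mulrC.
Qed.

Lemma rf_mul1 : left_id (rf_cst 1) rf_mul.
Proof.
move=> u; apply: ratfun_eq; apply: gen_eq_fun.
- exact: repr_mulP (repr_cst _) (gen_eq_refl _).
- exact: gen_eq_refl.
- by move=> a; rewrite mul1r.
Qed.

Lemma rf_mulDl : left_distributive rf_mul rf_add.
Proof.
move=> u v w; apply: ratfun_eq; apply: gen_eq_fun.
- exact: repr_mulP (repr_add _ _) (gen_eq_refl _).
- exact: repr_addP (repr_mul _ _) (repr_mul _ _).
- by move=> a; rewrite mulrDl.
Qed.

HB.instance Definition _ :=
  GRing.isZmodule.Build ratfun rf_addA rf_addC rf_add0 rf_addN.
HB.instance Definition _ :=
  GRing.Zmodule_isComPzRing.Build ratfun rf_mulA rf_mulC rf_mul1 rf_mulDl.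

Definition rf_scale (c : C) (u : ratfun) : ratfun := rf_cst c * u.

Lemma rf_cstD c d : rf_cst (c + d) = rf_cst c + rf_cst d.
Proof.
apply: ratfun_eq; apply: gen_eq_fun; first exact: repr_cst.
  exact: repr_addP (repr_cst _) (repr_cst _).
by [].
Qed.

Lemma rf_cstM c d : rf_cst (c * d) = rf_cst c * rf_cst d.
Proof.
apply: ratfun_eq; apply: gen_eq_fun; first exact: repr_cst.
  exact: repr_mulP (repr_cst _) (repr_cst _).
by [].
Qed.

Lemma rf_scaleA c d u : rf_scale c (rf_scale d u) = rf_scale (c * d) u.
Proof. by rewrite /rf_scale rf_cstM mulrA. Qed.

Lemma rf_scale1 : left_id 1 rf_scale.
Proof. by move=> u; rewrite /rf_scale [rf_cst 1 * u]mul1r. Qed.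

Lemma rf_scaleDr : right_distributive rf_scale +%R.
Proof. by move=> c u v; rewrite /rf_scale mulrDr. Qed.

Lemma rf_scaleDl u : {morph rf_scale^~ u : c d / c + d}.
Proof. by move=> c d; rewrite /rf_scale rf_cstD mulrDl. Qed.

HB.instance Definition _ := GRing.Zmodule_isLmodule.Build C ratfun
  rf_scaleA rf_scale1 rf_scaleDr rf_scaleDl.

Definition local_ring (p : pt X) : set ratfun :=
  [set u | exists U f, U p /\ represents u U f].

Definition ideal_stalk Z (p : pt X) : set ratfun :=
  [set u | exists U f, [/\ U p, represents u U f
                         & forall q, U q -> Z q -> f q = 0]].

Lemma represents_cst c : represents (rf_cst c) setT (fun=> c).
Proof.
by split; [exact: odenseT | exact: regular_on_cst zopenT | exact: repr_cst].
Qed.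

Lemma represents_add u v U V f g : represents u U f -> represents v V g ->
  represents (u + v) (U `&` V) (fun a => f a + g a).
Proof.
move=> [dU rU eU] [dV rV eV]; have dW := odenseI dU dV; split=> //.
  apply: regular_onD; [move: rU | move: rV].
    by apply: regular_onS; [exact: dW.1 | exact: subIsetl].
  by apply: regular_onS; [exact: dW.1 | exact: subIsetr].
exact: repr_addP.
Qed.

Lemma represents_mul u v U V f g : represents u U f -> represents v V g ->
  represents (u * v) (U `&` V) (fun a => f a * g a).
Proof.
move=> [dU rU eU] [dV rV eV]; have dW := odenseI dU dV; split=> //.
  apply: regular_onM; [move: rU | move: rV].
    by apply: regular_onS; [exact: dW.1 | exact: subIsetl].
  by apply: regular_onS; [exact: dW.1 | exact: subIsetr].
exact: repr_mulP.
Qed.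

Lemma local_ring_cst p c : local_ring p (rf_cst c).
Proof. by exists setT, (fun=> c); split=> //; exact: represents_cst. Qed.

Lemma local_ringD p u v : local_ring p u -> local_ring p v ->
  local_ring p (u + v).
Proof.
move=> [U [f [Up Uf]]] [V [g [Vp Vg]]].
by exists (U `&` V), (fun a => f a + g a); split=> //; exact: represents_add.
Qed.

Lemma local_ringM p u v : local_ring p u -> local_ring p v ->
  local_ring p (u * v).
Proof.
move=> [U [f [Up Uf]]] [V [g [Vp Vg]]].
by exists (U `&` V), (fun a => f a * g a); split=> //; exact: represents_mul.
Qed.

(* A sheaf of O_X-submodules F of the constant sheaf of rational functions,
   given by its stalks: F(U) is the set of the rational functions that lie in
   F_p for every point p of U. *)
Record fracsheaf := FracSheaf {
  stalk :> pt X -> set ratfun;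
  stalk0 : forall p, stalk p 0;
  stalkD : forall p u v, stalk p u -> stalk p v -> stalk p (u + v);
  stalkM : forall p r u, local_ring p r -> stalk p u -> stalk p (r * u)
}.

Definition structure_sheaf : fracsheaf :=
  FracSheaf (fun p => local_ring_cst p 0) local_ringD local_ringM.

Definition global_sections (L : fracsheaf) : set ratfun :=
  [set u | forall p, L p u].

(* O(Z), the inverse of the ideal sheaf of Z *)
Definition divisor_stalk Z p : set ratfun :=
  [set u | forall v, ideal_stalk Z p v -> local_ring p (u * v)].

Lemma divisor_stalk0 Z p : divisor_stalk Z p 0.
Proof. by move=> v _; rewrite mul0r; exact: local_ring_cst. Qed.

Lemma divisor_stalkD Z p u v : divisor_stalk Z p u -> divisor_stalk Z p v ->
  divisor_stalk Z p (u + v).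
Proof.
by move=> Zu Zv w Zw; rewrite mulrDl; apply: local_ringD; [exact: Zu|exact: Zv].
Qed.

Lemma divisor_stalkM Z p r u : local_ring p r -> divisor_stalk Z p u ->
  divisor_stalk Z p (r * u).
Proof.
by move=> rO Zu w Zw; rewrite -mulrA; apply: local_ringM => //; exact: Zu.
Qed.

Definition divisor_sheaf Z : fracsheaf :=
  FracSheaf (@divisor_stalk0 Z) (@divisor_stalkD Z) (@divisor_stalkM Z).

(* For invertible L and M, the product of L and M inside the rational functions
   is canonically isomorphic to their tensor product. *)
Definition tensor_stalk (L M : fracsheaf) p : set ratfun :=
  [set u | exists n (v w : 'I_n -> ratfun),
     [/\ forall i, L p (v i), forall i, M p (w i) & u = \sum_i v i * w i]].

Lemma tensor_stalk0 L M p : tensor_stalk L M p 0.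
Proof.
by exists 0%N, (fun=> 0), (fun=> 0); split=> [[]//|[]//|]; rewrite big_ord0.
Qed.

Lemma tensor_stalkD L M p u u' : tensor_stalk L M p u ->
  tensor_stalk L M p u' -> tensor_stalk L M p (u + u').
Proof.
move=> [n [v [w [Lv Mw ->]]]] [n' [v' [w' [Lv' Mw' ->]]]].
pose glue (f : 'I_n -> ratfun) (g : 'I_n' -> ratfun) (i : 'I_(n + n')) :=
  match split i with inl j => f j | inr j => g j end.
exists (n + n')%N, (glue v v'), (glue w w'); split.
- by move=> i; rewrite /glue; case: split.
- by move=> i; rewrite /glue; case: split.
rewrite big_split_ord /glue /=; congr (_ + _); apply: eq_bigr => i _.
  by rewrite -[lshift n' i]/(unsplit (inl i)) unsplitK.
by rewrite -[rshift n i]/(unsplit (inr i)) unsplitK.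
Qed.

Lemma tensor_stalkM L M p r u : local_ring p r -> tensor_stalk L M p u ->
  tensor_stalk L M p (r * u).
Proof.
move=> rO [n [v [w [Lv Mw ->]]]]; exists n, (fun i => r * v i), w; split=> //.
  by move=> i; exact: stalkM.
by rewrite mulr_sumr; apply: eq_bigr => i _; rewrite mulrA.
Qed.

Definition tensor (L M : fracsheaf) : fracsheaf :=
  FracSheaf (@tensor_stalk0 L M) (@tensor_stalkD L M) (@tensor_stalkM L M).

End Functions.

Arguments represents {C X} u U f.

Section Morphisms.
Variables (C : closedFieldType) (X Y : variety C).

Definition morphism (h : pt X -> pt Y) :=
  (forall V, zopen V -> zopen (h @^-1` V)) /\
  (forall V f, zopen V -> regular_on V f -> regular_on (h @^-1` V) (f \o h)).

(* The rational function u on Y can be restricted along h, and v is its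
   restriction. *)
Definition restricts (h : pt X -> pt Y) (u : ratfun Y) (v : ratfun X) :=
  exists U f, represents u U f /\ represents v (h @^-1` U) (f \o h).

End Morphisms.

Definition isomorphism (C : closedFieldType) (X Y : variety C)
    (h : pt X -> pt Y) :=
  morphism h /\ exists g : pt Y -> pt X, [/\ morphism g, cancel h g & cancel g h].

Record automorphism (C : closedFieldType) (X : variety C) := Automorphism {
  aut_fun :> pt X -> pt X;
  aut_inv : pt X -> pt X;
  aut_mor : morphism aut_fun;
  aut_inv_mor : morphism aut_inv;
  aut_funK : cancel aut_fun aut_inv;
  aut_invK : cancel aut_inv aut_fun
}.

Section Pullback.
Variables (C : closedFieldType) (X : variety C) (s : automorphism X).
Implicit Types (u v : ratfun X).

Lemma odense_preim U : odense U -> odense (s @^-1` U).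
Proof.
move=> [oU dU]; split; first exact: (aut_mor s).1.
move=> V oV [a Va]; have [||b [Ub Vb]] := dU (aut_inv s @^-1` V).
- exact: (aut_inv_mor s).1.
- by exists (s a); rewrite /= aut_funK.
- by exists (aut_inv s b); split=> //=; rewrite aut_invK.
Qed.

Lemma regular_preim (U : set (pt X)) f : zopen U -> regular_on U f ->
  regular_on (s @^-1` U) (f \o s).
Proof. exact: (aut_mor s).2. Qed.

Lemma gen_regular_preim f : gen_regular f -> gen_regular (f \o s).
Proof.
move=> [U dU rU]; exists (s @^-1` U); first exact: odense_preim.
by apply: regular_preim => //; case: dU.
Qed.

Lemma gen_eq_preim f g : gen_eq f g -> gen_eq (f \o s) (g \o s).
Proof.
move=> [U dU e]; exists (s @^-1` U); first exact: odense_preim.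
by move=> a /e.
Qed.

Definition pullback (u : ratfun X) : ratfun X :=
  locked (ratclass (gen_regular_preim (rr_reg (repr u)))).

Lemma repr_pullback u f : gen_eq (repr u) f ->
  gen_eq (repr (pullback u)) (f \o s).
Proof.
move=> uf; rewrite /pullback -lock.
apply: gen_eq_trans (gen_eq_repr _) _; exact: gen_eq_preim.
Qed.

Lemma represents_pullback u U f : represents u U f ->
  represents (pullback u) (s @^-1` U) (f \o s).
Proof.
move=> [dU rU eU]; split; first exact: odense_preim.
- by apply: regular_preim => //; case: dU.
- exact: repr_pullback.
Qed.

Lemma pullbackD : {morph pullback : u v / u + v}.
Proof.
move=> u v; apply: ratfun_eq; apply: gen_eq_fun.
- exact: repr_pullback (repr_add _ _).
- exact: repr_addP (repr_pullback (gen_eq_refl _)) (repr_pullback (gen_eq_refl _)).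
- by [].
Qed.

Lemma pullbackM : {morph pullback : u v / u * v}.
Proof.
move=> u v; apply: ratfun_eq; apply: gen_eq_fun.
- exact: repr_pullback (repr_mul _ _).
- exact: repr_mulP (repr_pullback (gen_eq_refl _)) (repr_pullback (gen_eq_refl _)).
- by [].
Qed.

Lemma pullback_cst c : pullback (rf_cst X c) = rf_cst X c.
Proof.
apply: ratfun_eq; apply: gen_eq_fun; first exact: repr_pullback (repr_cst _ _).
  exact: repr_cst.
by [].
Qed.

Lemma pullback0 : pullback 0 = 0.
Proof. exact: pullback_cst. Qed.

Lemma pullback1 : pullback 1 = 1.
Proof. exact: pullback_cst. Qed.

Lemma pullbackZ c u : pullback (c *: u) = c *: pullback u.
Proof. by rewrite [LHS]pullbackM pullback_cst. Qed.

Lemma pullback_sum I r (P : pred I) (F : I -> ratfun X) :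
  pullback (\sum_(i <- r | P i) F i) = \sum_(i <- r | P i) pullback (F i).
Proof. exact: (big_morph _ pullbackD pullback0). Qed.

Lemma local_ring_pullback p u : local_ring (s p) u -> local_ring p (pullback u).
Proof.
move=> [U [f [Up Uf]]]; exists (s @^-1` U), (f \o s); split=> //.
exact: represents_pullback.
Qed.

End Pullback.

Definition aut_invA (C : closedFieldType) (X : variety C) (s : automorphism X) :
  automorphism X :=
  Automorphism (aut_inv_mor s) (aut_mor s) (aut_invK s) (aut_funK s).

Section PullbackSheaf.
Variables (C : closedFieldType) (X : variety C) (s : automorphism X).
Implicit Types (u v : ratfun X).

Lemma pullback_invK u : pullback s (pullback (aut_invA s) u) = u.
Proof.
apply: ratfun_eq; apply: gen_eq_fun.
- by apply: repr_pullback; apply: repr_pullback; exact: gen_eq_refl.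
- exact: gen_eq_refl.
- by move=> a /=; rewrite aut_funK.
Qed.

(* s^* L is embedded in the rational functions by the canonical isomorphism from
   s^* of the sheaf of rational functions to the sheaf of rational functions, so
   that s^* O(Z) is O(s^-1(Z)). *)
Definition pullback_stalk (L : fracsheaf X) p : set (ratfun X) :=
  pullback s @` L (s p).

Variable L : fracsheaf X.

Lemma pullback_stalk0 p : pullback_stalk L p 0.
Proof. by exists 0; [exact: stalk0 | exact: pullback0]. Qed.

Lemma pullback_stalkD p u v : pullback_stalk L p u -> pullback_stalk L p v ->
  pullback_stalk L p (u + v).
Proof.
move=> [u' Lu <-] [v' Lv <-]; rewrite -pullbackD.
by exists (u' + v') => //; exact: stalkD.
Qed.

Lemma pullback_stalkM p r u : local_ring p r -> pullback_stalk L p u ->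
  pullback_stalk L p (r * u).
Proof.
move=> rO [v Lv <-]; rewrite -[r]pullback_invK -pullbackM; exists (pullback (aut_invA s) r * v) => //.
apply: stalkM => //; apply: local_ring_pullback.
by rewrite /= aut_funK.
Qed.

Definition pullback_sheaf : fracsheaf X :=
  FracSheaf pullback_stalk0 pullback_stalkD (@pullback_stalkM).

End PullbackSheaf.

Section TwistedRing.
Variables (C : closedFieldType) (X : variety C).
Variables (L : fracsheaf X) (s : automorphism X).
Implicit Types (u v : ratfun X).

Fixpoint twisted_power n : fracsheaf X :=
  if n is m.+1 then tensor (twisted_power m) (iter m (pullback_sheaf s) L)
  else structure_sheaf X.

Record thcr := Thcr {
  comp :> nat -> ratfun X;
  comp_section : forall n, global_sections (twisted_power n) (comp n);
  comp_finite : exists N, forall n, (N <= n)%N -> comp n = 0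
}.

HB.instance Definition _ := gen_eqMixin thcr.
HB.instance Definition _ := gen_choiceMixin thcr.

Lemma thcr_eq (a b : thcr) : (forall n, a n = b n) -> a = b.
Proof.
case: a b => [a a1 a2] [b b1 b2] /= /funext ab; subst b.
by congr Thcr; exact: Prop_irrelevance.
Qed.

Lemma sections0 n : global_sections (twisted_power n) 0.
Proof. by move=> p; exact: stalk0. Qed.

Lemma sections1 : global_sections (twisted_power 0) 1.
Proof. by move=> p; exact: local_ring_cst. Qed.

Lemma sectionsD n u v : global_sections (twisted_power n) u ->
  global_sections (twisted_power n) v ->
  global_sections (twisted_power n) (u + v).
Proof. by move=> Lu Lv p; apply: stalkD. Qed.

Lemma sectionsZ n c u : global_sections (twisted_power n) u ->
  global_sections (twisted_power n) (c *: u).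
Proof. by move=> Lu p; apply: stalkM => //; exact: local_ring_cst. Qed.

Lemma sections_sum n I r (P : pred I) (F : I -> ratfun X) :
  (forall i, P i -> global_sections (twisted_power n) (F i)) ->
  global_sections (twisted_power n) (\sum_(i <- r | P i) F i).
Proof. by move=> LF; apply: big_ind => //; [exact: sections0|exact: sectionsD]. Qed.

Lemma iter_pullback_local m p u : local_ring (iter m s p) u ->
  local_ring p (iter m (pullback s) u).
Proof.
elim: m p u => [|m IHm] p u //= Lu; apply: local_ring_pullback.
by apply: IHm; rewrite -iterSr.
Qed.

Lemma iter_pullback_stalk m M p u : stalk M (iter m s p) u ->
  iter m (pullback_sheaf s) M p (iter m (pullback s) u).
Proof.
elim: m p u => [|m IHm] p u //= Lu; exists (iter m (pullback s) u) => //.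
by apply: IHm; rewrite -iterSr.
Qed.

Lemma iter_pullbackM m :
  {morph iter m (pullback s) : u v / u * v}.
Proof. by elim: m => [|m IHm] u v //=; rewrite IHm pullbackM. Qed.

Lemma iter_pullbackD m :
  {morph iter m (pullback s) : u v / u + v}.
Proof. by elim: m => [|m IHm] u v //=; rewrite IHm pullbackD. Qed.

Lemma iter_pullback0 m : iter m (pullback s) 0 = 0.
Proof. by elim: m => [|m IHm] //=; rewrite IHm pullback0. Qed.

Lemma iter_pullback1 m : iter m (pullback s) 1 = 1.
Proof. by elim: m => [|m IHm] //=; rewrite IHm pullback1. Qed.

Lemma iter_pullback_sum m I r (P : pred I) (F : I -> ratfun X) :
  iter m (pullback s) (\sum_(i <- r | P i) F i) =
  \sum_(i <- r | P i) iter m (pullback s) (F i).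
Proof. exact: (big_morph _ (iter_pullbackD m) (iter_pullback0 m)). Qed.

Lemma twisted_powerM m n p u v : twisted_power m p u ->
  twisted_power n (iter m s p) v ->
  twisted_power (m + n) p (u * iter m (pullback s) v).
Proof.
move=> Lu; elim: n v => [|n IHn] v /= Lv.
  rewrite addn0 mulrC; apply: stalkM => //.
  by apply: iter_pullback_local.
have {Lv}[k [a [b [La Lb ->]]]] := Lv; rewrite addnS /=.
exists k, (fun i => u * iter m (pullback s) (a i)),
  (fun i => iter m (pullback s) (b i)); split=> [i|i|].
- exact: IHn.
- by rewrite iterD; apply: iter_pullback_stalk.
- rewrite iter_pullback_sum mulr_sumr; apply: eq_bigr => i _.
  by rewrite iter_pullbackM mulrA.
Qed.

Lemma sectionsM m n u v : global_sections (twisted_power m) u ->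
  global_sections (twisted_power n) v ->
  global_sections (twisted_power (m + n)) (u * iter m (pullback s) v).
Proof. by move=> Lu Lv p; apply: twisted_powerM. Qed.

Definition thcr_zero : thcr.
Proof. by exists (fun=> 0); [exact: sections0 | exists 0%N]. Defined.

Definition thcr_one : thcr.
Proof.
exists (fun n => if n is 0 then 1 else 0); last by exists 1%N => -[].
by case=> [|n]; [exact: sections1 | exact: sections0].
Defined.

Definition thcr_add (a b : thcr) : thcr.
Proof.
exists (fun n => a n + b n).
- by move=> n; apply: sectionsD; exact: comp_section.
- case: (comp_finite a) (comp_finite b) => [M aM] [N bN].
  exists (maxn M N) => n; rewrite geq_max => /andP[Mn Nn].
  by rewrite aM // bN // addr0.
Defined.

Definition thcr_scale (c : C) (a : thcr) : thcr.
Proof.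
exists (fun n => c *: a n).
- by move=> n; apply: sectionsZ; exact: comp_section.
- by case: (comp_finite a) => [M aM]; exists M => n /aM ->; rewrite scaler0.
Defined.

Definition thcr_mul (a b : thcr) : thcr.
Proof.
exists (fun n => \sum_(i < n.+1) a i * iter i (pullback s) (b (n - i)%N)).
- move=> n; apply: sections_sum => i _; rewrite -{1}(subnKC (ltnSE (ltn_ord i))).
  by apply: sectionsM; exact: comp_section.
- case: (comp_finite a) (comp_finite b) => [M aM] [N bN].
  exists (M + N)%N => n MNn; apply: big1 => i _.
  have [Mi|iM] := leqP M i; first by rewrite aM // mul0r.
  rewrite bN ?iter_pullback0 ?mulr0 // leq_subRL; last exact: ltnSE.
  by rewrite (leq_trans _ MNn) // leq_add2r ltnW.
Defined.

Definition thcr_opp (a : thcr) := thcr_scale (-1) a.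

Lemma thcr_addA : associative thcr_add.
Proof. by move=> a b c; apply: thcr_eq => n /=; rewrite addrA. Qed.

Lemma thcr_addC : commutative thcr_add.
Proof. by move=> a b; apply: thcr_eq => n /=; rewrite addrC. Qed.

Lemma thcr_add0 : left_id thcr_zero thcr_add.
Proof. by move=> a; apply: thcr_eq => n /=; rewrite add0r. Qed.

Lemma thcr_addN : left_inverse thcr_zero thcr_opp thcr_add.
Proof. by move=> a; apply: thcr_eq => n /=; rewrite scaleN1r addNr. Qed.

HB.instance Definition _ :=
  GRing.isZmodule.Build thcr thcr_addA thcr_addC thcr_add0 thcr_addN.

Lemma thcr_mul_rev (a b : thcr) n :
  thcr_mul a b n = \sum_(k < n.+1) a (n - k)%N * iter (n - k) (pullback s) (b k).
Proof.
rewrite /= (reindex_inj rev_ord_inj) /=; apply: eq_bigr => k _.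
by rewrite subSS subKn // -ltnS.
Qed.

Lemma thcr_mulA : associative thcr_mul.
Proof.
move=> a b c; apply: thcr_eq => n; rewrite [RHS]thcr_mul_rev.
pose F j k := a j * iter j (pullback s)
  (b (n - j - k)%N * iter (n - j - k) (pullback s) (c k)).
transitivity (\sum_(j < n.+1) \sum_(k < n.+1 | (k <= n - j)%N) F j k).
  apply: eq_bigr => /= j _; rewrite -[\sum_(_ < _) _]/(thcr_mul b c (n - j)%N).
  rewrite thcr_mul_rev iter_pullback_sum mulr_sumr.
  by rewrite (big_ord_narrow_leq (leq_subr _ _)).
rewrite (exchange_big_dep predT) //=; apply: eq_bigr => k _.
transitivity (\sum_(j < n.+1 | (j <= n - k)%N) F j k).
  apply: eq_bigl => j; rewrite -ltnS -(ltnS j) -!subSn ?leq_ord //.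
  by rewrite -subn_gt0 -(subn_gt0 j) -!subnDA addnC.
rewrite (big_ord_narrow_leq (leq_subr _ _)) mulr_suml /=.
apply: eq_bigr => j _; rewrite /F /= iter_pullbackM mulrA subnAC -iterD.
by rewrite subnKC // -ltnS.
Qed.

Lemma thcr_mul1 : left_id thcr_one thcr_mul.
Proof.
move=> a; apply: thcr_eq => n /=; rewrite big_ord_recl /= mul1r subn0.
by rewrite big1 ?addr0 // => i _; rewrite mul0r.
Qed.

Lemma thcr_mulr1 : right_id thcr_one thcr_mul.
Proof.
move=> a; apply: thcr_eq => n /=; rewrite big_ord_recr /= subnn.
rewrite iter_pullback1 mulr1 big1 ?add0r // => i _.
have : (0 < n - i)%N by rewrite subn_gt0.
by case: (n - i)%N => // m _; rewrite iter_pullback0 mulr0.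
Qed.

Lemma thcr_mulDl : left_distributive thcr_mul thcr_add.
Proof.
move=> a b c; apply: thcr_eq => n /=; rewrite -big_split /=.
by apply: eq_bigr => i _; rewrite mulrDl.
Qed.

Lemma thcr_mulDr : right_distributive thcr_mul thcr_add.
Proof.
move=> a b c; apply: thcr_eq => n /=; rewrite -big_split /=.
by apply: eq_bigr => i _; rewrite iter_pullbackD mulrDr.
Qed.

HB.instance Definition _ := GRing.Zmodule_isPzRing.Build thcr
  thcr_mulA thcr_mul1 thcr_mulr1 thcr_mulDl thcr_mulDr.

Lemma thcr_scaleA c d a : thcr_scale c (thcr_scale d a) = thcr_scale (c * d) a.
Proof. by apply: thcr_eq => n /=; rewrite scalerA. Qed.

Lemma thcr_scale1 : left_id 1 thcr_scale.
Proof. by move=> a; apply: thcr_eq => n /=; rewrite scale1r. Qed.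

Lemma thcr_scaleDr : right_distributive thcr_scale +%R.
Proof. by move=> c a b; apply: thcr_eq => n /=; rewrite scalerDr. Qed.

Lemma thcr_scaleDl a : {morph thcr_scale^~ a : c d / c + d}.
Proof. by move=> c d; apply: thcr_eq => n /=; rewrite scalerDl. Qed.

HB.instance Definition _ := GRing.Zmodule_isLmodule.Build C thcr
  thcr_scaleA thcr_scale1 thcr_scaleDr thcr_scaleDl.

Lemma thcr_scaleAl (c : C) (a b : thcr) : c *: (a * b) = (c *: a) * b.
Proof.
apply: thcr_eq => n /=; rewrite scaler_sumr; apply: eq_bigr => i _.
exact: mulrA.
Qed.

Definition thcr_homog n : set thcr :=
  [set a | forall m, m != n -> a m = 0].

End TwistedRing.

Definition projective_space (C : closedFieldType) n : variety C :=
  Variety 1 n setT.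

Definition subvariety (C : closedFieldType) (X : variety C) (Z : set (pt X)) :
    variety C :=
  Variety (vk X) (vn X) [set A | exists2 a : pt X, Z a & sval a = A].

Lemma subvariety_sub (C : closedFieldType) (X : variety C) (Z : set (pt X))
  (b : pt (subvariety Z)) : normalized_point (sval b) /\ @vmem C X (sval b).
Proof. by case: b => A /= [_ [a _ <-]]; exact: (svalP a). Qed.

Definition inclusion (C : closedFieldType) (X : variety C) (Z : set (pt X))
    (b : pt (subvariety Z)) : pt X :=
  exist _ (sval b) (subvariety_sub b).

Section MinusOneCurves.
Variables (C : closedFieldType) (X : variety C).

(* The restriction along h : P^1 -> X of the invertible sheaf L, which is
   assumed to be embedded in the rational functions in such a way that its
   sections can be restricted, is equal to M. *)
Definition restricts_to (L : pt X -> set (ratfun X))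
    (h : pt (projective_space C 1) -> pt X)
    (M : pt (projective_space C 1) -> set (ratfun (projective_space C 1))) :=
  forall b, (forall u, L (h b) u -> exists2 v, M b v & restricts h u v) /\
            (forall v, M b v -> exists2 u, L (h b) u & restricts h u v).

(* A smooth rational curve Z with self-intersection -1.  The self-intersection
   of Z is the degree of the restriction of O(Z) to Z; thus it is -1 iff this
   restriction is isomorphic to O_{P^1}(-1), the ideal sheaf of a point c of
   P^1.  Multiplying O(Z) by an invertible rational function t replaces it by
   an isomorphic sheaf; for suitable t its sections can be restricted to Z. *)
Definition minus_one_curve (Z : set (pt X)) :=
  zclosed Z /\
  exists h : pt (projective_space C 1) -> pt (subvariety Z),
    isomorphism h /\
    exists (t t' : ratfun X) (c : pt (projective_space C 1)),
      t * t' = 1 /\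
      restricts_to (fun p => [set t * u | u in divisor_sheaf Z p])
        (fun b => inclusion (h b)) (ideal_stalk [set c]).

Definition has_order (s : automorphism X) n :=
  [/\ (0 < n)%N, iter n s =1 id
    & forall m, (0 < m < n)%N -> ~ iter m s =1 id].

(* The elements of [P] are pairwise distinct sets K_0, ..., K_5, and
   s(K_i) = K_{i+1}, where i is taken modulo 6. *)
Definition cyclically_permutes_six (s : automorphism X)
    (P : set (set (pt X))) :=
  exists K : 'I_6 -> set (pt X),
    [/\ injective K, P = range K & forall i, s @` K i = K (ordS i)].

End MinusOneCurves.

Section BlowUp.
Variable C : closedFieldType.

(* The line with equation l_0 x_0 + l_1 x_1 + l_2 x_2 = 0 is represented by the
   row vector l. *)
Definition non_collinear (p : 'I_3 -> pt (projective_space C 2)) :=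
  ~ exists l : 'rV[C]_3, l != 0 /\ forall i, l *m (sval (p i))^T = 0.

(* The blow-up of P^2 at one point q is the set of the pairs (x, l) where l is a
   line through q and x is a point of l.  The blow-up at three distinct points
   is the fibre product over P^2 of the three blow-ups: the set of (x, l_1, l_2,
   l_3) where l_i is a line through p_i and x is a point of each l_i. *)
Definition blow_up3 (p : 'I_3 -> pt (projective_space C 2)) : variety C :=
  Variety 4 2 [set A : 'M[C]_(4, 3) | forall i : 'I_3,
    row (lift ord0 i) A *m (sval (p i))^T = 0 /\
    row (lift ord0 i) A *m (row ord0 A)^T = 0].

End BlowUp.

Section QuotientAlgebra.
Variables (C : comNzRingType) (A : lalgType C) (S : set A).
Implicit Types (a b c : A).

Definition two_sided_ideal : set A :=
  [set a | exists n (u r v : 'I_n -> A),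
     (forall i, S (r i)) /\ a = \sum_i u i * r i * v i].

Lemma two_sided_ideal0 : two_sided_ideal 0.
Proof.
by exists 0%N, (fun=> 0), (fun=> 0), (fun=> 0); split=> [[]//|]; rewrite big_ord0.
Qed.

Lemma two_sided_idealD a b : two_sided_ideal a -> two_sided_ideal b ->
  two_sided_ideal (a + b).
Proof.
move=> [n [u [r [v [Sr ->]]]]] [n' [u' [r' [v' [Sr' ->]]]]].
pose glue (f : 'I_n -> A) (g : 'I_n' -> A) (i : 'I_(n + n')) :=
  match split i with inl j => f j | inr j => g j end.
exists (n + n')%N, (glue u u'), (glue r r'), (glue v v'); split.
  by move=> i; rewrite /glue; case: split.
rewrite big_split_ord /glue /=; congr (_ + _); apply: eq_bigr => i _.
  by rewrite -[lshift n' i]/(unsplit (inl i)) unsplitK.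
by rewrite -[rshift n i]/(unsplit (inr i)) unsplitK.
Qed.

Lemma two_sided_idealMl c a : two_sided_ideal a -> two_sided_ideal (c * a).
Proof.
move=> [n [u [r [v [Sr ->]]]]]; exists n, (fun i => c * u i), r, v; split=> //.
by rewrite mulr_sumr; apply: eq_bigr => i _; rewrite !mulrA.
Qed.

Lemma two_sided_idealMr c a : two_sided_ideal a -> two_sided_ideal (a * c).
Proof.
move=> [n [u [r [v [Sr ->]]]]]; exists n, u, r, (fun i => v i * c); split=> //.
by rewrite mulr_suml; apply: eq_bigr => i _; rewrite !mulrA.
Qed.

Definition ideal_pred : {pred A} := fun a => `[< two_sided_ideal a >].

Lemma ideal_pred_closed : zmod_closed ideal_pred.
Proof.
split; first by apply/asboolP; exact: two_sided_ideal0.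
move=> a b /asboolP Ia /asboolP Ib; apply/asboolP; apply: two_sided_idealD => //.
by rewrite -mulN1r; exact: two_sided_idealMl.
Qed.

HB.instance Definition _ := GRing.isZmodClosed.Build A ideal_pred ideal_pred_closed.

(* The quotient of A by the two-sided ideal generated by S *)
Definition quotient_algebra := {ideal_quot ideal_pred}.

HB.instance Definition _ := EqQuotient.on quotient_algebra.
HB.instance Definition _ := GRing.Zmodule.on quotient_algebra.

Definition qa_pi (a : A) : quotient_algebra := \pi_quotient_algebra a.

Lemma qa_eq a b : qa_pi a = qa_pi b <-> two_sided_ideal (a - b).
Proof.
rewrite /qa_pi; split.
  by move/eqP; rewrite -Quotient.idealrBE => /asboolP.
by move=> Iab; apply/eqP; rewrite -Quotient.idealrBE; apply/asboolP.
Qed.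

Lemma qa_reprK (a : quotient_algebra) : qa_pi (repr a) = a.
Proof. exact: reprK. Qed.

Lemma qa_piD : {morph qa_pi : a b / a + b}.
Proof. by move=> a b; rewrite /qa_pi !piE. Qed.

Definition qa_one : quotient_algebra := qa_pi 1.
Definition qa_mul (a b : quotient_algebra) : quotient_algebra :=
  locked (qa_pi (repr a * repr b)).
Definition qa_scale (k : C) (a : quotient_algebra) : quotient_algebra :=
  locked (qa_pi (k *: repr a)).

Lemma qa_piM a b : qa_pi (a * b) = qa_mul (qa_pi a) (qa_pi b).
Proof.
rewrite /qa_mul -lock; apply/qa_eq; set a' := repr (qa_pi a); set b' := repr (qa_pi b).
have Ia : two_sided_ideal (a - a') by apply/qa_eq; rewrite qa_reprK.
have Ib : two_sided_ideal (b - b') by apply/qa_eq; rewrite qa_reprK.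
have -> : a * b - a' * b' = (a - a') * b + a' * (b - b').
  by rewrite mulrBl mulrBr addrA subrK.
by apply: two_sided_idealD; [exact: two_sided_idealMr|exact: two_sided_idealMl].
Qed.

Lemma qa_piZ k a : qa_pi (k *: a) = qa_scale k (qa_pi a).
Proof.
rewrite /qa_scale -lock; apply/qa_eq; set a' := repr (qa_pi a).
have Ia : two_sided_ideal (a - a') by apply/qa_eq; rewrite qa_reprK.
by rewrite -scalerBr -[a - a']mul1r scalerAl; exact: two_sided_idealMl.
Qed.

Lemma qa_mulA : associative qa_mul.
Proof.
by move=> a b c; rewrite -[a]qa_reprK -[b]qa_reprK -[c]qa_reprK -!qa_piM mulrA.
Qed.

Lemma qa_mul1 : left_id qa_one qa_mul.
Proof. by move=> a; rewrite -[a]qa_reprK -qa_piM mul1r. Qed.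

Lemma qa_mulr1 : right_id qa_one qa_mul.
Proof. by move=> a; rewrite -[a]qa_reprK -qa_piM mulr1. Qed.

Lemma qa_mulDl : left_distributive qa_mul +%R.
Proof.
move=> a b c; rewrite -[a]qa_reprK -[b]qa_reprK -[c]qa_reprK.
by rewrite -!(qa_piM, qa_piD) mulrDl.
Qed.

Lemma qa_mulDr : right_distributive qa_mul +%R.
Proof.
move=> a b c; rewrite -[a]qa_reprK -[b]qa_reprK -[c]qa_reprK.
by rewrite -!(qa_piM, qa_piD) mulrDr.
Qed.

HB.instance Definition _ := GRing.Zmodule_isPzRing.Build quotient_algebra
  qa_mulA qa_mul1 qa_mulr1 qa_mulDl qa_mulDr.

Lemma qa_scaleA k l (a : quotient_algebra) : qa_scale k (qa_scale l a) = qa_scale (k * l) a.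
Proof. by rewrite -[a]qa_reprK -!qa_piZ scalerA. Qed.

Lemma qa_scale1 : left_id 1 qa_scale.
Proof. by move=> a; rewrite -[a]qa_reprK -qa_piZ scale1r. Qed.

Lemma qa_scaleDr : right_distributive qa_scale +%R.
Proof.
move=> k a b; rewrite -[a]qa_reprK -[b]qa_reprK.
by rewrite -!(qa_piZ, qa_piD) scalerDr.
Qed.

Lemma qa_scaleDl (a : quotient_algebra) : {morph qa_scale^~ a : k l / k + l}.
Proof. by move=> k l; rewrite -[a]qa_reprK -!qa_piZ scalerDl qa_piD. Qed.

HB.instance Definition _ := GRing.Zmodule_isLmodule.Build C quotient_algebra
  qa_scaleA qa_scale1 qa_scaleDr qa_scaleDl.

Lemma qa_pi_zmod_morphism : zmod_morphism qa_pi.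
Proof.
move=> a b; apply: (addIr (qa_pi b)).
by rewrite -qa_piD !subrK.
Qed.

Lemma qa_pi_monoid_morphism : monoid_morphism qa_pi.
Proof. by split=> // a b; exact: qa_piM. Qed.

Lemma qa_pi_scalable : scalable qa_pi.
Proof. by move=> k a; exact: qa_piZ. Qed.

HB.instance Definition _ :=
  GRing.isZmodMorphism.Build A quotient_algebra qa_pi qa_pi_zmod_morphism.
HB.instance Definition _ :=
  GRing.isMonoidMorphism.Build A quotient_algebra qa_pi qa_pi_monoid_morphism.
HB.instance Definition _ :=
  GRing.isScalable.Build C A quotient_algebra *:%R qa_pi qa_pi_scalable.

Lemma qa_scaleAl k (a b : quotient_algebra) : k *: (a * b) = (k *: a) * b.
Proof.
by rewrite -[a]qa_reprK -[b]qa_reprK -rmorphM -!qa_pi_scalable scalerAl rmorphM.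
Qed.

End QuotientAlgebra.

Section TheAlgebra.
Variable C : closedFieldType.

(* C<x, y> is the algebra of the free monoid on the two letters 0 and 1. *)
Local Notation free_algebra := {malg C[{fmonom 'I_2}]}.

Definition gen_x : free_algebra := << fmu (0 : 'I_2) >>.
Definition gen_y : free_algebra := << fmu (1 : 'I_2) >>.

Definition the_relations : set free_algebra :=
  [set gen_x ^+ 5 - gen_y * gen_x * gen_y; gen_y ^+ 2 - gen_x * gen_y * gen_x].

Definition algR := quotient_algebra the_relations.

(* deg x = 1 and deg y = 2 *)
Definition word_weight (m : {fmonom 'I_2}) : nat :=
  (\sum_(i <- fmonom_val m) (nat_of_ord i).+1)%N.

Definition algR_pi : free_algebra -> algR := qa_pi the_relations.

Definition free_homog n : set free_algebra :=
  [set f | forall m, monalg.mcoeff m f != 0 -> word_weight m = n].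

Definition algR_homog n : set algR :=
  algR_pi @` free_homog n.

End TheAlgebra.

(* Main.v *)
Require Import Defs.
From HB Require Import structures.
From mathcomp Require Import all_boot all_order all_algebra.
From mathcomp Require Import boolp classical_sets reals complex.
From mathcomp Require Import finmap monalg mpoly ring zify.
Import GRing.Theory.
Local Open Scope ring_scope.
Local Open Scope classical_set_scope.

(** The surface is toric: the complement of the hexagon of its six (-1)-curves
    E_0, ..., E_5 is a torus, and six affine planes cover the surface.  The k-th
    plane has coordinates w_k and w_(k+2), and its axes lie on E_k and E_(k+1).
    The characters w_k of the torus satisfy w_(k+1) = w_k w_(k+2) and
    w_(k+3) = 1 / w_k, so every monomial is some w_0^a w_1^b.  A rational function
    on a plane that is regular at every point is a polynomial (regular_is_poly),
    so the sections of a divisor supported on the hexagon are spanned by the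
    monomials whose orders along the six edges are bounded below
    (laurent_sections).  All this holds for any variety with such a system of
    charts (hex_atlas), and Cox coordinates provide one for the blow-up of three
    points that are not collinear (blow_up_hex_atlas).

    The six edges of the hexagon are (-1)-curves (edge_minus_one).  As there are
    only six such curves to be permuted, there are no others, and an automorphism
    that permutes them cyclically rotates the hexagon by one step, because it
    preserves incidence (edge_rotation).  Number the edges so that E_0 is the given
    curve and the preimage of E_i is E_(i+1).  The pullback of w_k has the divisor
    of w_(k+1); the quotient of the two is regular everywhere, hence constant, and
    the constants disappear when the origin of the torus is moved to the fixed
    point of the rotation (rotation_coordinates).

    Hence the n-th twisted power of O(E_0) is the sheaf of the divisor
    E_0 + ... + E_(n-1), with indices modulo 6, and its sections are spanned by the
    monomials with exponents in a polygon (twisted_sections).  Products of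
    monomials are monomials: degrees add up, and the exponent m' of the right
    factor is rotated n times before it is added to the exponent of the left
    factor of degree n.  Send x to the section 1 of degree 1 and y to the section
    1 / w_1 of degree 2.  Both defining relations hold for these monomials.  Every
    monomial section of positive degree is divisible on the left by x or by y
    (polygon_divides), so words in x and y give all of them.  If it is divisible
    by both, it is divisible by x^5 = yxy or by y^2 = xyx (polygon_common); by
    induction, words with the same value are equal modulo the relations
    (word_value_unique).  As distinct monomials are linearly independent
    (laurent_comb_inj), the homomorphism is bijective (twisted_ring_iso). *)

Set Implicit Arguments.
Unset Strict Implicit.
Unset Printing Implicit Defensive.

Local Notation gen_eq := Defs.gen_eq.
Local Notation Z2 := (int * int)%type.
Local Notation lx := (0 : 'I_2).
Local Notation ly := (1 : 'I_2).

(** * Polynomials in two variables *)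

Section BivariatePolynomials.
Variable C : closedFieldType.
Implicit Types (F G : {poly {poly C}}).

Definition poly2 := {poly {poly C}}.

Lemma horner_neq0 (p : {poly C}) : p != 0 -> exists x, p.[x] != 0.
Proof. by move=> /closed_nonrootP[x px]; exists x. Qed.

Lemma horner2_specialize F x y : F.[x, y] = (map_poly (horner_eval y) F).[x].
Proof. by rewrite -{2}(hornerC x y) -[_%:P.[y]]/(horner_eval y _) horner_map. Qed.

Lemma specialize_neq0 F y : (lead_coef F).[y] != 0 ->
  size (map_poly (horner_eval y) F) = size F.
Proof. by move=> h; rewrite size_map_poly_id0. Qed.

Lemma horner2_neq0 F : F != 0 -> exists x y, F.[x, y] != 0.
Proof.
rewrite -lead_coef_eq0 => /horner_neq0[y Fy].
have : map_poly (horner_eval y) F != 0.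
  rewrite -size_poly_eq0 specialize_neq0 // size_poly_eq0.
  by apply: contraNneq Fy => ->; rewrite lead_coef0 horner0.
by move=> /horner_neq0[x Fx]; exists x, y; rewrite horner2_specialize.
Qed.

Lemma divides_inner F y : (forall x, F.[x, y] = 0) ->
  exists F', F = F' * ('X - y%:P)%:P.
Proof.
move=> F0; exists (map_poly (fun q => q %/ ('X - y%:P)) F).
apply/polyP => i; rewrite coefMC coef_map_id0 ?div0p // divpK // dvdp_XsubCl.
have E0 : map_poly (horner_eval y) F = 0.
  apply/eqP; apply: contraT => /horner_neq0[x].
  by rewrite -horner2_specialize F0 eqxx.
by have := coef_map (horner_eval y) F i; rewrite E0 coef0 => /esym/eqP.
Qed.

Lemma divides_outer F x : (forall y, F.[x, y] = 0) ->
  exists F', F = F' * ('X - x%:P%:P).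
Proof.
move=> F0; have /eqP/factor_theorem[F' ->] : F.[x%:P] = 0; last by exists F'.
by apply/eqP; apply: contraT => /horner_neq0[y]; rewrite F0 eqxx.
Qed.

(** Over C(y) one may take F / G to be a reduced fraction F1 / G1; a Bezout
    relation then shows that G1 divides r(y) G' for a fixed r and for every
    denominator G' of F / G.  If G1 depended on x, it would vanish at a point
    of a line y = y0 with r(y0) <> 0, and so would every denominator. *)
Lemma denominator_in_y F G : G != 0 ->
  (forall x y, exists F' G', G'.[x, y] != 0 /\ F * G' = F' * G) ->
  exists2 r : {poly C}, r != 0 & exists F', F * r%:P = F' * G.
Proof.
move=> G0 reg; set h := gcdp F G.
have h0 : h != 0 by rewrite gcdp_eq0 negb_and G0 orbT.
have /Pdiv.Idomain.dvdpP[[a F1] /= a0 F1E] := dvdp_gcdl F G.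
have /Pdiv.Idomain.dvdpP[[b G1] /= b0 G1E] := dvdp_gcdr F G.
have [[e1 e2]/= /eqpP[[c d]/= /andP[c0 d0] bez]] := Bezoutp F G.
rewrite -/h in F1E G1E bez.
have G1n0 : G1 != 0.
  by apply: contraNneq G0 => z; move: G1E; rewrite z mul0r => /eqP; rewrite scale_poly_eq0 (negPf b0).
have divG1 F' G' : F * G' = F' * G -> (b * d) *: G' = G1 * (c *: (e1 * F' + e2 * G')).
  move=> FG'; apply: (mulIf h0); apply/eqP; rewrite -subr_eq0; apply/eqP.
  have -> : (b * d) *: G' * h = b *: G' * (c *: (e1 * F + e2 * G)).
    by rewrite bez -!mul_polyC polyCM; ring.
  rewrite -!mul_polyC.
  have E : b%:P * G = G1 * h by rewrite mul_polyC.
  transitivity (c%:P * ((b%:P * e1) * (F * G') + e2 * (b%:P * G) * G' -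
     (e1 * F' + e2 * G') * (G1 * h))); first by ring.
  by rewrite FG' -E; ring.
have [G1s|] := leqP (size G1) 1.
  have G1C := size1_polyC G1s.
  exists (a * G1`_0).
    rewrite mulf_neq0 //; apply: contraNneq G1n0 => z.
    by rewrite G1C z.
  exists (b *: F1); rewrite polyCM -G1C.
  transitivity ((a *: F) * G1); first by rewrite -mul_polyC; ring.
  by rewrite F1E mulrAC -mulrA -G1E -!mul_polyC; ring.
move=> G1s; have : b * d * lead_coef G1 != 0 by rewrite !mulf_neq0 // lead_coef_eq0.
move=> /horner_neq0[y]; rewrite !hornerM !mulf_eq0 !negb_or => /andP[/andP[by0 dy0] ly0].
have /closed_rootP[x] : size (map_poly (horner_eval y) G1) != 1%N.
  by rewrite specialize_neq0 //; case: (size G1) G1s => [|[]].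
rewrite /root -horner2_specialize => /eqP G1x.
have [F' [G' [G'n0 /divG1 E]]] := reg x y.
have := congr1 (fun f : poly2 => f.[x, y]) E.
rewrite !(hornerE, hornerM) /= G1x !mul0r => /eqP.
by rewrite !mulf_eq0 (negPf by0) (negPf dy0) (negPf G'n0).
Qed.

(** A rational function on the plane that is regular at every point is a
    polynomial.  A denominator r(y) of F / G can be divided by any y - y0 with
    r(y0) = 0: the numerator vanishes on the line y = y0, because at each point
    of that line there is also a denominator that does not vanish. *)
Lemma regular_is_poly F G : G != 0 ->
  (forall x y, exists F' G', G'.[x, y] != 0 /\ F * G' = F' * G) ->
  exists H, F = H * G.
Proof.
move=> G0 reg; have [r r0 [F' E]] := denominator_in_y G0 reg.
have [n] := ubnP (size r); elim: n r r0 F' E => // n IHn r r0 F' E rn.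
have [/size1_polyC rC|r1] := leqP (size r) 1.
  have c0 : r`_0 != 0 by apply: contraNneq r0 => z; rewrite rC z.
  exists ((r`_0)^-1%:P%:P * F'); rewrite -mulrA -E rC mulrCA -!polyCM coefC /=.
  by rewrite mulVf // mulr1.
have /closed_rootP[y] : size r != 1%N by case: (size r) r1 => [|[]].
move=> /factor_theorem[r' rE].
have r'0 : r' != 0 by apply: contraNneq r0; rewrite rE => ->; rewrite mul0r.
have F'0 x : F'.[x, y] = 0.
  have [F2 [G2 [G2n0 E2]]] := reg x y.
  have E3 : F' * G2 = F2 * r%:P.
    by apply: (mulIf G0); rewrite mulrAC -E mulrAC E2 mulrAC.
  have := congr1 (fun f : poly2 => f.[x, y]) E3.
  rewrite !(hornerE, hornerM) /= rE hornerM hornerXsubC subrr !mulr0 => /eqP.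
  by rewrite mulf_eq0 (negPf G2n0) orbF => /eqP.
have [F2 F2E] := divides_inner F'0; apply: (IHn r' r'0 F2).
  apply: (@mulIf _ ('X - y%:P)%:P); first by rewrite polyC_eq0 polyXsubC_eq0.
  by rewrite -mulrA -polyCM -rE E F2E mulrAC.
by move: rn; rewrite rE size_Mmonic ?monicXsubC // size_XsubC addn2 /=.
Qed.

End BivariatePolynomials.

(** * Regular functions in charts *)

Section OpenSets.
Variables (C : closedFieldType) (X : variety C).
Implicit Types (U V : set (pt X)) (f g : pt X -> C).

Lemma zopen_local U :
  (forall a, U a -> exists V, [/\ zopen V, V a & V `<=` U]) -> zopen U.
Proof.
move=> loc a /loc[V [oV Va VU]]; have [d [F [hF Fa FV]]] := oV a Va.
by exists d, F; split=> // b /FV /VU.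
Qed.

Lemma zopen_nonzero U f : regular_on U f -> zopen [set a | U a /\ f a != 0].
Proof.
move=> rf; apply: zopen_local => a [Ua fa].
have [V [d [F [G [[oV Va VU] [hF hG fE]]]]]] := rf a Ua.
have [e [H [hH Ha HV]]] := oV a Va.
have Fa : ev F a != 0.
  by apply: contraNneq fa => Fa; have [_ ->] := fE a Va; rewrite Fa mul0r.
exists [set b | ev (F * H) b != 0]; split.
- move=> b Fb; exists (fun i => (d i + e i)%N), (F * H); split=> //.
  exact: mhomogM.
- by rewrite /= /ev mxevalM mulf_neq0.
move=> b; rewrite /= /ev mxevalM mulf_eq0 negb_or => /andP[Fb /HV Vb].
by split; [exact: VU | have [Gb ->] := fE b Vb; rewrite mulf_neq0 ?invr_eq0].
Qed.

Lemma regular_onV U f : regular_on U f -> (forall a, U a -> f a != 0) ->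
  regular_on U (fun a => (f a)^-1).
Proof.
move=> rf f0 a Ua; have [V [d [F [G [[oV Va VU] [hF hG fE]]]]]] := rf a Ua.
exists V, d, G, F; do 2![split=> //] => b Vb.
have := f0 b (VU _ Vb); have [Gb ->] := fE b Vb.
by rewrite invf_div mulf_eq0 negb_or => /andP[].
Qed.

Definition irreducible := forall U, zopen U -> U !=set0 -> zdense U.

Lemma irreducible_odense U : irreducible -> zopen U -> U !=set0 -> odense U.
Proof. by move=> irr oU U0; split=> //; exact: irr. Qed.

Lemma odense_neq0 U (a : pt X) : odense U -> U !=set0.
Proof.
move=> [_ dU]; have [|b [Ub _]] := dU setT (@zopenT _ _); first by exists a.
by exists b.
Qed.

End OpenSets.

(** A chart is a parametrization of an open set by a space T that carries a
    ring A of functions, e t f being the value of f at t: forms restrict to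
    elements of A, up to a nowhere vanishing factor that depends only on the
    degree, and elements of A are regular functions on the image. *)
Record chart (C : closedFieldType) (X : variety C) (T : Type)
    (A : comNzRingType) (e : T -> {rmorphism A -> C}) (c : T -> pt X) : Prop :=
  Chart {
    chart_form : forall d, exists m : T -> C, (forall t, m t != 0) /\
      forall F, mhomog d F -> exists f, forall t, ev F (c t) = m t * e t f;
    chart_open : zopen (range c);
    chart_fun : forall f, exists2 h, regular_on (range c) h &
      forall t, h (c t) = e t f
  }.

Section Chart.
Variables (C : closedFieldType) (X : variety C) (T : Type).
Variables (A : comNzRingType) (e : T -> {rmorphism A -> C}) (c : T -> pt X).
Hypothesis chc : chart e c.
Implicit Types (U V Z : set (pt X)) (F G H : A).

Lemma chart_nbhs U t0 : zopen U -> U (c t0) ->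
  exists2 g, e t0 g != 0 & forall t, e t g != 0 -> U (c t).
Proof.
move=> oU Uc; have [d [F [hF F0 FU]]] := oU _ Uc.
have [m [m0 /(_ F hF)[f fE]]] := chart_form chc d.
exists f; first by move: F0; rewrite fE mulf_eq0 negb_or => /andP[].
by move=> t ft; apply: FU; rewrite fE mulf_neq0.
Qed.

Lemma chart_basic_open G : zopen (c @` [set t | e t G != 0]).
Proof.
have [h rh hE] := chart_fun chc G.
have -> : c @` [set t | e t G != 0] = [set a | range c a /\ h a != 0].
  apply/seteqP; split=> [a [t Gt <-]|a [[t _ <-]]]; last by rewrite hE; exists t.
  by split; [exists t | rewrite hE].
exact: zopen_nonzero.
Qed.

(** Numerator and denominator of a regular function are forms of the same degree,
    so the unit factors by which they differ from elements of A cancel. *)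
Lemma chart_regular U f t0 : regular_on U f -> U (c t0) ->
  exists F G, e t0 G != 0 /\
    forall t, e t G != 0 -> U (c t) /\ f (c t) = e t F / e t G.
Proof.
move=> rf Uc; have [V [d [F [G [[oV Vc VU] [hF hG fE]]]]]] := rf _ Uc.
have [m [m0 mE]] := chart_form chc d.
have [F1 FE] := mE F hF; have [G1 GE] := mE G hG.
have [g g0 gV] := chart_nbhs oV Vc.
have key t : e t g != 0 -> V (c t) /\ e t G1 != 0.
  move=> /gV Vt; split=> //; have [] := fE _ Vt.
  by rewrite GE mulf_eq0 negb_or => /andP[].
exists (F1 * g), (G1 * g); split; first by rewrite rmorphM mulf_neq0 ?(key t0 g0).2.
move=> t; rewrite !rmorphM mulf_eq0 negb_or => /andP[G1t gt].
have [Vt _] := key t gt; split; first exact: VU.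
by have [_ ->] := fE _ Vt; rewrite FE GE -mulf_div divff // mul1r -mulf_div divff // mulr1.
Qed.

Lemma chart_quotient F G : exists2 h,
  regular_on (c @` [set t | e t G != 0]) h &
  forall t, e t G != 0 -> h (c t) = e t F / e t G.
Proof.
have [h rh hE] := chart_fun chc F; have [k rk kE] := chart_fun chc G.
exists (fun a => h a / k a) => [|t _]; last by rewrite hE kE.
have oG := @chart_basic_open G.
have sub : c @` [set t | e t G != 0] `<=` range c by move=> a [t _ <-]; exists t.
apply: regular_onM; first exact: regular_onS rh.
apply: regular_onV; first exact: regular_onS rk.
by move=> _ [t tG <-]; rewrite kE.
Qed.

Lemma chart_value F t t' : c t = c t' -> e t F = e t' F.
Proof. by move=> tt'; have [h _ hE] := chart_fun chc F; rewrite -!hE tt'. Qed.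

End Chart.
Arguments chart_basic_open {C X T A e c} chc G.

Section RationalFunctions.
Variables (C : closedFieldType) (X : variety C) (T : Type).
Variables (A : idomainType) (e : T -> {rmorphism A -> C}) (c : T -> pt X).
Hypothesis irrX : irreducible X.
Hypothesis chc : chart e c.
Hypothesis faithful : forall f : A, f != 0 -> exists t, e t f != 0.
Implicit Types (U V Z : set (pt X)) (F G H : A) (u v w : ratfun X) (f h : pt X -> C).

(** On the chart c the rational function u is the fraction F / G.  The equation is
    multiplied out, so that G may vanish at some points of the open set. *)
Definition rat u F G := exists U, [/\ zopen U, U !=set0 &
  forall t, U (c t) -> e t G * repr u (c t) = e t F].

(** A nonempty open set meets the chart in a set that contains the complement of
    the zeros of some function. *)
Lemma chart_dense U : zopen U -> U !=set0 ->
  exists2 g, g != 0 & forall t, e t g != 0 -> U (c t).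
Proof.
move=> oU U0; have [t0 _] := faithful (oner_neq0 A).
have [|b [Ub [t _ tb]]] := irrX oU U0 (chart_open chc).
  by exists (c t0), t0.
rewrite -tb in Ub; have [g gt gU] := chart_nbhs chc oU Ub.
by exists g => //; apply: contraNneq gt => ->; rewrite rmorph0.
Qed.

Lemma eq_on_chart F G U : zopen U -> U !=set0 ->
  (forall t, U (c t) -> e t F = e t G) -> F = G.
Proof.
move=> oU U0 FG; have [g g0 gU] := chart_dense oU U0.
apply/eqP; rewrite -subr_eq0; apply: contraT => FG0.
have [t] := faithful (mulf_neq0 FG0 g0).
rewrite rmorphM rmorphB mulf_eq0 negb_or => /andP[h /gU /FG E].
by move: h; rewrite E subrr eqxx.
Qed.

Lemma open_meet U V : zopen U -> U !=set0 -> zopen V -> V !=set0 ->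
  zopen (U `&` V) /\ (U `&` V) !=set0.
Proof. by move=> oU U0 oV V0; split; [exact: zopenI | exact: irrX]. Qed.

Lemma pt_inhabited : exists a : pt X, True.
Proof. by have [t _] := faithful (oner_neq0 A); exists (c t). Qed.

Lemma gen_eq_open f h : gen_eq f h <->
  exists U, [/\ zopen U, U !=set0 & forall a : pt X, U a -> f a = h a].
Proof.
have [a0 _] := pt_inhabited; split=> [[U dU fg]|[U [oU U0 fg]]].
  by exists U; split=> //; [case: dU | exact: odense_neq0 a0 dU].
by exists U => //; exact: irreducible_odense.
Qed.

Lemma rat_intro u f U F G : gen_eq (repr u) f -> zopen U -> U !=set0 ->
  (forall t, U (c t) -> e t G * f (c t) = e t F) -> rat u F G.
Proof.
move=> /gen_eq_open[V [oV V0 uf]] oU U0 fE.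
have [oW W0] := open_meet oU U0 oV V0.
by exists (U `&` V); split=> // t [Ut Vt]; rewrite uf // fE.
Qed.

Lemma rat_det u F G F' G' : rat u F G -> rat u F' G' -> F * G' = F' * G.
Proof.
move=> [U [oU U0 uE]] [V [oV V0 vE]]; have [oW W0] := open_meet oU U0 oV V0.
apply: (eq_on_chart oW W0) => t [Ut Vt].
by rewrite !rmorphM -uE // -vE //; ring.
Qed.

Lemma basic_open_neq0 G : G != 0 -> c @` [set t | e t G != 0] !=set0.
Proof. by move=> /faithful[t tG]; exists (c t), t. Qed.

Lemma rat_equiv u F G F' G' : G != 0 -> rat u F G -> F * G' = F' * G ->
  rat u F' G'.
Proof.
move=> G0 [U [oU U0 uE]] FG.
have [oW W0] := open_meet oU U0 (chart_basic_open chc G) (basic_open_neq0 G0).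
exists (U `&` c @` [set t | e t G != 0]); split=> // t [Ut [t' /= tG tt']].
rewrite (chart_value chc G tt') in tG; apply: (mulfI tG).
have := congr1 (e t) FG; rewrite !rmorphM -(uE t Ut) => h.
by rewrite [RHS]mulrC -h; ring.
Qed.

Lemma rat_eq u v F G F' G' : G != 0 -> G' != 0 -> rat u F G -> rat v F' G' ->
  F * G' = F' * G -> u = v.
Proof.
move=> G0 G'0 ru rv FG.
have {ru FG}[U [oU U0 uE]] := rat_equiv G0 ru FG; have [V [oV V0 vE]] := rv.
apply: ratfun_eq; apply/gen_eq_open.
have [oW W0] := open_meet oU U0 oV V0.
have [oW' W'0] := open_meet oW W0 (chart_basic_open chc G') (basic_open_neq0 G'0).
exists (U `&` V `&` c @` [set t | e t G' != 0]); split=> // a [[Ua Va] [t /= tG ta]].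
by apply: (mulfI tG); rewrite -ta uE ?ta // -vE ?ta.
Qed.

Lemma rat_cst (a : C) F : (forall t, e t F = a) -> rat (rf_cst X a) F 1.
Proof.
move=> Fa; apply: rat_intro (repr_cst _ _) (@zopenT _ _) _ _.
  by have [a0 _] := pt_inhabited; exists a0.
by move=> t _; rewrite rmorph1 mul1r Fa.
Qed.

Lemma rat1 : rat 1 1 1.
Proof. by apply: rat_cst => t; rewrite rmorph1. Qed.

Lemma ratM u v F G F' G' : rat u F G -> rat v F' G' ->
  rat (u * v) (F * F') (G * G').
Proof.
move=> [U [oU U0 uE]] [V [oV V0 vE]]; have [oW W0] := open_meet oU U0 oV V0.
apply: rat_intro (repr_mul _ _) oW W0 _ => t [Ut Vt].
by rewrite !rmorphM -uE // -vE //; ring.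
Qed.

Lemma ratD u v F F' G : rat u F G -> rat v F' G -> rat (u + v) (F + F') G.
Proof.
move=> [U [oU U0 uE]] [V [oV V0 vE]]; have [oW W0] := open_meet oU U0 oV V0.
apply: rat_intro (repr_add _ _) oW W0 _ => t [Ut Vt].
by rewrite rmorphD -uE // -vE //; ring.
Qed.

Lemma rat_inv u v F G : F != 0 -> G != 0 -> u * v = 1 -> rat u F G -> rat v G F.
Proof.
move=> F0 G0 uv1 [U [oU U0 uE]].
have /gen_eq_open[V [oV V0 vE]] : gen_eq (fun a => repr u a * repr v a) (fun=> 1).
  apply: gen_eq_trans (gen_eq_sym (repr_mul _ _)) _.
  by rewrite -[rf_mul u v]/(u * v) uv1; exact: repr_cst.
have [oW W0] := open_meet oU U0 oV V0; exists (U `&` V); split=> // t [Ut Vt].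
by rewrite -uE // -mulrA vE // mulr1.
Qed.

Lemma rat_represents u U f t0 : represents u U f -> U (c t0) ->
  exists F G, [/\ e t0 G != 0, rat u F G &
    forall t, e t G != 0 -> U (c t) /\ f (c t) = e t F / e t G].
Proof.
move=> [dU rU uf] Ut0; have [F [G [G0 fE]]] := chart_regular chc rU Ut0.
exists F, G; split=> //; apply: rat_intro uf (chart_basic_open chc G) _ _.
  by exists (c t0), t0.
move=> t [t' /= Gt' tt']; rewrite (chart_value chc G tt') in Gt'.
by have [_ ->] := fE t Gt'; rewrite mulrC divfK.
Qed.

Lemma rat_exists u : exists F G, G != 0 /\ rat u F G.
Proof.
have [U dU rU] := rr_reg (repr u); have [a0 _] := pt_inhabited.
have [g /faithful[t gt] gU] := chart_dense dU.1 (odense_neq0 a0 dU).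
have [||F [G [G0 ru _]]] := @rat_represents u U (repr u) t.
- by split=> //; exact: gen_eq_refl.
- exact: gU.
by exists F, G; split=> //; apply: contraNneq G0 => ->; rewrite rmorph0.
Qed.

Lemma represents_rat u F G h : G != 0 -> rat u F G ->
  regular_on (c @` [set t | e t G != 0]) h ->
  (forall t, e t G != 0 -> h (c t) = e t F / e t G) ->
  represents u (c @` [set t | e t G != 0]) h.
Proof.
move=> G0 [U [oU U0 uE]] rh hE; have oG := chart_basic_open chc G.
have G0' := basic_open_neq0 G0; split=> //; first exact: irreducible_odense.
apply/gen_eq_open; have [oW W0] := open_meet oU U0 oG G0'.
exists (U `&` c @` [set t | e t G != 0]); split=> // a [Ua [t /= tG ta]].
by rewrite -ta hE // -uE ?ta // mulrC mulKf.
Qed.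

Lemma rat_surj F G : G != 0 -> exists u, rat u F G.
Proof.
move=> G0; have [h rh hE] := chart_quotient chc F G.
have oG := chart_basic_open chc G; have G0' := basic_open_neq0 G0.
have reg : gen_regular h.
  by exists (c @` [set t | e t G != 0]) => //; exact: irreducible_odense.
exists (ratclass reg); apply: rat_intro (gen_eq_repr reg) oG G0' _.
move=> t [t' /= tG tt']; rewrite (chart_value chc G tt') in tG.
by rewrite hE // mulrC divfK.
Qed.

Lemma local_ring_rat u t0 :
  local_ring (c t0) u <-> exists F G, e t0 G != 0 /\ rat u F G.
Proof.
split=> [[U [f [Ut0 uf]]]|[F [G [tG ru]]]].
  by have [F [G [tG ru _]]] := rat_represents uf Ut0; exists F, G.
have [h rh hE] := chart_quotient chc F G.
exists (c @` [set t | e t G != 0]), h; split; first by exists t0.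
by apply: represents_rat ru rh hE; apply: contraNneq tG => ->; rewrite rmorph0.
Qed.

Lemma local_ring_poly u F t0 : rat u F 1 -> local_ring (c t0) u.
Proof. by move=> ru; apply/local_ring_rat; exists F, 1; rewrite rmorph1 oner_eq0. Qed.

(** The equation g of Z has multiplicity one: locally, it divides every function
    that vanishes on its zeros.  The factor H allows the division to take place
    in a neighbourhood of the point only. *)
Definition local_equation Z g := (forall t, Z (c t) <-> e t g = 0) /\
  forall t0 F G, e t0 G != 0 ->
    (forall t, e t G != 0 -> e t g = 0 -> e t F = 0) ->
    exists F' H, e t0 H != 0 /\ H * F = g * F'.

(** The ideal of Z is generated by the rational function w with the local
    equation g, and membership is tested by multiplication with its inverse. *)
Lemma ideal_stalk_rat Z g w w' u t0 : local_equation Z g -> g != 0 -> rat w g 1 ->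
  w * w' = 1 -> ideal_stalk Z (c t0) u <-> local_ring (c t0) (u * w').
Proof.
move=> [Zg div] g0 rw ww'; split=> [[U [f [Ut0 uf fZ]]]|].
  have [F [G [tG ru fE]]] := rat_represents uf Ut0.
  have [|F' [H [tH HF]]] := div t0 F G tG.
    move=> t Gt gt; have [Ut ft] := fE t Gt.
    have : f (c t) = 0 by apply: fZ => //; apply/Zg.
    by rewrite ft => /eqP; rewrite mulf_eq0 invr_eq0 (negPf Gt) orbF => /eqP.
  have G0 : G != 0 by apply: contraNneq tG => ->; rewrite rmorph0.
  have rw' := rat_inv g0 (oner_neq0 A) ww' rw.
  apply/local_ring_rat; exists F', (H * G); split; first by rewrite rmorphM mulf_neq0.
  apply: rat_equiv (ratM ru rw') _; first by rewrite mulf_neq0.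
  by rewrite mulr1; transitivity ((H * F) * G); [ring | rewrite HF; ring].
move=> [U [f [Ut0 uf]]]; have [h rh hE] := chart_fun chc g.
have E1 : c @` [set t | e t 1 != 0] = range c.
  by apply/seteqP; split=> a [t _ <-]; exists t => //=; rewrite rmorph1 oner_eq0.
have wh : represents w (range c) h.
  rewrite -E1; apply: (represents_rat (oner_neq0 A) rw); rewrite ?E1 // => t _.
  by rewrite hE rmorph1 divr1.
exists (U `&` range c), (fun a => f a * h a); split; first by split; last exists t0.
  by rewrite -[u]mulr1 -ww' [w * _]mulrC mulrA; exact: represents_mul.
move=> q [Uq [t _ tq]] Zq; rewrite -tq hE.
by have -> : e t g = 0; [apply/Zg; rewrite tq | rewrite mulr0].
Qed.

End RationalFunctions.

(** * Charts from homogeneous coordinates *)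

Lemma pt_eq (C : closedFieldType) (X : variety C) (a b : pt X) :
  sval a = sval b -> a = b.
Proof.
by case: a b => [A hA] [B hB] /= AB; subst B; congr exist; exact: Prop_irrelevance.
Qed.

Section Normalization.
Variables (C : closedFieldType) (k n : nat).
Implicit Types (A B : 'M[C]_(k, n.+1)) (D : 'I_k -> C).

Definition row_scale D A := \matrix_(i, j) (D i * A i j).

Lemma row_scaleE D A i j : row_scale D A i j = D i * A i j.
Proof. by rewrite mxE. Qed.

Lemma normalize_exists A : (forall i, exists j, A i j != 0) ->
  exists2 D, (forall i, D i != 0) & normalized_point (row_scale D A).
Proof.
move=> A0; have lead i : exists j, A i j != 0 /\ forall j' : 'I_n.+1, (j' < j)%N -> A i j' = 0.
  have [j0 Aj0] := A0 i; case: (arg_minnP (P := fun j => A i j != 0) val Aj0) => j Aj jmin.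
  exists j; split=> // j' lt; apply/eqP; apply: contraT => /jmin.
  by rewrite leqNgt lt.
have [J JP] := choice lead; exists (fun i => (A i (J i))^-1) => i.
  by rewrite invr_eq0; case: (JP i).
have [AJ A0J] := JP i; exists (J i); rewrite row_scaleE mulVf //; split=> // j' lt.
by rewrite row_scaleE (A0J j' lt) mulr0.
Qed.

(** The scaling factors are 1 because the first nonzero entries of the rows are
    at the same places. *)
Lemma normalized_unique A B D : normalized_point A -> normalized_point B ->
  (forall i j, A i j = D i * B i j) -> A = B.
Proof.
move=> nA nB AB; suff D1 i : D i = 1 by apply/matrixP => i j; rewrite AB D1 mul1r.
have [j [Aj A0]] := nA i; have [l [Bl B0]] := nB i.
suff jl : j = l by move: Aj; rewrite AB jl Bl mulr1.
have D0 : D i != 0.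
  by apply/eqP => Di; move: Aj; rewrite AB Di mul0r => /esym/eqP; rewrite oner_eq0.
apply/val_inj; case: (ltngtP j l) => // lt.
  by move: Aj; rewrite AB B0 // mulr0 => /esym/eqP; rewrite oner_eq0.
by have := A0 _ lt; rewrite AB Bl mulr1 => /eqP; rewrite (negPf D0).
Qed.

End Normalization.

Section LinearForms.
Variables (C : closedFieldType) (X : variety C).

Definition linear_form i (v : 'I_(vn X).+1 -> C) : cform X :=
  \sum_j (v j)%:MP * 'X_(mxvec_index i j).

Lemma mxeval_linear i v A : mxeval (linear_form i v) A = \sum_j v j * A i j.
Proof.
rewrite /mxeval /linear_form raddf_sum; refine (eq_bigr _ _) => j _ /=.
by rewrite mevalM mevalC mevalXU mxvecE.
Qed.

Lemma mhomog_linear i v : mhomog (fun l => (l == i : nat)) (linear_form i v).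
Proof.
move=> c A; rewrite !mxeval_linear.
have -> : \prod_l c l ^+ (l == i) = c i.
  by rewrite (bigD1 i) //= eqxx expr1 big1 ?mulr1 // => l /negPf ->; rewrite expr0.
by rewrite mulr_sumr; apply: eq_bigr => j _; rewrite mxE mulrCA.
Qed.

End LinearForms.

Section MatrixChart.
Variables (C : closedFieldType) (X : variety C) (T : Type).
Variables (A : comNzRingType) (e : T -> {rmorphism A -> C}) (c : T -> pt X).
Variables (k : {rmorphism C -> A}) (M : 'M[A]_(vk X, (vn X).+1)).
Variable D : T -> 'I_(vk X) -> C.
Hypothesis ek : forall t a, e t (k a) = a.
Hypothesis D0 : forall t i, D t i != 0.
Hypothesis cE : forall t, sval (c t) = row_scale (D t) (map_mx (e t) M).

Definition restrict_form (F : cform X) : A := mmap k (fun s => mxvec M 0 s) F.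

Lemma restrict_formE F t : e t (restrict_form F) = mxeval F (map_mx (e t) M).
Proof.
rewrite /restrict_form /mxeval /meval /mmap raddf_sum.
apply: eq_bigr => m _; rewrite /= rmorphM ek; congr (_ * _).
rewrite /mmap1 rmorph_prod; apply: eq_bigr => s _; rewrite rmorphXn; congr (_ ^+ _).
by case/mxvec_indexP: s => i j; rewrite !mxvecE mxE.
Qed.

Lemma matrix_chart_ev d F t : mhomog d F ->
  ev F (c t) = (\prod_i D t i ^+ d i) * e t (restrict_form F).
Proof. by move=> hF; rewrite /ev cE hF restrict_formE. Qed.

Lemma matrix_chart_form d : exists m : T -> C, (forall t, m t != 0) /\
  forall F, mhomog d F -> exists f, forall t, ev F (c t) = m t * e t f.
Proof.
exists (fun t => \prod_i D t i ^+ d i); split=> [t|F hF].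
  by apply/prodf_neq0 => i _; rewrite expf_neq0.
by exists (restrict_form F) => t; exact: matrix_chart_ev.
Qed.

Hypothesis oc : zopen (range c).
Definition extends f :=
  exists2 h : pt X -> C, regular_on (range c) h & forall t, h (c t) = e t f.

Lemma extends_cst a : extends (k a).
Proof. by exists (fun=> a); [exact: regular_on_cst | move=> t; rewrite ek]. Qed.

Lemma extendsD f g : extends f -> extends g -> extends (f + g).
Proof.
move=> [h rh hE] [h' rh' hE']; exists (fun a => h a + h' a).
  exact: regular_onD.
by move=> t; rewrite rmorphD hE hE'.
Qed.

Lemma extendsM f g : extends f -> extends g -> extends (f * g).
Proof.
move=> [h rh hE] [h' rh' hE']; exists (fun a => h a * h' a).
  exact: regular_onM.
by move=> t; rewrite rmorphM hE hE'.
Qed.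

(** Both linear forms have degree one in the row i and degree zero in the other
    rows, so that their quotient is a function of the point. *)
Lemma extends_ratio f i v w :
  (forall t, \sum_j w j * sval (c t) i j != 0) ->
  (forall t, \sum_j v j * sval (c t) i j = e t f * \sum_j w j * sval (c t) i j) ->
  extends f.
Proof.
move=> w0 vE; pose F : cform X := linear_form i v; pose G : cform X := linear_form i w.
exists (fun a => ev F a / ev G a); last first.
  by move=> t; rewrite /ev !mxeval_linear vE mulfK.
move=> a ca; exists (range c), (fun l => (l == i : nat)), F, G.
split; split=> //; try exact: mhomog_linear.
by move=> _ [t _ <-]; rewrite {1}/ev mxeval_linear.
Qed.

End MatrixChart.

Section EvaluationMorphisms.
Variable C : closedFieldType.

Definition eval1 (t : C) : {rmorphism {poly C} -> C} := horner_eval t.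

Definition eval2 (t : C * C) : {rmorphism {poly {poly C}} -> C} :=
  horner_eval t.2 \o horner_eval t.1%:P.

Lemma eval1E t f : eval1 t f = f.[t]. Proof. by []. Qed.

Lemma eval2E t f : eval2 t f = f.[t.1, t.2]. Proof. by []. Qed.

Lemma eval1_faithful (f : {poly C}) : f != 0 -> exists t, eval1 t f != 0.
Proof. exact: horner_neq0. Qed.

Lemma eval2_faithful (f : {poly {poly C}}) : f != 0 -> exists t, eval2 t f != 0.
Proof. by move=> /horner2_neq0[x [y f0]]; exists (x, y). Qed.

End EvaluationMorphisms.

(** Statements that are compatible with the ring operations need only be checked
    on constants and on the variable. *)
Lemma poly_generated (R : nzRingType) (P : {poly R} -> Prop) :
  (forall a, P a%:P) -> P 'X -> (forall f g, P f -> P g -> P (f + g)) ->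
  (forall f g, P f -> P g -> P (f * g)) -> forall f, P f.
Proof.
move=> PC PX PD PM; elim/poly_ind => [|f a Pf]; first by rewrite -polyC0; exact: PC.
by apply: PD; [exact: PM | exact: PC].
Qed.

Section PolynomialCharts.
Variables (C : closedFieldType) (X : variety C).

Lemma polynomial_chart1 (c : C -> pt X) (M : 'M[{poly C}]_(vk X, (vn X).+1)) D :
  (forall t i, D t i != 0) ->
  (forall t, sval (c t) = row_scale (D t) (map_mx (eval1 t) M)) ->
  zopen (range c) -> extends (@eval1 C) c 'X -> chart (@eval1 C) c.
Proof.
move=> D0 cE oc eX.
have ek t (a : C) : eval1 t (polyC a) = a by rewrite eval1E hornerC.
have H := matrix_chart_form (k := polyC : {rmorphism C -> {poly C}}) ek D0 cE.
split=> [d||]; [exact: H|exact: oc|].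
apply: poly_generated => // [a|f g|f g].
- exact: (extends_cst (k := polyC) ek oc).
- exact: extendsD.
- exact: extendsM.
Qed.

Lemma polynomial_chart2 (c : C * C -> pt X)
    (M : 'M[{poly {poly C}}]_(vk X, (vn X).+1)) D :
  (forall t i, D t i != 0) ->
  (forall t, sval (c t) = row_scale (D t) (map_mx (eval2 t) M)) ->
  zopen (range c) -> extends (@eval2 C) c 'X -> extends (@eval2 C) c 'X%:P ->
  chart (@eval2 C) c.
Proof.
move=> D0 cE oc eX eY.
have ek t (a : C) : eval2 t ((polyC \o polyC) a) = a by rewrite eval2E !hornerC.
have H := matrix_chart_form (k := polyC \o polyC : {rmorphism C -> {poly {poly C}}}) ek D0 cE.
split=> [d||]; [exact: H|exact: oc|].
apply: poly_generated => // [a|f g|f g]; [|exact: extendsD|exact: extendsM].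
elim/poly_generated: a => // [a|f g Hf Hg|f g Hf Hg].
- by exists (fun=> a); [exact: regular_on_cst | move=> t; rewrite ek].
- by rewrite polyCD; exact: extendsD.
- by rewrite polyCM; exact: extendsM.
Qed.

End PolynomialCharts.

(** * Gluing and restricting charts *)

Section ChartIsomorphism.
Variables (C : closedFieldType) (X Y : variety C) (I T : Type).
Variables (A : comNzRingType) (e : T -> {rmorphism A -> C}).
Variables (cx : I -> T -> pt X) (cy : I -> T -> pt Y).
Hypothesis chx : forall i, chart e (cx i).
Hypothesis chy : forall i, chart e (cy i).
Hypothesis coverx : forall a, exists i t, a = cx i t.

(** Regularity can be tested in charts, where h is the identity. *)
Lemma chart_morphism h : (forall i t, h (cx i t) = cy i t) -> morphism h.
Proof.
move=> hE; split=> [V oV|V f oV rf].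
  apply: zopen_local => a Va; have [i [t at_]] := coverx a.
  rewrite at_ /= hE in Va; have [g g0 gV] := chart_nbhs (chy i) oV Va.
  exists (cx i @` [set t | e t g != 0]); split.
  - exact: chart_basic_open.
  - by rewrite at_; exists t.
  - by move=> _ [t' /= gt <-]; rewrite hE; exact: gV.
move=> a Va; have [i [t at_]] := coverx a; rewrite at_ /= hE in Va.
have [F [G [G0 fE]]] := chart_regular (chy i) rf Va.
have [k rk kE] := chart_quotient (chx i) F G.
have [|W [d [F' [G' [[oW Wa WU] [hF hG kFG]]]]]] := rk a.
  by rewrite at_; exists t.
exists W, d, F', G'; split; split=> // b Wb.
  by have [t' /= Gt <-] := WU b Wb; rewrite hE; case: (fE t' Gt).
have [t' /= Gt tb] := WU b Wb; have [? <-] := kFG b Wb; split=> //.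
by rewrite -tb /= hE kE //; case: (fE t' Gt).
Qed.

End ChartIsomorphism.

(** The charts t and 1 / t of a projective line.  The gluing condition
    determines the line, so that two such systems of charts give an
    isomorphism. *)
Record line_atlas (C : closedFieldType) (X : variety C) (d : bool -> C -> pt X) :
    Prop := LineAtlas {
  line_chart : forall b, chart (@eval1 C) (d b);
  line_cover : forall a, exists b t, a = d b t;
  line_glue : forall b b' t t',
    d b t = d b' t' <-> (if b == b' then t = t' else t * t' = 1)
}.

Lemma line_atlas_iso (C : closedFieldType) (X Y : variety C)
    (dx : bool -> C -> pt X) (dy : bool -> C -> pt Y) :
  line_atlas dx -> line_atlas dy ->
  exists2 h : pt X -> pt Y, isomorphism h & forall b t, h (dx b t) = dy b t.
Proof.
move=> ax ay.
have [h hP] := choice (fun a => line_cover ax a).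
have [h2 h2P] := choice hP.
have [g gP] := choice (fun a => line_cover ay a).
have [g2 g2P] := choice gP.
have hE b t : dy (h (dx b t)) (h2 (dx b t)) = dy b t.
  by apply/(line_glue ay)/(line_glue ax); rewrite -h2P.
have gE b t : dx (g (dy b t)) (g2 (dy b t)) = dx b t.
  by apply/(line_glue ax)/(line_glue ay); rewrite -g2P.
exists (fun a => dy (h a) (h2 a)) => //; split.
  exact: (chart_morphism (line_chart ax) (line_chart ay) (line_cover ax)).
exists (fun a => dx (g a) (g2 a)); split.
- exact: (chart_morphism (line_chart ay) (line_chart ax) (line_cover ay)).
- by move=> a; rewrite gE -h2P.
- by move=> a; rewrite hE -g2P.
Qed.

Section Restriction.
Variables (C : closedFieldType) (X : variety C) (Z : set (pt X)).

Lemma inclusion_surj a : Z a -> exists b : pt (subvariety Z), inclusion b = a.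
Proof.
move=> Za; have h : normalized_point (sval a) /\ @vmem C (subvariety Z) (sval a).
  by split; [case: (svalP a) | exists a].
by exists (exist _ (sval a) h : pt (subvariety Z)); exact: pt_eq.
Qed.

Lemma inclusion_inj : injective (@inclusion C X Z).
Proof. by move=> a b /(congr1 sval) /= ab; exact: (@pt_eq _ (subvariety Z)). Qed.

Lemma inclusion_mem (b : pt (subvariety Z)) : Z (inclusion b).
Proof.
have [nB [a Za aB]] := svalP b; suff -> : inclusion b = a by [].
by apply: pt_eq; rewrite /= aB.
Qed.

Lemma inclusion_morphism : morphism (@inclusion C X Z).
Proof.
split=> [V oV b Vb|V f oV rf b Vb].
  by have [d [F [hF F0 FV]]] := oV _ Vb; exists d, F; split=> // b' Fb'; exact: (FV (inclusion b')).
have [W [d [F [G [[oW Wb WV] [hF hG fE]]]]]] := rf _ Vb.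
exists (@inclusion C X Z @^-1` W), d, F, G; split; split=> //.
- by move=> b' Wb'; have [d' [F' [hF' F0 FW]]] := oW _ Wb'; exists d', F'; split=> // b2 Fb2; exact: (FW (inclusion b2)).
- by move=> b' Wb'; exact: WV.
- by move=> b' Wb'; exact: (fE (inclusion b')).
Qed.

Variables (T T' : Type) (A A' : comNzRingType).
Variables (e : T -> {rmorphism A -> C}) (e' : T' -> {rmorphism A' -> C}).
Variables (c : T -> pt X) (j : T' -> T) (c' : T' -> pt (subvariety Z)).

(** The locus j of T' in T is the part of the chart that lies on Z; functions on
    it are the restrictions of functions on T. *)
Lemma restrict_chart : chart e c ->
  (forall t, inclusion (c' t) = c (j t)) ->
  (forall b, range c (inclusion b) -> range c' b) ->
  (forall f, exists f', forall t, e' t f' = e (j t) f) ->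
  (forall f', exists f, forall t, e' t f' = e (j t) f) -> chart e' c'.
Proof.
move=> chc c'E rc r1 r2.
have rE : range c' = @inclusion C X Z @^-1` range c.
  apply/seteqP; split=> [_ [t _ <-]|b]; last exact: rc.
  by rewrite /= c'E; exists (j t).
split=> [d||f'].
- have [m [m0 mE]] := chart_form chc d; exists (m \o j); split=> [t|F hF]; first exact: m0.
  have [f fE] := mE F hF; have [f' f'E] := r1 f; exists f' => t.
  by rewrite f'E /= -fE -c'E.
- by rewrite rE; apply: inclusion_morphism.1; exact: chart_open chc.
- have [f f'E] := r2 f'; have [h rh hE] := chart_fun chc f.
  exists (h \o @inclusion C X Z).
    by rewrite rE; apply: inclusion_morphism.2 => //; exact: chart_open chc.
  by move=> t; rewrite /= c'E hE f'E.
Qed.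

End Restriction.

(** * The projective line *)

Lemma pt_of_matrix (C : closedFieldType) (X : variety C) (I : Type)
    (M : I -> 'M[C]_(vk X, (vn X).+1)) :
  (forall t i, exists j, M t i j != 0) ->
  (forall t D, (forall i, D i != 0) -> @vmem C X (row_scale D (M t))) ->
  exists (c : I -> pt X) (D : I -> 'I_(vk X) -> C),
    (forall t i, D t i != 0) /\ forall t, sval (c t) = row_scale (D t) (M t).
Proof.
move=> M0 MX; have h t : exists aD : pt X * ('I_(vk X) -> C),
    (forall i, aD.2 i != 0) /\ sval aD.1 = row_scale aD.2 (M t).
  have [D D0 nD] := normalize_exists (M0 t).
  by exists (exist _ (row_scale D (M t)) (conj nD (MX t D D0)), D).
have [f fP] := choice h; exists (fun t => (f t).1), (fun t => (f t).2).
by split=> t; case: (fP t).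
Qed.

Lemma pt_proportional (C : closedFieldType) (X : variety C) (a b : pt X)
    (D D' E : 'I_(vk X) -> C) (M M' : 'M[C]_(vk X, (vn X).+1)) :
  (forall i, D' i != 0) -> sval a = row_scale D M -> sval b = row_scale D' M' ->
  (forall i j, M i j = E i * M' i j) -> a = b.
Proof.
move=> D'0 aM bM MM'; apply: pt_eq.
apply: (normalized_unique (D := fun i => D i * E i / D' i)).
- by case: (svalP a).
- by case: (svalP b).
by move=> i j; rewrite aM bM !mxE MM'; field; exact: D'0.
Qed.

Lemma zopen_linear (C : closedFieldType) (X : variety C) i v :
  zopen [set a : pt X | \sum_j v j * sval a i j != 0].
Proof.
move=> a a0; exists (fun l => (l == i : nat)), (linear_form i v).
by split=> [||b]; rewrite ?/ev ?mxeval_linear //; exact: mhomog_linear.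
Qed.

Section ProjectiveLine.
Variable C : closedFieldType.
Local Notation P1 := (projective_space C 1).

Definition line_matrix (b : bool) : 'M[{poly C}]_(1, 2) :=
  \matrix_(i, j) if (j == 0) == b then 'X else 1.

Lemma projective_line_atlas : exists d : bool -> C -> pt P1, line_atlas d.
Proof.
pose M (bt : bool * C) : 'M[C]_(1, 2) := map_mx (eval1 bt.2) (line_matrix bt.1).
pose u (b : bool) : 'I_2 := if b then 1 else 0.
pose v (b : bool) : 'I_2 := if b then 0 else 1.
have pick (a : pt P1) (k : 'I_2) : \sum_j (j == k)%:R * sval a 0 j = sval a 0 k.
  rewrite (bigD1 k) //= eqxx mul1r big1 ?addr0 // => j /negPf ->.
  by rewrite mul0r.
have uM b t i : M (b, t) i (u b) = 1 by rewrite !mxE; case: b; rewrite /= eval1E hornerC.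
have vM b t i : M (b, t) i (v b) = t by rewrite !mxE; case: b; rewrite /= eval1E hornerX.
have [||c [D [D0 cE]]] := @pt_of_matrix C P1 _ M.
- by move=> [b t] i; exists (u b); rewrite uM oner_eq0.
- by [].
have cu b t : sval (c (b, t)) 0 (u b) = D (b, t) 0 by rewrite cE mxE uM mulr1.
have cv b t : sval (c (b, t)) 0 (v b) = D (b, t) 0 * t by rewrite cE mxE vM.
have vu b : v b = u (~~ b) by case: b.
have uv b (j : 'I_2) : j = u b \/ j = v b.
  by case: b; case: j => [[|[|//]] h]; [right|left|left|right]; apply/val_inj.
have onto (a : pt P1) b : sval a 0 (u b) != 0 -> a = c (b, sval a 0 (v b) / sval a 0 (u b)).
  move=> a0; apply: (pt_proportional (M := sval a) (D := fun=> 1) (E := fun=> sval a 0 (u b)) (D0 _) _ (cE _)).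
    by apply/matrixP => i j; rewrite mxE mul1r.
  move=> i j; rewrite !ord1; case: (uv b j) => ->; first by rewrite uM mulr1.
  by rewrite vM mulrC divfK.
exists (fun b t => c (b, t)); split.
- move=> b; have oc : zopen (range (fun t => c (b, t))).
    have -> : range (fun t => c (b, t)) =
        [set a : pt P1 | \sum_j (j == u b)%:R * sval a 0 j != 0].
      apply/seteqP; split=> a /=; rewrite pick; last by move=> /onto ->; eexists.
      by case=> t _ <-; rewrite cu.
    exact: (@zopen_linear C P1).
  apply: (@polynomial_chart1 C P1 _ (line_matrix b) (fun t => D (b, t))) => //.
  apply: (extends_ratio oc (i := 0) (v := fun j => (j == v b)%:R) (w := fun j => (j == u b)%:R)) => t.
    by rewrite pick cu.
  by rewrite !pick cu cv eval1E hornerX mulrC.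
- move=> a; have [j [aj _]] := (svalP a).1 0.
  have [b bj] : exists b, j = u b.
    by case: (uv true j) => ->; [exists true | exists false].
  exists b, (sval a 0 (v b) / sval a 0 (u b)); apply: onto.
  by rewrite -bj aj oner_eq0.
- move=> b b' t t'; split.
    move=> cc; have := cu b t; have := cv b t; rewrite cc.
    have [<-|bb'] := eqVneq b b'.
      by rewrite cu cv => + Db; rewrite Db => /(mulfI (D0 _ _)).
    have bE : b = ~~ b' by case: b bb' {cc}; case: b'.
    rewrite {bb'}bE -(vu b') (vu (~~ b')) negbK cu cv => e1 e2.
    by apply: (mulfI (D0 (b', t') 0)); rewrite mulr1 {2}e1 -e2; ring.
  have [<- -> //|bb' tt'] := eqVneq b b'.
  have -> : b' = ~~ b by case: b bb'; case: b'.
  apply: (pt_proportional (E := fun=> t) (D0 _) (cE _) (cE _)) => i j.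
  case: (uv b j) => ->; last by rewrite vM vu uM mulr1.
  by rewrite uM -[u b]/(u b) -[b in u b]negbK -vu vM.
Qed.
End ProjectiveLine.

(** The ring A is a domain, so that two nonempty open sets that both meet the
    chart have a common point in the chart. *)
Lemma irreducible_of_chart (C : closedFieldType) (X : variety C) (T : Type)
    (A : idomainType) (e : T -> {rmorphism A -> C}) (c : T -> pt X) :
  chart e c -> (forall f : A, f != 0 -> exists t, e t f != 0) ->
  (forall U, zopen U -> U !=set0 -> exists t, U (c t)) -> irreducible X.
Proof.
move=> chc faithful meet U oU U0 V oV V0.
have [t Ut] := meet U oU U0; have [g gt gU] := chart_nbhs chc oU Ut.
have [t' Vt'] := meet V oV V0; have [g' gt' gV] := chart_nbhs chc oV Vt'.
have g0 : g != 0 by apply: contraNneq gt => ->; rewrite rmorph0.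
have g'0 : g' != 0 by apply: contraNneq gt' => ->; rewrite rmorph0.
have [t2] := faithful _ (mulf_neq0 g0 g'0).
rewrite rmorphM mulf_eq0 negb_or => /andP[/gU Ut2 /gV Vt2].
by exists (c t2).
Qed.

Section LineAtlas.
Variables (C : closedFieldType) (X : variety C) (d : bool -> C -> pt X).
Hypothesis ax : line_atlas d.

Lemma line_irreducible : irreducible X.
Proof.
apply: (irreducible_of_chart (line_chart ax false) (@eval1_faithful C)).
move=> U oU [a Ua]; have [b [t at_]] := line_cover ax a; rewrite at_ in Ua.
have [g gt gU] := chart_nbhs (line_chart ax b) oU Ua.
have gX0 : g * 'X != 0.
  by rewrite mulf_neq0 ?polyX_eq0 //; apply: contraNneq gt => ->; rewrite rmorph0.
have [x] := eval1_faithful gX0; rewrite rmorphM mulf_eq0 negb_or => /andP[/gU Ux x0].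
case: b Ux {at_ Ua gU gt} => Ux; last by exists x.
exists x^-1; suff <- : d true x = d false x^-1 by [].
by apply/(line_glue ax); rewrite /= mulfV // -[x in x != 0]hornerX.
Qed.

End LineAtlas.

(** * Surfaces with a hexagon of lines *)

(** The axes of the chart k are the edges k and k + 1, and the chart does not meet
    the other edges.  The indices are taken modulo 6, where 5 k stands for - k. *)
Definition edge_poly (C : closedFieldType) (j k : nat) : {poly {poly C}} :=
  match ((j + 5 * k) %% 6)%N with 0 => 'X | 1 => 'X%:P | _ => 1 end.

(** Six affine planes glued cyclically like the charts of the toric surface whose
    fan has the six rays v_k with v_(k-1) + v_(k+1) = v_k.  The last condition
    says that a point lies on an edge or not independently of the chart in which
    it is seen. *)
Record hex_atlas (C : closedFieldType) (X : variety C)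
    (c : nat -> C * C -> pt X) : Prop := HexAtlas {
  hex_chart : forall k, chart (@eval2 C) (c k);
  hex_cover : forall a, exists k t, a = c k t;
  hex_period : forall k t, c (k + 6)%N t = c k t;
  hex_glue : forall k x y, x != 0 -> c k (x, y) = c k.+1 (x * y, x^-1);
  hex_edge : forall j k k' t t', c k t = c k' t' ->
    eval2 t (edge_poly C j k) = 0 -> eval2 t' (edge_poly C j k') = 0
}.

Definition edge (C : closedFieldType) (X : variety C) (c : nat -> C * C -> pt X)
    (j : nat) : set (pt X) :=
  [set a | exists k t, a = c k t /\ eval2 t (edge_poly C j k) = 0].

Section Hexagon.
Variables (C : closedFieldType) (X : variety C) (c : nat -> C * C -> pt X).
Hypothesis ax : hex_atlas c.
Local Notation e2 := (@eval2 C).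
Local Notation Y := ('X%:P : {poly {poly C}}).
Local Notation ratk k := (rat e2 (c k)).

Lemma eval2X t : e2 t 'X = t.1. Proof. by rewrite eval2E hornerX hornerC. Qed.
Lemma eval2Y t : e2 t Y = t.2. Proof. by rewrite eval2E hornerC hornerX. Qed.
Lemma eval2C t a : e2 t a%:P%:P = a. Proof. by rewrite eval2E !hornerC. Qed.
Lemma outerX_neq0 : ('X : {poly {poly C}}) != 0. Proof. by rewrite polyX_eq0. Qed.
Lemma innerX_neq0 : Y != 0. Proof. by rewrite polyC_eq0 polyX_eq0. Qed.

Lemma edge_poly_neq0 j k : edge_poly C j k != 0.
Proof.
by rewrite /edge_poly; case: ((_ %% _)%N) => [|[|?]];
  rewrite ?oner_eq0 ?outerX_neq0 ?innerX_neq0.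
Qed.

Lemma edgeE j k t : edge c j (c k t) <-> e2 t (edge_poly C j k) = 0.
Proof.
split=> [[k' [t' [tt' t'0]]]|t0]; last by exists k, t.
by apply: (hex_edge ax (esym tt')) t'0.
Qed.

Lemma hex_periodM k m t : c (k + 6 * m)%N t = c k t.
Proof.
elim: m => [|m IHm]; first by rewrite muln0 addn0.
by rewrite mulnS addnCA addnC (hex_period ax).
Qed.

Lemma hex_mod k l t : (k = l %[mod 6])%N -> c k t = c l t.
Proof.
move=> kl; rewrite (divn_eq k 6) (divn_eq l 6) kl.
by rewrite ![(_ * 6 + _)%N]addnC ![(_ * 6)%N]mulnC !hex_periodM.
Qed.

Lemma hex_glue_torus k m t : t.1 != 0 -> t.2 != 0 ->
  exists t', [/\ t'.1 != 0, t'.2 != 0 & c k t = c (k + m)%N t'].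
Proof.
move=> t10 t20; elim: m => [|m [t' [h1 h2 ->]]]; first by exists t; rewrite addn0.
exists (t'.1 * t'.2, t'.1^-1); split; rewrite /= ?mulf_neq0 ?invr_eq0 //.
by rewrite addnS -(hex_glue ax) // -surjective_pairing.
Qed.

(** The torus, where both coordinates are nonzero, lies in all the charts and is
    dense in each of them. *)
Lemma open_meets_torus k U : zopen U -> U !=set0 ->
  exists t, [/\ t.1 != 0, t.2 != 0 & U (c k t)].
Proof.
move=> oU [a Ua]; have [l [t at_]] := hex_cover ax a; rewrite at_ in Ua.
have [g gt gU] := chart_nbhs (hex_chart ax l) oU Ua.
have g0 : g != 0 by apply: contraNneq gt => ->; rewrite rmorph0.
have [t1] := eval2_faithful (mulf_neq0 g0 (mulf_neq0 outerX_neq0 innerX_neq0)).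
rewrite !rmorphM !mulf_eq0 !negb_or eval2X eval2Y => /and3P[/gU Ut1 x0 y0].
have [t' [h1 h2 tt']] := hex_glue_torus l (5 * l + k)%N x0 y0.
exists t'; split=> //; rewrite -(hex_periodM k l).
suff -> : (k + 6 * l = l + (5 * l + k))%N by rewrite -tt'.
by lia.
Qed.

Lemma hex_irreducible : irreducible X.
Proof.
apply: (irreducible_of_chart (hex_chart ax 0) (@eval2_faithful C)) => U oU U0.
by have [t [_ _ Ut]] := open_meets_torus 0 oU U0; exists t.
Qed.

Let irr := hex_irreducible.
Let faith := @eval2_faithful C.

(** The transition map (x, y) |-> (x y, 1 / x) transforms expressions in the chart
    k + 1 into expressions in the chart k. *)
Lemma rat_change_chart k u F F' G' : ratk k.+1 u F 1 ->
  (forall x y, x != 0 ->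
     e2 (x * y, x^-1) F * e2 (x, y) G' = e2 (x, y) F') ->
  ratk k u F' G'.
Proof.
move=> [U [oU U0 uE]] FF'.
have [oW W0] := open_meet irr oU U0 (chart_basic_open (hex_chart ax k) 'X)
   (@basic_open_neq0 _ _ _ _ _ _ faith _ outerX_neq0).
exists (U `&` (c k @` [set t | e2 t 'X != 0])); split=> // [[x y]] [Ut [t tX tt]].
have x0 : x != 0.
  by have := chart_value (hex_chart ax k) 'X tt; rewrite !eval2X /= => <-; rewrite -eval2X.
have ct := hex_glue ax k y x0.
have := uE (x * y, x^-1); rewrite -ct rmorph1 mul1r => /(_ Ut) ->.
by rewrite mulrC FF'.
Qed.

(** The characters w_k of the torus that are the first coordinates of the charts;
    the second coordinate of the chart k is w_(k+2). *)
Record hex_coordinates (w : nat -> ratfun X) : Prop := HexCoordinates {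
  coordX : forall k, ratk k (w k) 'X 1;
  coordY : forall k, ratk k (w k.+2) Y 1;
  coordM : forall k, w k.+1 = w k * w k.+2;
  coordV : forall k, w k * w (k + 3)%N = 1
}.

Lemma hex_coordinates_exist : exists w, hex_coordinates w.
Proof.
have exX k : exists u, ratk k u 'X 1 by exact: (rat_surj irr (hex_chart ax k) faith _ (oner_neq0 _)).
have exY k : exists u, ratk k u Y 1 by exact: (rat_surj irr (hex_chart ax k) faith _ (oner_neq0 _)).
have [w wX] := choice exX; have [y yY] := choice exY.
have eqk k u v F G F' G' := @rat_eq _ _ _ _ _ _ irr (hex_chart ax k) faith u v F G F' G'.
have wS k : w k.+1 = w k * y k.
  apply: (eqk k _ _ ('X * Y) 1 ('X * Y) (1 * 1)); rewrite ?mulr1 ?oner_neq0 //.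
    apply: rat_change_chart (wX k.+1) _ => a b a0.
    by rewrite rmorph1 mulr1 eval2X rmorphM eval2X eval2Y.
  by rewrite -[1]mulr1; apply: ratM.
have yw k : y k.+1 * w k = 1.
  apply: (eqk k _ _ (1 * 'X) ('X * 1) 1 1); rewrite ?mulr1 ?mul1r ?oner_neq0 ?outerX_neq0 //.
    rewrite -[X in rat _ _ _ X _]mul1r -[X in rat _ _ _ _ X]mulr1; apply: ratM => //.
    apply: rat_change_chart (yY k.+1) _ => a b a0.
    by rewrite rmorph1 eval2X eval2Y /= mulVf.
  exact: rat1 faith.
have wSS k : w k.+2 = y k by rewrite !wS mulrAC [w k * _]mulrC yw mul1r.
exists w; split=> // [k|k|k]; first by rewrite wSS.
  by rewrite wSS wS.
by rewrite addn3 wSS mulrC yw.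
Qed.
End Hexagon.

Section Edges.
Variables (C : closedFieldType) (X : variety C) (c : nat -> C * C -> pt X).
Hypothesis ax : hex_atlas c.
Variable w : nat -> ratfun X.
Hypothesis hw : hex_coordinates c w.
Local Notation e2 := (@eval2 C).
Local Notation Y := ('X%:P : {poly {poly C}}).
Local Notation ratk k := (rat e2 (c k)).
Let irr := hex_irreducible ax.
Let faith := @eval2_faithful C.

(** A generator of the ideal of the edge j on the chart k, and its inverse. *)
Definition gen j k :=
  match ((j + 5 * k) %% 6)%N with 0 => w k | 1 => w k.+2 | _ => 1 end.
Definition genV j k :=
  match ((j + 5 * k) %% 6)%N with 0 => w (k + 3) | 1 => w (k + 5) | _ => 1 end.

Lemma gen_rat j k : ratk k (gen j k) (edge_poly C j k) 1.
Proof.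
rewrite /gen /edge_poly; case: ((_ %% _)%N) => [|[|_]].
- exact: coordX hw k.
- exact: coordY hw k.
- exact: rat1 faith.
Qed.

Lemma genK j k : gen j k * genV j k = 1.
Proof.
rewrite /gen /genV; case: ((_ %% _)%N) => [|[|_]].
- exact: coordV hw k.
- by have := coordV hw k.+2; rewrite -[k.+2]addn2 -addnA.
- by rewrite mulr1.
Qed.

(** A polynomial that vanishes where x = 0 and G <> 0 has a product with G that
    vanishes on x = 0; away from x = 0 the function x is invertible. *)
Lemma edge_local_equation j k :
  local_equation e2 (c k) (edge c j) (edge_poly C j k).
Proof.
split=> [t|[x0 y0] F G G0]; first exact: edgeE.
rewrite /edge_poly; case: ((_ %% _)%N) => [|[|_]] FZ.
- have [x00|x00] := eqVneq x0 0; last first.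
    by exists F, 'X; rewrite mulrC eval2X.
  have [y|F' FE] := @divides_outer _ (F * G) 0.
    have [Gy|Gy] := eqVneq (e2 (0, y) G) 0.
      by rewrite -[LHS]/(e2 (0, y) (F * G)) rmorphM Gy mulr0.
    by rewrite -[LHS]/(e2 (0, y) (F * G)) rmorphM (FZ (0, y)) ?mul0r ?eval2X.
  by exists F', G; split=> //; rewrite mulrC FE polyC0 polyC0 subr0 mulrC.
- have [y00|y00] := eqVneq y0 0; last first.
    by exists F, Y; rewrite mulrC eval2Y.
  have [x|F' FE] := @divides_inner _ (F * G) 0.
    have [Gx|Gx] := eqVneq (e2 (x, 0) G) 0.
      by rewrite -[LHS]/(e2 (x, 0) (F * G)) rmorphM Gx mulr0.
    by rewrite -[LHS]/(e2 (x, 0) (F * G)) rmorphM (FZ (x, 0)) ?mul0r ?eval2Y.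
  by exists F', G; split=> //; rewrite mulrC FE polyC0 subr0 mulrC.
- by exists F, 1; rewrite rmorph1 oner_eq0 mulrC.
Qed.

Lemma edge_ideal j k t u :
  ideal_stalk (edge c j) (c k t) u <-> local_ring (c k t) (u * genV j k).
Proof.
exact: (ideal_stalk_rat irr (hex_chart ax k) faith u t (edge_local_equation j k)
  (edge_poly_neq0 C j k) (gen_rat j k) (genK j k)).
Qed.

Lemma coord_period k m : w (k + 6 * m)%N = w k.
Proof.
elim: m => [|m IHm]; first by rewrite muln0 addn0.
rewrite mulnS addnCA addnC -[RHS]IHm; set l := (k + _)%N.
rewrite -[LHS]mulr1 -(coordV hw l) mulrCA [_ * w (l + 3)%N]mulrC.
by have := coordV hw (l + 3)%N; rewrite -addnA => ->; rewrite mulr1.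
Qed.

Lemma coord_mod k l m m' : (k + 6 * m = l + 6 * m')%N -> w k = w l.
Proof. by move=> kl; rewrite -(coord_period k m) kl coord_period. Qed.

(** The relation that expresses the divisor of w_l, which is
    E_l + E_(l-1) - E_(l+2) - E_(l+3), on each chart. *)
Lemma coord_divisor l k : w l * gen (l + 2) k * gen (l + 3) k = gen l k * gen (l + 5) k.
Proof.
pose r := ((l + 5 * k) %% 6)%N.
have wr : w l = w (k + r)%N.
  apply: (coord_mod (m := k) (m' := (l + 5 * k) %/ 6)).
  by have := divn_eq (l + 5 * k) 6; rewrite /r; lia.
have gr m : gen (l + m) k = match ((r + m) %% 6)%N with 0 => w k | 1 => w k.+2 | _ => 1 end.
  by rewrite /gen /r modnDml addnAC.
have := gr 0; rewrite addn0 => ->; rewrite !gr wr.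
have : (r < 6)%N by rewrite ltn_mod.
have aV := coordV hw k; have bV := coordV hw k.+2.
have ab := coordM hw k; have abV := coordV hw k.+1; have abV' := coordM hw (k + 3).
have e5 : (k.+2 + 3 = k + 5)%N by lia.
have e4 : (k.+1 + 3 = k + 4)%N by lia.
rewrite e5 in bV; rewrite e4 in abV.
case: r {wr gr} => [|[|[|[|[|[|//]]]]]] _ /=;
  rewrite ?addn0 ?addn1 ?addn2 ?mulr1 ?mul1r //.
- by rewrite ab mulrC.
- by rewrite mulrC.
- by rewrite -mulrA -ab mulrC.
- by rewrite mulrC.
Qed.

Lemma genM_neq (u v g g' : ratfun X) : g * g' = 1 -> u * g = v * g -> u = v.
Proof. by move=> gg' uv; rewrite -[u]mulr1 -gg' mulrA uv -mulrA gg' mulr1. Qed.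

Lemma edge_closed j : zclosed (edge c j).
Proof.
apply: zopen_local => a; have [k [t ->]] := hex_cover ax a => /= na.
exists (c k @` [set t | e2 t (edge_poly C j k) != 0]); split.
- exact: chart_basic_open (hex_chart ax k) _.
- by exists t => //=; apply/eqP => /(edgeE ax).
- by move=> _ [t' /= /eqP t'0 <-] /(edgeE ax).
Qed.

Lemma edge_poly_val j k t : e2 t (edge_poly C j k) =
  match ((j + 5 * k) %% 6)%N with 0 => t.1 | 1 => t.2 | _ => 1 end.
Proof.
by rewrite /edge_poly; case: ((_ %% _)%N) => [|[|_]]; rewrite ?eval2X ?eval2Y ?rmorph1.
Qed.

Lemma edge_mod i j : (i = j %[mod 6])%N -> edge c i = edge c j.
Proof.
move=> ij; have E k : edge_poly C i k = edge_poly C j k.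
  by rewrite /edge_poly -modnDml ij modnDml.
by apply/seteqP; split=> a [k [t [-> t0]]]; exists k, t; rewrite ?E // -E.
Qed.

Lemma edge_inj i j : edge c i = edge c j -> (i = j %[mod 6])%N.
Proof.
move=> ij; have : edge c i (c i (0, 1)).
  apply/(edgeE ax); rewrite edge_poly_val.
  by have -> : ((i + 5 * i) %% 6 = 0)%N by lia.
rewrite ij => /(edgeE ax); rewrite edge_poly_val.
have := ltn_pmod (j + 5 * i) (isT : (0 < 6)%N).
case E: ((j + 5 * i) %% 6)%N => [|[|r]] _ /=; first by lia.
  by move/eqP; rewrite oner_eq0.
by move/eqP; rewrite oner_eq0.
Qed.

(** Two distinct edges meet if and only if they are axes of the same chart. *)
Lemma edge_meet i j : edge c i `&` edge c j !=set0 <->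
  [\/ i = j %[mod 6], i.+1 = j %[mod 6] | i = j.+1 %[mod 6]]%N.
Proof.
split=> [[a []]|].
  have [k [t ->]] := hex_cover ax a => /(edgeE ax) + /(edgeE ax).
  rewrite !edge_poly_val.
  case Ei: ((i + 5 * k) %% 6)%N => [|[|r]]; last by move/eqP; rewrite oner_eq0.
    case Ej: ((j + 5 * k) %% 6)%N => [|[|r]]; last by move=> _ /eqP; rewrite oner_eq0.
      by constructor 1; lia.
    by constructor 2; lia.
  case Ej: ((j + 5 * k) %% 6)%N => [|[|r]]; last by move=> _ /eqP; rewrite oner_eq0.
    by constructor 3; lia.
  by constructor 1; lia.
have v0 k : edge c k (c k (0, 0)).
  apply/(edgeE ax); rewrite edge_poly_val.
  by have -> : ((k + 5 * k) %% 6 = 0)%N by lia.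
have v1 k : edge c k.+1 (c k (0, 0)).
  apply/(edgeE ax); rewrite edge_poly_val.
  by have -> : ((k.+1 + 5 * k) %% 6 = 1)%N by lia.
case=> ij.
- by exists (c i (0, 0)); split; rewrite -?(edge_mod ij); exact: v0.
- by exists (c i (0, 0)); split; [exact: v0 | rewrite -(edge_mod ij); exact: v1].
- by exists (c j (0, 0)); split; [rewrite (edge_mod ij); exact: v1 | exact: v0].
Qed.

(** * The edges are (-1)-curves *)

Definition edge_point (b : bool) (t : C) : C * C := if b then (t, 0) else (0, t).
Definition edge_chart j (b : bool) : nat := if b then j + 5 else j.

Lemma edge_point_on j b t : edge c j (c (edge_chart j b) (edge_point b t)).
Proof.
apply/(edgeE ax); rewrite edge_poly_val /edge_chart /edge_point; case: b.
  by have -> : ((j + 5 * (j + 5)) %% 6 = 1)%N by lia.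
by have -> : ((j + 5 * j) %% 6 = 0)%N by lia.
Qed.

Lemma edge_chart_on j b t : edge c j (c (edge_chart j b) t) ->
  exists s, t = edge_point b s.
Proof.
move/(edgeE ax); rewrite edge_poly_val /edge_chart /edge_point; case: t => x y.
case: b.
  have -> : ((j + 5 * (j + 5)) %% 6 = 1)%N by lia.
  by move=> /= ->; exists x.
have -> : ((j + 5 * j) %% 6 = 0)%N by lia.
by move=> /= ->; exists y.
Qed.

Lemma edge_covered j a : edge c j a -> exists b s, a = c (edge_chart j b) (edge_point b s).
Proof.
move=> [k [t [-> t0]]].
have ja : edge c j (c k t) by apply/(edgeE ax).
suff [b [t' tt']] : exists b t', c k t = c (edge_chart j b) t'.
  by rewrite tt' in ja *; have [s ->] := edge_chart_on ja; exists b, s.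
move: t0; rewrite edge_poly_val; have := ltn_pmod (j + 5 * k) (isT : (0 < 6)%N).
case E: ((j + 5 * k) %% 6)%N => [|[|r]] _ /=; last by move/eqP; rewrite oner_eq0.
  by exists false, t; apply: (hex_mod ax); rewrite /edge_chart; lia.
by exists true, t; apply: (hex_mod ax); rewrite /edge_chart; lia.
Qed.

Lemma edge_glue j b b' t t' :
  c (edge_chart j b) (edge_point b t) = c (edge_chart j b') (edge_point b' t') <->
  (if b == b' then t = t' else t * t' = 1).
Proof.
have inj k x y x' y' : c k (x, y) = c k (x', y') -> x = x' /\ y = y'.
  move=> E; have := chart_value (hex_chart ax k) 'X E.
  by have := chart_value (hex_chart ax k) Y E; rewrite !eval2X !eval2Y.
have cross s s' : c j (0, s) = c (j + 5)%N (s', 0) <-> s * s' = 1.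
  have [->|s'0] := eqVneq s' 0.
    rewrite mulr0; split=> [E|/esym/eqP]; last by rewrite oner_eq0.
    have := hex_edge ax (j := (j + 5)%N) (esym E); rewrite !edge_poly_val.
    have -> : ((j + 5 + 5 * (j + 5)) %% 6 = 0)%N by lia.
    have -> : ((j + 5 + 5 * j) %% 6 = 5)%N by lia.
    by move=> /(_ erefl) /eqP; rewrite oner_eq0.
  rewrite (hex_glue ax _ _ s'0) mulr0 -addnS (hex_period ax); split=> [/inj[_ ->]|ss'].
    by rewrite mulVf.
  by congr (c j (_, _)); apply: (mulIf s'0); rewrite ss' mulVf.
case: b; case: b' => /=; rewrite /edge_chart /edge_point.
- by split=> [/inj[]|->].
- by rewrite mulrC; split=> [/esym/cross|/cross].
- exact: cross.
- by split=> [/inj[]|->].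
Qed.

(** The edge j is the first axis of the chart j and the second axis of the chart
    j + 5, and the coordinates on the two axes are inverse to each other. *)
Lemma edge_atlas j : exists2 d : bool -> C -> pt (subvariety (edge c j)),
  line_atlas d &
  forall b t, inclusion (d b t) = c (edge_chart j b) (edge_point b t).
Proof.
have ex (bt : bool * C) : exists a : pt (subvariety (edge c j)),
    inclusion a = c (edge_chart j bt.1) (edge_point bt.1 bt.2).
  by apply: inclusion_surj; exact: edge_point_on.
have [f fP] := choice ex; exists (fun b t => f (b, t)); last by move=> b t; rewrite fP.
split=> [b|a|b b' t t'].
- apply: (restrict_chart (j := edge_point b) (hex_chart ax (edge_chart j b))).
  + by move=> t; rewrite fP.
  + move=> a [t _ ta]; have ja := inclusion_mem a; rewrite -ta in ja.
    have [s tE] := edge_chart_on ja; exists s => //.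
    by apply: inclusion_inj; rewrite fP -ta tE.
  + case: b => F.
      exists (map_poly (horner_eval 0) F) => t.
      by rewrite eval1E eval2E -horner2_specialize.
    by exists F.[0%:P] => t; rewrite eval1E eval2E.
  + case: b => G.
      exists (map_poly polyC G) => t.
      by rewrite eval1E eval2E /= horner_map hornerC.
    by exists G%:P => t; rewrite eval1E eval2E /= hornerC.
- have [b [s as_]] := edge_covered (inclusion_mem a).
  by exists b, s; apply: inclusion_inj; rewrite fP.
- rewrite -(edge_glue j); split=> [E|E]; last by apply: inclusion_inj; rewrite !fP.
  by rewrite -[LHS](fP (b, t)) -[RHS](fP (b', t')) E.
Qed.

End Edges.

Section DivisorOfEdge.
Variables (C : closedFieldType) (X : variety C) (c : nat -> C * C -> pt X).
Hypothesis ax : hex_atlas c.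
Variable w : nat -> ratfun X.
Hypothesis hw : hex_coordinates c w.

(** The inverse of a principal ideal. *)
Lemma divisor_edge j k t u :
  divisor_stalk (edge c j) (c k t) u <-> local_ring (c k t) (u * gen w j k).
Proof.
split=> [|uO v /(edge_ideal ax hw) vO].
  by apply; apply/(edge_ideal ax hw); rewrite (genK hw); exact: local_ring_cst.
have -> : u * v = (u * gen w j k) * (v * genV w j k).
  by rewrite mulrACA (genK hw) mulr1.
exact: local_ringM.
Qed.

End DivisorOfEdge.

Section Restricts.
Variables (C : closedFieldType) (X Y : variety C) (h : pt X -> pt Y).
Hypothesis irr : irreducible X.
Hypothesis mh : morphism h.

Lemma restricts_local a u : local_ring (h a) u ->
  exists2 v, local_ring a v & restricts h u v.
Proof.
move=> [U [f [Ua uf]]]; have [[oU _] rU _] := uf.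
have dV : odense (h @^-1` U).
  by apply: irreducible_odense => //; [exact: mh.1 | exists a].
have rV : regular_on (h @^-1` U) (f \o h) by exact: mh.2.
have reg : gen_regular (f \o h) by exists (h @^-1` U).
have vf : represents (ratclass reg) (h @^-1` U) (f \o h).
  by split=> //; exact: gen_eq_repr.
by exists (ratclass reg); [exists (h @^-1` U), (f \o h) | exists U, f].
Qed.

Lemma restrictsM u v u' v' : restricts h u v -> restricts h u' v' ->
  restricts h (u * u') (v * v').
Proof.
move=> [U [f [uf vf]]] [U' [f' [uf' vf']]].
exists (U `&` U'), (fun a => f a * f' a); split; first exact: represents_mul.
exact: (represents_mul vf vf').
Qed.

Variables (T T' : Type) (A A' : idomainType).
Variables (e : T -> {rmorphism A -> C}) (e' : T' -> {rmorphism A' -> C}).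
Variables (cx : T -> pt X) (cy : T' -> pt Y) (j : T -> T').
Hypothesis irrY : irreducible Y.
Hypothesis chx : chart e cx.
Hypothesis chy : chart e' cy.
Hypothesis faith : forall f : A, f != 0 -> exists t, e t f != 0.
Hypothesis faith' : forall f : A', f != 0 -> exists t, e' t f != 0.
Hypothesis hE : forall t, h (cx t) = cy (j t).

(** In compatible charts the restriction is the restriction of numerator and
    denominator. *)
Lemma restricts_rat u v F G F' G' : rat e cx v F G -> rat e' cy u F' G' ->
  G != 0 -> (forall t, e' (j t) F' = e t F) -> (forall t, e' (j t) G' = e t G) ->
  restricts h u v.
Proof.
move=> rv ru G0 FE GE.
have G'0 : G' != 0.
  have [t Gt] := faith G0; apply: contraNneq Gt => G'0.
  by rewrite -GE G'0 rmorph0.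
have [k rk kE] := chart_quotient chy F' G'.
have oG' := chart_basic_open chy G'.
exists (cy @` [set t | e' t G' != 0]), k; split; first exact: represents_rat rk kE.
have op : zopen (h @^-1` (cy @` [set t | e' t G' != 0])) by exact: mh.1.
split.
- apply: irreducible_odense => //; have [t Gt] := faith G0.
  by exists (cx t); rewrite /= hE; exists (j t); rewrite //= GE.
- exact: mh.2.
have [U [oU U0 vE]] := rv.
have [oW W0] := open_meet irr oU U0 (chart_basic_open chx G) (basic_open_neq0 cx faith G0).
apply/(gen_eq_open cx irr faith).
exists (U `&` cx @` [set t | e t G != 0]); split=> // a [Ua [t /= Gt ta]].
rewrite -ta /= hE kE ?GE // FE; apply: (mulfI Gt).
by rewrite vE ?ta // mulrC divfK.
Qed.

End Restricts.

Section MinusOneCurves.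
Variables (C : closedFieldType) (X : variety C) (c : nat -> C * C -> pt X).
Hypothesis ax : hex_atlas c.

(** The function w_j vanishes to order one along the edges j and j - 1, and has
    neither zeros nor poles on the rest of the edge j.  Hence w_j O(E_j)
    restricts to E_j as the ideal sheaf of the vertex of the edges j - 1 and
    j. *)
Lemma edge_minus_one j : minus_one_curve (edge c j).
Proof.
split; first exact: edge_closed.
have [w hw] := hex_coordinates_exist ax.
have [d0 ad0] := projective_line_atlas C; have [d ad dE] := edge_atlas ax j.
have [h isoh hE] := line_atlas_iso ad0 ad; exists h; split=> //.
pose i b := inclusion (h b).
have mi : morphism i.
  have [m1 m2] := @inclusion_morphism _ _ (edge c j); have [h1 h2] := isoh.1.
  by split=> [V oV|V f oV rf]; [exact: (h1 _ (m1 V oV)) | exact: (h2 _ _ (m1 V oV) (m2 V f oV rf))].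
have iE b t : i (d0 b t) = c (edge_chart j b) (edge_point b t) by rewrite /i hE dE.
have irr0 := line_irreducible ad0; have irr := hex_irreducible ax.
have f1 := @eval1_faithful C; have f2 := @eval2_faithful C.
have ch0 := line_chart ad0; have ch := hex_chart ax.
have [x rx] := rat_surj irr0 (ch0 true) f1 'X (oner_neq0 _).
have X0 : ('X : {poly C}) != 0 by rewrite polyX_eq0.
have [x' rx'] := rat_surj irr0 (ch0 true) f1 1 X0.
have xx' : x * x' = 1.
  apply: (@rat_eq _ _ _ _ _ _ irr0 (ch0 true) f1 _ _ ('X * 1) (1 * 'X) 1 1).
  - by rewrite mul1r.
  - exact: oner_neq0.
  - exact: ratM.
  - exact: rat1.
  - by rewrite !mulr1 !mul1r.
(* Polynomials on an axis of a chart extend to the chart. *)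
have lift b (F : {poly C}) : exists F' : {poly {poly C}},
    forall t, eval2 (edge_point b t) F' = eval1 t F.
  case: b.
    by exists (map_poly polyC F) => t; rewrite eval1E eval2E /= horner_map hornerC.
  by exists F%:P => t; rewrite eval1E eval2E /= hornerC.
have surj b s v : local_ring (d0 b s) v ->
    exists2 u, local_ring (i (d0 b s)) u & restricts i u v.
  move=> /(local_ring_rat irr0 (ch0 b) f1)[F [G [Gs rv]]].
  have [F' F'E] := lift b F; have [G' G'E] := lift b G.
  have G0 : G != 0 by apply: contraNneq Gs => ->; rewrite rmorph0.
  have G's : eval2 (edge_point b s) G' != 0 by rewrite G'E.
  have G'0 : G' != 0 by apply: contraNneq G's => ->; rewrite rmorph0.
  have [u ru] := rat_surj irr (ch (edge_chart j b)) f2 F' G'0; exists u.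
    by rewrite iE; apply/(local_ring_rat irr (ch _) f2); exists F', G'.
  exact: (restricts_rat irr0 mi irr (ch0 b) (ch _) f1 f2 (iE b) rv ru G0).
have wx : restricts i (w (j + 5)%N) x.
  apply: (restricts_rat irr0 mi irr (ch0 true) (ch _) f1 f2 (iE true) rx (coordX hw _)) => [|t|t].
  - exact: oner_neq0.
  - by rewrite eval2X eval1E hornerX.
  - by rewrite !rmorph1.
(* On the chart j + 5 the function w_j is the product of the coordinates. *)
have wj : w j = w (j + 5)%N * w (j + 5).+2.
  by rewrite -(coordM hw) -addnS -(coord_period hw j 1).
have Lfalse s u : [set w j * u | u in divisor_sheaf (edge c j) (i (d0 false s))] u <->
    local_ring (i (d0 false s)) u.
  have gE : gen w j j = w j by rewrite /gen; have -> : ((j + 5 * j) %% 6 = 0)%N by lia.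
  rewrite iE; split=> [[u' /(divisor_edge ax hw) u'O <-]|uO].
    by rewrite mulrC -[X in _ * X]gE.
  exists (w (j + 3)%N * u); last by rewrite mulrA (coordV hw) mul1r.
  by apply/(divisor_edge ax hw); rewrite /edge_chart gE mulrC mulrA (coordV hw) mul1r.
have Ltrue s u : [set w j * u | u in divisor_sheaf (edge c j) (i (d0 true s))] u <->
    exists2 u', local_ring (i (d0 true s)) u' & u = w (j + 5)%N * u'.
  have gE : gen w j (j + 5) = w (j + 5).+2.
    by rewrite /gen; have -> : ((j + 5 * (j + 5)) %% 6 = 1)%N by lia.
  rewrite iE; split=> [[u' /(divisor_edge ax hw) u'O <-]|[u' u'O ->]].
    by exists (u' * gen w j (j + 5)) => //; rewrite gE wj; ring.
  have wV := genK hw j (j + 5); rewrite gE in wV.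
  exists (genV w j (j + 5) * u'); last by rewrite wj mulrA -[_ * _ * genV _ _ _]mulrA wV mulr1.
  by apply/(divisor_edge ax hw); rewrite /edge_chart gE mulrC mulrA wV mul1r.
pose p0 := d0 true 0.
have Mfalse s v : ideal_stalk [set p0] (d0 false s) v <-> local_ring (d0 false s) v.
  rewrite -{2}[v]mulr1.
  apply: (ideal_stalk_rat irr0 (ch0 false) f1 v s (g := 1) (w := 1)).
  - split=> [t|t0 F G _ _]; last by exists F, 1; rewrite rmorph1 oner_neq0.
    rewrite rmorph1; split=> [/(line_glue ad0)/=|/eqP]; last by rewrite oner_eq0.
    by rewrite mulr0.
  - exact: oner_neq0.
  - exact: rat1.
  - exact: mulr1.
have Mtrue s v : ideal_stalk [set p0] (d0 true s) v <-> local_ring (d0 true s) (v * x').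
  apply: (ideal_stalk_rat irr0 (ch0 true) f1 v s _ X0 rx xx').
  split=> [t|t0 F G G0 FZ].
    rewrite eval1E hornerX; split=> [/(line_glue ad0)//|t0].
    by apply/(line_glue ad0).
  have [t00|t00] := eqVneq t0 0; last first.
    by exists F, 'X; rewrite eval1E hornerX.
  have /eqP/factor_theorem[F' FE] : F.[0] = 0.
    by rewrite t00 in G0; apply: (FZ 0 G0); rewrite eval1E hornerX.
  by exists F', 1; rewrite rmorph1 oner_neq0 mul1r FE polyC0 subr0 mulrC.
exists (w j), (w (j + 3)%N), p0; split; first exact: coordV hw j.
move=> b; have [[|] [s ->]] := line_cover ad0 b; split.
- move=> u /Ltrue[u' /(restricts_local irr0 mi)[v' v'O uv'] ->].
  exists (x * v'); last exact: restrictsM.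
  by apply/Mtrue; rewrite mulrAC xx' mul1r.
- move=> v /Mtrue/surj[u' u'O uv']; exists (w (j + 5)%N * u'); first by apply/Ltrue; exists u'.
  by rewrite -[v]mulr1 -xx' mulrCA; exact: restrictsM.
- by move=> u /Lfalse/(restricts_local irr0 mi)[v vO uv]; exists v => //; apply/Mfalse.
- by move=> v /Mfalse/surj[u uO uv]; exists u => //; apply/Lfalse.
Qed.

End MinusOneCurves.

(** * Laurent monomials *)

Section IntegerPowers.
Variable R : comPzRingType.
Implicit Types (a b : R) (i j : int).

(** The inverse b of a is an argument, so that negative powers make sense in any
    ring. *)
Definition zpow a b i := match i with Posz n => a ^+ n | Negz n => b ^+ n.+1 end.

Lemma zpowB a b m n : a * b = 1 -> zpow a b (m%:Z - n%:Z) = a ^+ m * b ^+ n.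
Proof.
move=> ab; have E p : a ^+ p * b ^+ p = 1 by rewrite -exprMn ab expr1n.
have [le|lt] := leqP n m.
  rewrite -(subnK le) PoszD addrK /= exprD -mulrA E mulr1.
  by [].
have -> : m%:Z - n%:Z = Negz (n - m).-1 by lia.
rewrite /= prednK ?subn_gt0 // -{2}(subnK (ltnW lt)) exprD mulrCA E mulr1.
by [].
Qed.

Lemma zpowD a b i j : a * b = 1 -> zpow a b (i + j) = zpow a b i * zpow a b j.
Proof.
move=> ab; have int_diff l : exists m n, l = m%:Z - n%:Z.
  by case: l => n; [exists n, 0%N | exists 0%N, n.+1]; lia.
have [m [n ->]] := int_diff i; have [m' [n' ->]] := int_diff j.
have -> : m%:Z - n%:Z + (m'%:Z - n'%:Z) = (m + m')%N%:Z - (n + n')%N%:Z by lia.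
by rewrite !zpowB // !exprD mulrACA.
Qed.

Lemma zpowV a b i : zpow b a i = zpow a b (- i).
Proof. by case: i => [[|n]|n]. Qed.

Lemma zpowM a b a' b' i : zpow (a * a') (b * b') i = zpow a b i * zpow a' b' i.
Proof. by case: i => n; rewrite /= exprMn. Qed.

End IntegerPowers.

Lemma zpow_morph (R S : comPzRingType) (f : R -> S) (a b : R) i :
  (forall x y, f (x * y) = f x * f y) -> f 1 = 1 ->
  f (zpow a b i) = zpow (f a) (f b) i.
Proof.
move=> fM f1; have fX x n : f (x ^+ n) = f x ^+ n.
  by elim: n => [|n IHn]; rewrite ?expr0 // !exprS fM IHn.
by case: i => n; rewrite /= fX.
Qed.

(** The order of vanishing along the edge k of the monomial w_0^a w_1^b, for
    m = (a, b). *)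
Definition ell (k : nat) (m : Z2) : int :=
  match (k %% 6)%N with
  | 0 => m.1 + m.2 | 1 => m.2 | 2 => - m.1 | 3 => - (m.1 + m.2) | 4 => - m.2
  | _ => m.1 end.

Lemma ellSS k m : ell k.+2 m = ell k.+1 m - ell k m.
Proof.
rewrite /ell -addn1 -(addn1 k) -addnA -[((k + (1 + 1)) %% 6)%N]modnDml.
rewrite -[((k + 1) %% 6)%N]modnDml; have := ltn_pmod k (isT : (0 < 6)%N).
by case: ((k %% 6)%N) => [|[|[|[|[|[|//]]]]]] _ /=; ring.
Qed.

(** The orders along the two axes of a chart are coordinates on the lattice of
    exponents. *)
Lemma ell_surj k i j : exists m, ell k m = i /\ ell k.+1 m = j.
Proof.
elim: k i j => [|k IHk] i j; first by exists (i - j, j); rewrite /ell /=; split; ring.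
by have [m [mi mj]] := IHk (i - j) i; exists m; rewrite ellSS mi mj; split=> //; ring.
Qed.

Section MalgLift.
Variables (K : choiceType) (C : comNzRingType) (V : lmodType C) (h : K -> V).
Implicit Types (g : {malg C[K]}).

(** The linear map that extends h, where K is a basis of the source. *)
Definition malg_lift g : V := \sum_(k <- monalg.msupp g) monalg.mcoeff k g *: h k.

Lemma malg_liftE (d : seq K) g : uniq d -> (forall k, monalg.mcoeff k g != 0 -> k \in d) ->
  malg_lift g = \sum_(k <- d) monalg.mcoeff k g *: h k.
Proof.
move=> ud gd; rewrite /malg_lift [RHS](bigID (fun k => k \in monalg.msupp g)) /=.
rewrite [X in _ + X]big1 ?addr0; last by move=> k; rewrite -monalg.mcoeff_eq0 => /eqP ->; rewrite scale0r.
rewrite -[RHS]big_filter; apply: perm_big; apply: uniq_perm; rewrite ?filter_uniq ?fset_uniq //.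
move=> k; rewrite mem_filter; apply/idP/andP => [kg|[]//]; split=> //.
by apply: gd; rewrite monalg.mcoeff_neq0.
Qed.

Lemma malg_liftD : {morph malg_lift : g1 g2 / g1 + g2}.
Proof.
move=> g1 g2; pose d := undup (monalg.msupp g1 ++ monalg.msupp g2).
have ud : uniq d by exact: undup_uniq.
have d1 k : monalg.mcoeff k g1 != 0 -> k \in d.
  by rewrite monalg.mcoeff_neq0 mem_undup mem_cat => ->.
have d2 k : monalg.mcoeff k g2 != 0 -> k \in d.
  by rewrite monalg.mcoeff_neq0 mem_undup mem_cat => ->; rewrite orbT.
rewrite (malg_liftE ud d1) (malg_liftE ud d2) (malg_liftE (d := d)) //.
  by rewrite -big_split /=; apply: eq_bigr => k _; rewrite monalg.mcoeffD scalerDl.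
move=> k; rewrite monalg.mcoeffD; have [->|/d1 //] := eqVneq (monalg.mcoeff k g1) 0.
by rewrite add0r; exact: d2.
Qed.

Lemma malg_liftU a k : malg_lift (monalg.mkmalgU k a) = a *: h k.
Proof.
rewrite (malg_liftE (d := [:: k])) // => [|l]; last first.
  by rewrite monalg.mcoeffU inE [l == k]eq_sym; case: (k == l); rewrite ?mulr0n ?eqxx.
by rewrite big_seq1 monalg.mcoeffUU.
Qed.

Lemma malg_lift0 : malg_lift 0 = 0.
Proof. by apply: (addrI (malg_lift 0)); rewrite -malg_liftD !addr0. Qed.

Lemma malg_liftZ a g : malg_lift (a *: g) = a *: malg_lift g.
Proof.
rewrite (malg_liftE (d := monalg.msupp g)) ?fset_uniq // => [|k].
  rewrite scaler_sumr; apply: eq_bigr => k _.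
  by rewrite monalg.mcoeffZ scalerA.
by rewrite -monalg.mcoeff_neq0 monalg.mcoeffZ; apply: contra_neq => ->; rewrite mulr0.
Qed.

Lemma malg_lift_sum (J : Type) (r : seq J) (P : pred J) (F : J -> {malg C[K]}) :
  malg_lift (\sum_(i <- r | P i) F i) = \sum_(i <- r | P i) malg_lift (F i).
Proof. exact: (big_morph _ malg_liftD malg_lift0). Qed.

End MalgLift.

Lemma malg_sum (K : choiceType) (C : comNzRingType) (g : {malg C[K]}) :
  g = \sum_(k <- monalg.msupp g) monalg.mkmalgU k (monalg.mcoeff k g).
Proof. by rewrite -monalg.monalgE. Qed.

Lemma ratfun_scaleAl (C : closedFieldType) (X : variety C) (a : C) (u v : ratfun X) :
  (a *: u) * v = a *: (u * v).
Proof. by rewrite -[a *: u]/(rf_cst X a * u) -mulrA. Qed.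

Lemma ratfun_scaleM (C : closedFieldType) (X : variety C) (a b : C) (u v : ratfun X) :
  (a *: u) * (b *: v) = (a * b) *: (u * v).
Proof. by rewrite ratfun_scaleAl [u * _]mulrC ratfun_scaleAl scalerA [v * u]mulrC. Qed.

Section Laurent.
Variables (C : closedFieldType) (X : variety C) (c : nat -> C * C -> pt X).
Hypothesis ax : hex_atlas c.
Variable w : nat -> ratfun X.
Hypothesis hw : hex_coordinates c w.
Local Notation e2 := (@eval2 C).
Local Notation Y := ('X%:P : {poly {poly C}}).
Local Notation ratk k := (rat e2 (c k)).
Let irr := hex_irreducible ax.
Let faith := @eval2_faithful C.

Definition laurent (m : Z2) : ratfun X :=
  zpow (w 0) (w 3) m.1 * zpow (w 1) (w 4) m.2.

Let w03 : w 0 * w 3 = 1. Proof. exact: coordV hw 0. Qed.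
Let w14 : w 1 * w 4 = 1. Proof. exact: coordV hw 1. Qed.

Lemma laurentD m m' : laurent (m + m') = laurent m * laurent m'.
Proof.
rewrite /laurent -[(m + m').1]/(m.1 + m'.1) -[(m + m').2]/(m.2 + m'.2).
by rewrite (zpowD _ _ w03) (zpowD _ _ w14) mulrACA.
Qed.

Lemma laurent0 : laurent 0 = 1. Proof. by rewrite /laurent /= !expr0 mulr1. Qed.

Lemma coordV2 k : w k.+2 * w (k + 5)%N = 1.
Proof. by have := coordV hw k.+2; rewrite -[k.+2]addn2 -addnA. Qed.

(** The induction step replaces w_(k+2) by w_(k+1) / w_k. *)
Lemma laurent_chart k m : laurent m =
  zpow (w k) (w (k + 3)) (ell k m) * zpow (w k.+2) (w (k + 5)) (ell k.+1 m).
Proof.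
elim: k => [|k ->].
  rewrite add0n /laurent -[ell 0 m]/(m.1 + m.2) -[ell 1 m]/(m.2) (zpowD _ _ w03).
  rewrite -mulrA -zpowM -(coordM hw 0).
  by have -> : w 3 * w (0 + 5)%N = w 4 by rewrite -(coordM hw 3).
have e6 : w (k.+1 + 5)%N = w k by rewrite addSnnS (coord_period hw k 1).
have e7 : w k.+3 = w (k + 3)%N by rewrite addn3.
have e4 : w (k.+1 + 3)%N = w (k + 3)%N * w (k + 5)%N.
  have -> : (k.+1 + 3 = (k + 3).+1)%N by lia.
  by rewrite (coordM hw) -[(k + 3).+2]addn2 -addnA.
rewrite ellSS e6 e7 e4 [w k.+1](coordM hw) zpowM (zpowV (w k) (w (k + 3)%N)) opprB mulrAC.
by rewrite -(zpowD _ _ (coordV hw k)) addrC subrK.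
Qed.

Definition laurent_comb : {malg C[Z2]} -> ratfun X := malg_lift laurent.

Lemma zpow_nat (a b : ratfun X) (i : int) : 0 <= i -> zpow a b i = a ^+ `|i|%N.
Proof. by case: i. Qed.

Lemma rat_const k a : ratk k (rf_cst X a) a%:P%:P 1.
Proof. by apply: (rat_cst _ irr faith) => t; rewrite eval2C. Qed.

Lemma rat_pow k u F n : ratk k u F 1 -> ratk k (u ^+ n) (F ^+ n) 1.
Proof.
move=> ru; elim: n => [|n IHn]; first by rewrite !expr0; exact: rat1.
by rewrite !exprS -[X in rat _ _ _ _ X]mulr1; exact: ratM.
Qed.

Lemma ratM1 k u v F G : ratk k u F 1 -> ratk k v G 1 -> ratk k (u * v) (F * G) 1.
Proof. by move=> ru rv; rewrite -[X in rat _ _ _ _ X]mulr1; exact: ratM. Qed.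

Lemma rat_monomial k a i j :
  ratk k (a *: (w k ^+ i * w k.+2 ^+ j)) (a%:P%:P * ('X ^+ i * Y ^+ j)) 1.
Proof.
apply: ratM1; first exact: rat_const.
by apply: ratM1; apply: rat_pow; [exact: coordX hw k | exact: coordY hw k].
Qed.

Lemma rat_sum k (I : eqType) (r : seq I) (u : I -> ratfun X) (F : I -> {poly {poly C}}) :
  (forall i, i \in r -> ratk k (u i) (F i) 1) ->
  ratk k (\sum_(i <- r) u i) (\sum_(i <- r) F i) 1.
Proof.
elim: r => [|i r IHr] ru.
  by rewrite !big_nil -[X in rat _ _ _ X]polyC0 -[X in X%:P]polyC0; exact: rat_const.
rewrite !big_cons; apply: ratD => //; first by apply: ru; rewrite mem_head.
by apply: IHr => l lr; apply: ru; rewrite in_cons lr orbT.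
Qed.

(** The monomials of H, divided by w_k^a w_(k+2)^b, are Laurent monomials with
    poles of order at most a and b along the two axes of the chart. *)
Lemma chart_expansion k a b u H : ratk k (u * (w k ^+ a * w k.+2 ^+ b)) H 1 ->
  exists g, u = laurent_comb g /\ forall m, monalg.mcoeff m g != 0 ->
    - a%:Z <= ell k m /\ - b%:Z <= ell k.+1 m.
Proof.
move=> ru; have ex (ij : nat * nat) : exists m, ell k m = ij.1%:Z - a%:Z /\ ell k.+1 m = ij.2%:Z - b%:Z.
  exact: ell_surj.
have [mk mkP] := choice ex.
pose g := \sum_(i < size H) \sum_(j < size H`_i) monalg.mkmalgU (mk (val i, val j)) H`_i`_j.
have HE : H = \sum_(i < size H) \sum_(j < size H`_i) (H`_i`_j)%:P%:P * ('X ^+ i * Y ^+ j).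
  rewrite -{1}[H]coefK poly_def; apply: eq_bigr => i _.
  rewrite -{1}[H`_i]coefK poly_def -mul_polyC rmorph_sum mulr_suml.
  by apply: eq_bigr => j _; rewrite /= -mul_polyC polyCM polyC_exp; ring.
exists g; split=> [|m gm].
  have wV := coordV hw k; have wV2 := coordV2 k.
  have cancel : w k ^+ a * w k.+2 ^+ b * (w (k + 3)%N ^+ a * w (k + 5)%N ^+ b) = 1.
    by rewrite mulrACA -!exprMn wV wV2 !expr1n mulr1.
  apply: (genM_neq cancel).
  apply: (rat_eq irr (hex_chart ax k) faith (oner_neq0 _) (oner_neq0 _) ru _ erefl).
  rewrite [X in rat _ _ _ X]HE /g /laurent_comb malg_lift_sum mulr_suml; apply: rat_sum => i _.
  rewrite malg_lift_sum mulr_suml; apply: rat_sum => j _.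
  rewrite malg_liftU (laurent_chart k).
  have [-> ->] := mkP (val i, val j); rewrite /= !zpowB // ratfun_scaleAl.
  have -> : w k ^+ i * w (k + 3)%N ^+ a * (w k.+2 ^+ j * w (k + 5)%N ^+ b) *
      (w k ^+ a * w k.+2 ^+ b) = (w k ^+ i * w k.+2 ^+ j) *
      (w k ^+ a * w k.+2 ^+ b * (w (k + 3)%N ^+ a * w (k + 5)%N ^+ b)) by ring.
  by rewrite cancel mulr1; exact: rat_monomial.
suff [i [j ->]] : exists i j, m = mk (i, j).
  by have [-> ->] := mkP (i, j); split; lia.
apply: contrapT => nm; move: gm; rewrite raddf_sum big1 ?eqxx // => i _.
rewrite raddf_sum big1 // => j _; rewrite /= monalg.mcoeffU.
by case: eqP => // E; case: nm; exists i, j.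
Qed.

Lemma coef_monomial (a : C) i j i' j' :
  (a%:P%:P * ('X ^+ i * Y ^+ j))`_i'`_j' = a *+ ((i' == i) && (j' == j)).
Proof.
rewrite -polyC_exp !coefCM ['X^i * _]mulrC coefCM coefXn.
case: (i' == i); rewrite /= ?mulr1 ?mulr0 ?coef0 ?mulr0 // coefXn.
by case: (j' == j); rewrite ?mulr1 ?mulr0.
Qed.

Lemma laurent_combD : {morph laurent_comb : g h / g + h}. Proof. exact: malg_liftD. Qed.
Lemma laurent_combU m a : laurent_comb (monalg.mkmalgU m a) = a *: laurent m.
Proof. exact: malg_liftU. Qed.

Lemma ell_inj k m m' : ell k m = ell k m' -> ell k.+1 m = ell k.+1 m' -> m = m'.
Proof.
elim: k => [|k IHk]; rewrite ?ellSS => E E'; last by apply: IHk; lia.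
case: m m' E E' => [a b] [a' b']; rewrite /ell /= => E E'.
by congr pair; lia.
Qed.

(** Distinct Laurent monomials are linearly independent: after multiplication by
    a high power of the coordinates of the chart 0 they are distinct monomials of
    a polynomial ring. *)
Lemma laurent_comb_inj0 g : laurent_comb g = 0 -> g = 0.
Proof.
move=> g0; pose N := (\sum_(m <- monalg.msupp g) (`|ell 0 m| + `|ell 1 m|))%N.
have NP m : m \in monalg.msupp g -> 0 <= ell 0 m + N%:Z /\ 0 <= ell 1 m + N%:Z.
  move=> mg; suff : (`|ell 0 m| + `|ell 1 m| <= N)%N by lia.
  by rewrite /N (big_rem m) //= leq_addr.
pose e0 m := absz (ell 0 m + N%:Z); pose e1 m := absz (ell 1 m + N%:Z).
have mE m : m \in monalg.msupp g ->
    laurent m * (w 0 ^+ N * w 2 ^+ N) = w 0 ^+ e0 m * w 2 ^+ e1 m.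
  move=> /NP[h0 h1]; rewrite (laurent_chart 0) mulrACA.
  rewrite -[w 0 ^+ N]/(zpow (w 0) (w (0 + 3)%N) N%:Z) -[w 2 ^+ N]/(zpow (w 2) (w (0 + 5)%N) N%:Z).
  by rewrite -!zpowD ?(coordV hw 0) ?(coordV2 0) // !zpow_nat.
have r0 : ratk 0 0 0 1 by rewrite -[X in rat _ _ _ X]polyC0 -[X in X%:P]polyC0; exact: rat_const.
pose F := \sum_(m <- monalg.msupp g) (monalg.mcoeff m g)%:P%:P * ('X ^+ e0 m * Y ^+ e1 m).
have rF : ratk 0 0 F 1.
  rewrite -[X in rat _ _ X](mul0r (w 0 ^+ N * w 2 ^+ N)) -g0 /laurent_comb /malg_lift mulr_suml.
  by apply: rat_sum => m /mE E; rewrite ratfun_scaleAl E; exact: rat_monomial.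
have F0 : F = 0.
  by have := rat_det irr (hex_chart ax 0) faith rF r0; rewrite mulr1 mul0r.
apply/malgP => m; rewrite monalg.mcoeff0; apply/eqP; apply: contraT.
rewrite monalg.mcoeff_neq0 => mg.
have := congr1 (fun f : {poly {poly C}} => f`_(e0 m)`_(e1 m)) F0.
rewrite /F (big_rem m) //= coefD coefD coef_monomial !eqxx mulr1n coef0 coef0.
rewrite big_seq coef_sum coef_sum big1 ?addr0 => [E|m' m'g].
  by move: mg; rewrite -monalg.mcoeff_neq0 E eqxx.
have m'm : m' != m by apply: contraTneq m'g => ->; rewrite mem_rem_uniqF ?fset_uniq.
have [h0 h1] := NP _ mg; have [h0' h1'] := NP _ (mem_rem m'g).
rewrite coef_monomial; case: eqP => //= E0; case: eqP => //= E1.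
by case/eqP: m'm; apply: (@ell_inj 0); move: E0 E1; rewrite /e0 /e1; lia.
Qed.

Lemma laurent_comb_inj : injective laurent_comb.
Proof.
move=> g h gh; apply/eqP; rewrite -subr_eq0; apply/eqP/laurent_comb_inj0.
by rewrite laurent_combD -scaleN1r /laurent_comb malg_liftZ -/(laurent_comb h) -gh scaleN1r subrr.
Qed.

(** The chart is an affine plane. *)
Lemma polynomial_of_regular k u : (forall t, local_ring (c k t) u) ->
  exists H, ratk k u H 1.
Proof.
have ch := hex_chart ax k.
move=> uO; have [F [G [G0 ru]]] := rat_exists irr ch faith u.
have [|H FH] := @regular_is_poly _ F G G0.
  move=> x y; have /(local_ring_rat irr ch faith)[F' [G' [G'0 ru']]] := uO (x, y).
  by exists F', G'; split=> //; exact: rat_det ru ru'.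
by exists H; apply: (rat_equiv irr ch faith G0 ru); rewrite mulr1.
Qed.

Lemma local_ring_coord k t i j : local_ring (c k t) (w k ^+ i * w k.+2 ^+ j).
Proof.
apply: (local_ring_poly irr (hex_chart ax k) faith).
by apply: ratM1; apply: rat_pow; [exact: coordX hw k | exact: coordY hw k].
Qed.

Lemma local_ringZ a (p : pt X) u : local_ring p u -> local_ring p (a *: u).
Proof. by move=> uO; apply: local_ringM => //; exact: local_ring_cst. Qed.

(** Sections of a divisor supported on the hexagon.  On each chart the section is
    a combination of monomials with bounded poles along the two axes; since
    the monomials are linearly independent, these combinations agree, and all
    the bounds hold for the same combination. *)
Lemma laurent_sections (a : nat -> nat) u :
  (forall k t, local_ring (c k t) (u * (w k ^+ a k * w k.+2 ^+ a k.+1))) <->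
  exists g, u = laurent_comb g /\
    forall m, monalg.mcoeff m g != 0 -> forall k, - (a k)%:Z <= ell k m.
Proof.
split=> [uO|[g [-> gP]] k t].
  have ex k : exists g, u = laurent_comb g /\ forall m, monalg.mcoeff m g != 0 -> - (a k)%:Z <= ell k m.
    have [H /chart_expansion[g [ug gP]]] := polynomial_of_regular (uO k).
    by exists g; split=> // m /gP[].
  have [g [ug _]] := ex 0; exists g; split=> // m gm k.
  have [h [uh hP]] := ex k; apply: hP.
  by rewrite (laurent_comb_inj (etrans (esym uh) ug)).
rewrite /laurent_comb /malg_lift mulr_suml big_seq; apply: big_ind.
- exact: local_ring_cst.
- by move=> *; exact: local_ringD.
move=> m; rewrite -monalg.mcoeff_neq0 => /gP mP.
rewrite ratfun_scaleAl; apply: local_ringZ.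
rewrite (laurent_chart k) mulrACA.
rewrite -[w k ^+ _]/(zpow (w k) (w (k + 3)%N) (a k)%:Z).
rewrite -[w k.+2 ^+ _]/(zpow (w k.+2) (w (k + 5)%N) (a k.+1)%:Z).
rewrite -!zpowD ?coordV2 ?(coordV hw) //.
have := mP k; have := mP k.+1 => h1 h0.
rewrite !zpow_nat; [exact: local_ring_coord | lia | lia].
Qed.

End Laurent.

(** * Relabelling the hexagon *)

Lemma reparametrized_chart (C : closedFieldType) (X : variety C) (T : Type)
    (A : comNzRingType) (e : T -> {rmorphism A -> C}) (c : T -> pt X) (j : T -> T) :
  chart e c -> (forall t, exists s, t = j s) ->
  (forall f, exists f', forall t, e t f' = e (j t) f) ->
  (forall f', exists f, forall t, e t f' = e (j t) f) -> chart e (c \o j).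
Proof.
move=> chc onto r1 r2.
have rE : range (c \o j) = range c.
  apply/seteqP; split=> _ [t _ <-]; first by exists (j t).
  by have [s ->] := onto t; exists s.
split=> [d||f'].
- have [m [m0 mE]] := chart_form chc d; exists (m \o j); split=> [t|F hF]; first exact: m0.
  by have [f fE] := mE F hF; have [f' f'E] := r1 f; exists f' => t; rewrite f'E /= -fE.
- by rewrite rE; exact: chart_open chc.
- have [f f'E] := r2 f'; have [h rh hE] := chart_fun chc f.
  by exists h => [|t]; rewrite ?rE // f'E -hE.
Qed.

Section Relabelling.
Variables (C : closedFieldType) (X : variety C).
Implicit Types (c : nat -> C * C -> pt X).
Local Notation e2 := (@eval2 C).

(** Substitution of polynomials for the coordinates. *)
Lemma eval2_reparam (j : C * C -> C * C) :
  (exists f, forall t, e2 t f = (j t).1) -> (exists f, forall t, e2 t f = (j t).2) ->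
  forall f, exists f', forall t, e2 t f' = e2 (j t) f.
Proof.
move=> [fx fxE] [fy fyE]; apply: poly_generated => [|||].
- apply: poly_generated => [a|||].
  + by exists a%:P%:P => t; rewrite !eval2C.
  + by exists fy => t; rewrite eval2Y.
  + by move=> f g [f' f'E] [g' g'E]; exists (f' + g') => t; rewrite polyCD !rmorphD f'E g'E.
  + by move=> f g [f' f'E] [g' g'E]; exists (f' * g') => t; rewrite polyCM !rmorphM f'E g'E.
- by exists fx => t; rewrite eval2X.
- by move=> f g [f' f'E] [g' g'E]; exists (f' + g') => t; rewrite !rmorphD f'E g'E.
- by move=> f g [f' f'E] [g' g'E]; exists (f' * g') => t; rewrite !rmorphM f'E g'E.
Qed.

Lemma hex_shift c m : hex_atlas c -> hex_atlas (fun k => c (k + m)%N).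
Proof.
move=> ax; split=> [k|a|k t|k x y x0|j k k' t t' tt'].
- exact: hex_chart ax _.
- have [k [t ->]] := hex_cover ax a; exists (k + 5 * m)%N, t.
  by apply: (hex_mod ax); lia.
- by apply: (hex_mod ax); lia.
- by rewrite (hex_glue ax).
have E l s : e2 s (edge_poly C j l) = e2 s (edge_poly C (j + m) (l + m)).
  rewrite !edge_poly_val; suff -> : ((j + m + 5 * (l + m)) %% 6 = (j + 5 * l) %% 6)%N by [].
  by lia.
by rewrite !E; exact: (hex_edge ax (j := (j + m)%N) tt').
Qed.

Lemma edge_shift c m j : hex_atlas c -> edge (fun k => c (k + m)%N) j = edge c (j + m).
Proof.
move=> ax; have E l s : e2 s (edge_poly C j l) = e2 s (edge_poly C (j + m) (l + m)).
  rewrite !edge_poly_val; suff -> : ((j + m + 5 * (l + m)) %% 6 = (j + 5 * l) %% 6)%N by [].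
  by lia.
apply/seteqP; split=> a; first by move=> [k [t [-> t0]]]; exists (k + m)%N, t; rewrite -E.
move=> [k [t [-> t0]]]; exists (k + 5 * m)%N, t; split.
  by apply: (hex_mod ax); lia.
move: t0; rewrite !edge_poly_val.
suff -> : ((j + m + 5 * k) %% 6 = (j + 5 * (k + 5 * m)) %% 6)%N by [].
by lia.
Qed.

Definition swap (t : C * C) : C * C := (t.2, t.1).
Lemma swapK t : swap (swap t) = t. Proof. by case: t. Qed.

(** The reflection of the hexagon that exchanges the two axes of the chart 0. *)
Definition hex_flip c k t := c (5 * k)%N (swap t).

Lemma edge_flip_val j k t : e2 (swap t) (edge_poly C (5 * j + 1) (5 * k)) =
  e2 t (edge_poly C j k).
Proof.
rewrite !edge_poly_val.
have -> : ((5 * j + 1 + 5 * (5 * k)) %% 6 = (1 + 5 * ((j + 5 * k) %% 6)) %% 6)%N by lia.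
have := ltn_pmod (j + 5 * k) (isT : (0 < 6)%N).
by case: ((_ %% _)%N) => [|[|[|[|[|[|//]]]]]].
Qed.

Lemma hex_flip_atlas c : hex_atlas c -> hex_atlas (hex_flip c).
Proof.
move=> ax; split=> [k|a|k t|k x y x0|j k k' t t' tt'].
- have swX : exists f, forall t, e2 t f = (swap t).1 by exists 'X%:P => t; rewrite eval2Y.
  have swY : exists f, forall t, e2 t f = (swap t).2 by exists 'X => t; rewrite eval2X.
  have sw := eval2_reparam swX swY.
  apply: (reparametrized_chart (j := swap) (hex_chart ax (5 * k))) => // [[x y]|f'].
    by exists (y, x).
  by have [f fE] := sw f'; exists f => t; rewrite fE /swap /=; case: t.
- have [k [t ->]] := hex_cover ax a; exists (5 * k)%N, (swap t).
  by rewrite /hex_flip swapK; apply: (hex_mod ax); lia.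
- by apply: (hex_mod ax); lia.
- rewrite /hex_flip /swap /= [RHS](hex_glue ax) ?invr_eq0 // invrK mulKf //.
  by apply: (hex_mod ax); lia.
rewrite -(edge_flip_val j k) -(edge_flip_val j k'); exact: (hex_edge ax tt').
Qed.

Lemma edge_flip c j : hex_atlas c -> edge (hex_flip c) j = edge c (5 * j + 1).
Proof.
move=> ax; apply/seteqP; split=> a.
  move=> [k [t [-> t0]]]; exists (5 * k)%N, (swap t); split=> //.
  by rewrite edge_flip_val.
move=> [k [t [-> t0]]]; exists (5 * k)%N, (swap t); split.
  by rewrite /hex_flip swapK; apply: (hex_mod ax); lia.
rewrite -edge_flip_val swapK -t0 !edge_poly_val.
suff -> : ((5 * j + 1 + 5 * (5 * (5 * k))) %% 6 = (5 * j + 1 + 5 * k) %% 6)%N by [].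
by lia.
Qed.

(** A point of the torus moves the coordinates. *)
Definition hex_scale (d : nat -> C) c k (t : C * C) := c k (d k * t.1, d k.+2 * t.2).

Lemma hex_rescale c w (d : nat -> C) : hex_atlas c -> hex_coordinates c w ->
  (forall k, d k.+1 = d k * d k.+2) -> (forall k, d k * d (k + 3)%N = 1) ->
  [/\ hex_atlas (hex_scale d c),
      hex_coordinates (hex_scale d c) (fun k => d (k + 3)%N *: w k)
    & forall j, edge (hex_scale d c) j = edge c j].
Proof.
move=> ax hw dM dV.
have d0 k : d k != 0 by apply/eqP => E; have /esym/eqP := dV k; rewrite E mul0r oner_eq0.
have d3 k : d (k + 3)%N = (d k)^-1 by apply: (mulfI (d0 k)); rewrite dV mulfV.
have d6 k : d (k + 6)%N = d k.
  by rewrite -[(k + 6)%N]/(k + (3 + 3))%N addnA !d3 invrK.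
pose sc k (t : C * C) := (d k * t.1, d k.+2 * t.2).
have scK k t : sc k ((d k)^-1 * t.1, (d k.+2)^-1 * t.2) = t.
  by rewrite /sc /= !mulVKf -?surjective_pairing.
have e0 j k t : (e2 (sc k t) (edge_poly C j k) = 0) <-> (e2 t (edge_poly C j k) = 0).
  rewrite !edge_poly_val; case: ((_ %% _)%N) => [|[|_]] //=; split=> [/eqP|->]; rewrite ?mulr0 //.
    by rewrite mulf_eq0 (negPf (d0 _)) => /eqP.
  by rewrite mulf_eq0 (negPf (d0 _)) => /eqP.
have reparam k (f : {poly {poly C}}) : exists f', forall t, e2 t f' = e2 (sc k t) f.
  apply: eval2_reparam.
    by exists ((d k)%:P%:P * 'X) => t; rewrite rmorphM eval2C eval2X.
  by exists ((d k.+2)%:P%:P * 'X%:P) => t; rewrite rmorphM eval2C eval2Y.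
have reparam' k (f' : {poly {poly C}}) : exists f, forall t, e2 t f' = e2 (sc k t) f.
  have [||f fE] := @eval2_reparam (fun t => ((d k)^-1 * t.1, (d k.+2)^-1 * t.2)) _ _ f'.
  - by exists ((d k)^-1%:P%:P * 'X) => t; rewrite rmorphM eval2C eval2X.
  - by exists ((d k.+2)^-1%:P%:P * 'X%:P) => t; rewrite rmorphM eval2C eval2Y.
  by exists f => t; rewrite fE /sc /= !mulKf -?surjective_pairing.
have ax' : hex_atlas (hex_scale d c).
  split=> [k|a|k t|k x y x0|j k k' t t' tt'].
  - apply: (reparametrized_chart (j := sc k) (hex_chart ax k)) => // t.
    by exists ((d k)^-1 * t.1, (d k.+2)^-1 * t.2); rewrite scK.
  - have [k [t ->]] := hex_cover ax a; exists k, ((d k)^-1 * t.1, (d k.+2)^-1 * t.2).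
    by rewrite /hex_scale -/(sc k _) scK.
  - have E : ((k + 6).+2 = k.+2 + 6)%N by lia.
    by rewrite /hex_scale E !d6 (hex_period ax).
  - rewrite /hex_scale /= (hex_glue ax) ?mulf_neq0 //; congr (c _ (_, _)).
      by rewrite (dM k); ring.
    by rewrite -addn3 d3 invfM mulrC.
  by move=> /e0/(hex_edge ax tt')/e0.
split=> //.
- have irr := hex_irreducible ax; have f2 := @eval2_faithful C.
  have rw k l F : rat e2 (c k) (w l) F 1 -> forall F', (forall t, d (l + 3)%N * e2 (sc k t) F = e2 t F') ->
      rat e2 (hex_scale d c k) (d (l + 3)%N *: w l) F' 1.
    move=> rwl F' FF'.
    have [U [oU U0 uE]] : rat e2 (c k) (d (l + 3)%N *: w l) ((d (l + 3)%N)%:P%:P * F) 1.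
      rewrite -[X in rat _ _ _ _ X]mulr1; apply: ratM => //.
      by apply: (rat_cst _ irr f2) => t; rewrite eval2C.
    exists U; split=> // t Ut; rewrite rmorph1 -FF'.
    by have := uE _ Ut; rewrite rmorph1 rmorphM eval2C.
  split=> [k|k|k|k].
  + by apply: (rw k k 'X (coordX hw k)) => t; rewrite !eval2X /= d3 mulKf.
  + by apply: (rw k k.+2 _ (coordY hw k)) => t; rewrite !eval2Y /= d3 mulKf.
  + by rewrite ratfun_scaleM -(coordM hw) !d3 (dM k) invfM.
  + by rewrite ratfun_scaleM (coordV hw) dV scale1r.
- move=> j; apply/seteqP; split=> a [k [t [-> t0]]].
    by exists k, (sc k t); split=> //; apply/e0.
  exists k, ((d k)^-1 * t.1, (d k.+2)^-1 * t.2); split.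
    by rewrite /hex_scale -/(sc k _) scK.
  by apply/e0; rewrite scK.
Qed.

End Relabelling.

(** * Automorphisms that rotate the hexagon *)

Lemma ideal_stalk_pullback (C : closedFieldType) (X : variety C)
    (s : automorphism X) (Z : set (pt X)) p u :
  ideal_stalk Z (s p) u -> ideal_stalk (s @^-1` Z) p (pullback s u).
Proof.
move=> [U [f [Up uf fZ]]]; exists (s @^-1` U), (f \o s); split=> //.
  exact: represents_pullback.
by move=> q Uq Zq; exact: fZ.
Qed.

Section Rotation.
Variables (C : closedFieldType) (X : variety C) (c : nat -> C * C -> pt X).
Hypothesis ax : hex_atlas c.
Variable w : nat -> ratfun X.
Hypothesis hw : hex_coordinates c w.
Variable s : automorphism X.
Hypothesis rot : forall j, s @^-1` edge c j = edge c j.+1.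

Lemma rot_inv j : aut_invA s @^-1` edge c j.+1 = edge c j.
Proof.
by rewrite -rot; apply/seteqP; split=> a; rewrite /= aut_invK.
Qed.

(** The pullback along s maps the ideal of E_j at s(p) onto the ideal of E_(j+1)
    at p, so the generators correspond up to a unit at p. *)
Lemma pullback_gen j k k' t t' : s (c k t) = c k' t' ->
  local_ring (c k t) (pullback s (gen w j k') * genV w j.+1 k) /\
  local_ring (c k t) (gen w j.+1 k * pullback s (genV w j k')).
Proof.
move=> st; split.
  apply/(edge_ideal ax hw); rewrite -rot; apply: ideal_stalk_pullback.
  by rewrite st; apply/(edge_ideal ax hw); rewrite (genK hw); exact: local_ring_cst.
have ct : aut_invA s (c k' t') = c k t by rewrite -st /= aut_funK.
rewrite -[gen w j.+1 k](pullback_invK s) -pullbackM; apply: local_ring_pullback.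
rewrite st; apply/(edge_ideal ax hw); rewrite -(rot_inv j).
apply: ideal_stalk_pullback; rewrite ct.
by apply/(edge_ideal ax hw); rewrite (genK hw); exact: local_ring_cst.
Qed.

(** Pulling back along s turns the relation for the divisor of w_l into the
    relation for the divisor of w_(l+1), up to units: the pullback of w_l is
    w_(l+1) times a function that is regular at every point. *)
Lemma pullback_coord_regular l p :
  local_ring p (pullback s (w l) * w (l + 4)%N).
Proof.
have [k [t ->]] := hex_cover ax p; have [k' [t' st]] := hex_cover ax (s (c k t)).
have [e0 _] := pullback_gen l st; have [e5 _] := pullback_gen (l + 5)%N st.
have [_ e2] := pullback_gen (l + 2)%N st; have [_ e3] := pullback_gen (l + 3)%N st.
have := local_ringM (local_ringM e0 e5) (local_ringM e2 e3).
set S := pullback s; set u := (X in local_ring _ X -> _).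
suff -> : u = S (w l) * w (l + 4)%N by [].
have K j l' := genK hw j l'.
have E1 : w l = gen w l k' * gen w (l + 5) k' * (genV w (l + 2) k' * genV w (l + 3) k').
  rewrite -(coord_divisor hw l k') -!mulrA [gen w (l + 3) k' * _]mulrCA K.
  by rewrite mulr1 K mulr1.
have E2 : w (l + 4)%N = genV w l.+1 k * genV w (l + 5).+1 k * (gen w (l + 2).+1 k * gen w (l + 3).+1 k).
  have := coord_divisor hw l.+1 k.
  have -> : (l.+1 + 2 = (l + 2).+1)%N by lia. have -> : (l.+1 + 3 = (l + 3).+1)%N by lia.
  have -> : (l.+1 + 5 = (l + 5).+1)%N by lia. move=> E.
  have wV : w l.+1 * w (l + 4)%N = 1 by rewrite -[(l + 4)%N]addSnnS (coordV hw).
  apply: (genM_neq wV); rewrite mulrC wV.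
  transitivity (genV w l.+1 k * genV w (l + 5).+1 k *
    (w l.+1 * gen w (l + 2).+1 k * gen w (l + 3).+1 k)); last by ring.
  rewrite E -[LHS]mulr1 -{1}(K l.+1 k) -(K (l + 5).+1 k); ring.
rewrite E2 {1}E1 /u /S !pullbackM -/S.
set a1 := S (gen w l k'); set a2 := S (gen w (l + 5) k').
set a3 := S (genV w (l + 2) k'); set a4 := S (genV w (l + 3) k').
set b1 := genV w l.+1 k; set b2 := genV w (l + 5).+1 k.
set b3 := gen w (l + 2).+1 k; set b4 := gen w (l + 3).+1 k.
ring.
Qed.

(** A monomial with order at least 0 along all the edges is constant, as the
    orders along opposite edges are opposite to each other. *)
Lemma regular_constant u : (forall p, local_ring p u) -> exists a, u = rf_cst X a.
Proof.
move=> uO; have [|g [-> gP]] := (laurent_sections ax hw (fun=> 0%N) u).1.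
  by move=> k t; rewrite !expr0 !mulr1; exact: uO.
exists (monalg.mcoeff 0 g).
rewrite /laurent_comb (malg_liftE _ (d := [:: 0])) // => [|m /gP mP].
  by rewrite big_seq1 laurent0 -[_ *: _]/(rf_cst X _ * 1) mulr1.
rewrite inE; case: m mP => a b mP.
have := mP 0; have := mP 1; have := mP 2; have := mP 3; have := mP 4; have := mP 5.
rewrite /ell /= => *; apply/eqP; congr pair; lia.
Qed.

Lemma pullback_coord l : exists a, pullback s (w l) = a *: w l.+1.
Proof.
have [a aE] := regular_constant (pullback_coord_regular l); exists a.
have wV : w (l + 4)%N * w l.+1 = 1 by rewrite -[(l + 4)%N]addSnnS mulrC (coordV hw).
by rewrite -[LHS]mulr1 -wV mulrA aE.
Qed.

Lemma ratfun1_neq0 : 1 != 0 :> ratfun X.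
Proof.
have irr := hex_irreducible ax; have f2 := @eval2_faithful C.
apply/eqP => E; have r1 := rat1 (c 0) irr f2.
have r0 : rat (@eval2 C) (c 0) 1 0 1.
  by rewrite E; apply: (rat_cst _ irr f2) => t; rewrite rmorph0.
have /eqP := rat_det irr (hex_chart ax 0) f2 r1 r0.
by rewrite mulr1 mul0r oner_eq0.
Qed.

Lemma scale_coord_inj a b l : a *: w l = b *: w l -> a = b.
Proof.
move=> E; have {}E : (a - b) *: w l = 0 by rewrite scalerBl E subrr.
apply/eqP; rewrite -subr_eq0; apply: contraT => ab.
have : (a - b)^-1 *: ((a - b) *: w l) * w (l + 3)%N = 0 by rewrite E scaler0 mul0r.
by rewrite scalerA mulVf // scale1r (coordV hw) => /eqP; rewrite (negPf ratfun1_neq0).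
Qed.

End Rotation.

(** A rotation of the hexagon has a fixed point in the torus.  In the
    coordinates centred at this point it permutes the coordinate functions. *)
Lemma rotation_coordinates (C : closedFieldType) (X : variety C)
    (c : nat -> C * C -> pt X) (s : automorphism X) : hex_atlas c ->
  (forall j, s @^-1` edge c j = edge c j.+1) ->
  exists c' w, [/\ hex_atlas c', hex_coordinates c' w,
    forall j, edge c' j = edge c j & forall k, pullback s (w k) = w k.+1].
Proof.
move=> ax rot; have [w hw] := hex_coordinates_exist ax.
have [a aE] := choice (pullback_coord ax hw rot).
have aM k : a k.+1 = a k * a k.+2.
  apply: (scale_coord_inj ax hw (l := k.+2)); rewrite -aE (coordM hw k) pullbackM !aE.
  by rewrite ratfun_scaleM -(coordM hw k.+1).
have aV k : a k * a (k + 3)%N = 1.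
  apply: (scale_coord_inj ax hw (l := 0)); rewrite scale1r.
  have := congr1 (pullback s) (coordV hw k); rewrite pullbackM pullback1 !aE.
  rewrite ratfun_scaleM -[(k + 3).+1]addSn (coordV hw) => E.
  by rewrite -[w 0]mul1r -ratfun_scaleAl E.
(* The scaling factors d solve d_(k+1) a_k = d_k together with the relations
   between the coordinates, which leaves d_0 = a_1. *)
have a0 k : a k != 0 by apply/eqP => E; have /esym/eqP := aV k; rewrite E mul0r oner_eq0.
pose d k := a k.+1.
have dM k : d k.+1 = d k * d k.+2 by exact: aM.
have dV k : d k * d (k + 3)%N = 1 by rewrite /d -addSn.
have [ax' hw' eE] := hex_rescale ax hw dM dV.
exists (hex_scale d c), (fun k => d (k + 3)%N *: w k); split=> // k.
rewrite pullbackZ aE scalerA; congr (_ *: _).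
have d3 l : d (l + 3)%N = (d l)^-1.
  by apply: (@mulfI _ (d l)); rewrite ?dV ?mulfV // /d.
rewrite !d3 /d; have := aM k => E; rewrite E.
by rewrite invfM mulrAC mulVf ?mul1r //.
Qed.

(** * Sections of the twisted powers *)

(** The number of i < n that are congruent to k modulo 6. *)
Definition residue_count (k n : nat) : nat := ((n + (5 - k %% 6)) %/ 6)%N.

(** The exponents of the sections of E_0 + ... + E_(n-1). *)
Definition polygon (n : nat) (m : Z2) := forall k, - (residue_count k n)%:Z <= ell k m.

Lemma pullback_invAK (C : closedFieldType) (X : variety C) (s : automorphism X) u :
  pullback (aut_invA s) (pullback s u) = u.
Proof.
apply: ratfun_eq; apply: gen_eq_fun.
- by apply: repr_pullback; apply: repr_pullback; exact: gen_eq_refl.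
- exact: gen_eq_refl.
- by move=> a /=; rewrite aut_invK.
Qed.

Lemma local_ring_pullback_iff (C : closedFieldType) (X : variety C)
    (s : automorphism X) p u : local_ring p (pullback s u) <-> local_ring (s p) u.
Proof.
split; last exact: local_ring_pullback.
move=> uO; rewrite -(pullback_invAK s u); apply: local_ring_pullback.
by rewrite /= aut_funK.
Qed.

Section TwistedPowers.
Variables (C : closedFieldType) (X : variety C) (c : nat -> C * C -> pt X).
Hypothesis ax : hex_atlas c.
Variable w : nat -> ratfun X.
Hypothesis hw : hex_coordinates c w.
Variable s : automorphism X.
Hypothesis rot : forall j, s @^-1` edge c j = edge c j.+1.
Local Notation L := (divisor_sheaf (edge c 0)).

(** Pulling back the divisor E_0 along the i-th power of s gives E_i. *)
Lemma iter_pullback_divisor i k t u :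
  iter i (pullback_sheaf s) L (c k t) u <-> local_ring (c k t) (u * gen w i k).
Proof.
elim: i k t u => [|i IHi] k t u; first exact: (divisor_edge ax hw).
have [k' [t' st]] := hex_cover ax (s (c k t)).
have [e1 e2] := pullback_gen ax hw rot i st.
split=> [[v]|uO].
  rewrite st => /IHi vO <-.
  have {}vO : local_ring (c k t) (pullback s (v * gen w i k')).
    by apply/local_ring_pullback_iff; rewrite st.
  have -> : pullback s v * gen w i.+1 k = pullback s (v * gen w i k') *
      (gen w i.+1 k * pullback s (genV w i k')).
    transitivity (pullback s v * gen w i.+1 k * pullback s (gen w i k' * genV w i k')).
      by rewrite (genK hw) pullback1 mulr1.
    by rewrite !pullbackM; ring.
  exact: local_ringM.
exists (pullback (aut_invA s) u); last exact: pullback_invK.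
rewrite st; apply/IHi; rewrite -st; apply/local_ring_pullback_iff.
rewrite pullbackM pullback_invK.
have -> : u * pullback s (gen w i k') = (u * gen w i.+1 k) *
    (pullback s (gen w i k') * genV w i.+1 k).
  by rewrite [RHS]mulrACA (genK hw) mulr1.
exact: local_ringM.
Qed.

(** The generators are invertible rational functions, so that the product of two
    fractional ideals with such generators is the fractional ideal of the product
    of the generators. *)
Lemma twisted_power_stalk n k t u : twisted_power L s n (c k t) u <->
  local_ring (c k t) (u * \prod_(i < n) gen w i k).
Proof.
elim: n u => [|n IHn] u; first by rewrite big_ord0 mulr1.
rewrite big_ord_recr /=; set G := \prod_(i < n) _.
pose GV := \prod_(i < n) genV w i k.
have GK : G * GV = 1 by rewrite -big_split big1 //= => i _; rewrite (genK hw).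
split=> [[l [v [v' [vP v'P ->]]]]|uO].
  rewrite mulr_suml; apply: big_ind => [||i _]; first exact: local_ring_cst.
    by move=> *; exact: local_ringD.
  rewrite mulrACA; apply: local_ringM; first by apply/IHn.
  by apply/iter_pullback_divisor.
exists 1%N, (fun=> GV), (fun=> u * G); split=> [_|_|].
- by apply/IHn; rewrite mulrC GK; exact: local_ring_cst.
- by apply/iter_pullback_divisor; rewrite -mulrA.
- by rewrite big_ord1 mulrCA [GV * _]mulrC GK mulr1.
Qed.

Lemma prod_gen n k : \prod_(i < n) gen w i k =
  w k ^+ residue_count k n * w k.+2 ^+ residue_count k.+1 n.
Proof.
elim: n => [|n IHn].
  rewrite big_ord0 /residue_count !divn_small ?expr0 ?mulr1 //; lia.
rewrite big_ord_recr /= IHn /gen.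
have cS l : residue_count l n.+1 = (((n + 5 * l) %% 6 == 0) + residue_count l n)%N.
  by rewrite /residue_count; case: eqP; lia.
rewrite !cS; have := ltn_pmod (n + 5 * k) (isT : (0 < 6)%N).
have -> : ((n + 5 * k.+1) %% 6 = ((n + 5 * k) %% 6 + 5) %% 6)%N by lia.
case: ((n + 5 * k) %% 6)%N => [|[|[|[|[|[|//]]]]]] _ /=; rewrite ?add0n ?mulr1 //.
  by rewrite add1n exprS; ring.
by rewrite add1n exprS; ring.
Qed.

Lemma twisted_sections n u : global_sections (twisted_power L s n) u <->
  exists g, u = laurent_comb w g /\ forall m, monalg.mcoeff m g != 0 -> polygon n m.
Proof.
rewrite -(laurent_sections ax hw (residue_count^~ n)).
split=> [uL k t|uO p].
  by have /twisted_power_stalk := uL (c k t); rewrite prod_gen.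
have [k [t ->]] := hex_cover ax p; apply/twisted_power_stalk.
by rewrite prod_gen.
Qed.

End TwistedPowers.

(** The action of the rotation on the exponents. *)
Definition rotate_exponent (m : Z2) : Z2 := (- m.2, m.1 + m.2).

Lemma pullback_laurent (C : closedFieldType) (X : variety C) c (w : nat -> ratfun X)
    (s : automorphism X) : hex_coordinates c w ->
  (forall k, pullback s (w k) = w k.+1) ->
  forall m, pullback s (laurent w m) = laurent w (rotate_exponent m).
Proof.
move=> hw sw m; have zs i a b := zpow_morph a b i (pullbackM s) (pullback1 s).
have w03 : w 3 * w 0 = 1 by rewrite mulrC; exact: coordV hw 0.
have w5 : w 5 = w 0 * w 4.
  by rewrite -[w 4]/(w 3.+1) (coordM hw 3) mulrA [w 0 * _]mulrC w03 mul1r.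
rewrite /laurent pullbackM !zs !sw w5 (coordM hw 1) [w 1 * w 3]mulrC zpowM (zpowV (w 0)).
by rewrite mulrCA /rotate_exponent /= (zpowD _ _ (coordV hw 1)).
Qed.

(** * Divisibility in the monoid of monomial sections *)

Lemma polygonP n a b : polygon n (a, b) <->
  - ((n + 5) %/ 6)%N%:Z <= a + b /\ - ((n + 4) %/ 6)%N%:Z <= b /\
  - ((n + 3) %/ 6)%N%:Z <= - a /\ - ((n + 2) %/ 6)%N%:Z <= - (a + b) /\
  - ((n + 1) %/ 6)%N%:Z <= - b /\ - (n %/ 6)%N%:Z <= a.
Proof.
split=> [h|[h0 [h1 [h2 [h3 [h4 h5]]]]] k].
  have := h 0; have := h 1; have := h 2; have := h 3; have := h 4; have := h 5.
  by rewrite /residue_count /ell /= ?addn0; tauto.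
rewrite /residue_count /ell; have := ltn_pmod k (isT : (0 < 6)%N).
by case: (k %% 6)%N => [|[|[|[|[|[|//]]]]]] _ /=; rewrite ?addn0.
Qed.

Lemma polygon_x n a b : polygon n (a, b) -> polygon n.+1 (- b, a + b).
Proof. by move=> /polygonP h; apply/polygonP; lia. Qed.

Lemma polygon_y n a b : polygon n (a, b) -> polygon n.+2 (- (a + b), a - 1).
Proof. by move=> /polygonP h; apply/polygonP; lia. Qed.

(** The two alternatives are divisibility on the left by x, which has degree 1 and
    exponent 0, and by y, which has degree 2 and exponent (0, -1): the exponent of
    a product of u, of degree n, and v is that of u plus that of v rotated n
    times. *)
Lemma polygon_divides n a b : polygon n.+1 (a, b) ->
  polygon n (a + b, - a) \/ exists2 n', n = n'.+1 & polygon n' (b + 1, - (a + b + 1)).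
Proof.
move=> /polygonP h.
have [hx|hx] := pselect (polygon n (a + b, - a)).
  by left.
right; case: n h hx => [|n'] h hx; first by case: hx; apply/polygonP; lia.
exists n' => //; apply/polygonP; move: hx => /polygonP hx; lia.
Qed.

(** The monomial sections of degree N + 2 and exponent (a, b) that are divisible on
    the left by x and by y are divisible by x^5 = yxy or by y^2 = xyx. *)
Lemma polygon_common N a b : polygon N.+1 (a + b, - a) -> polygon N (b + 1, - (a + b + 1)) ->
  (exists2 p, N = (p + 3)%N & polygon p (- b, a + b)) \/
  (exists2 p, N = (p + 2)%N & polygon p (- (a + b), a - 1)).
Proof.
move=> /polygonP h /polygonP h'.
have [hB|hB] := pselect ((2 <= N)%N /\ polygon (N - 2) (- (a + b), a - 1)).
  by right; exists (N - 2)%N; [lia | tauto].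
left; exists (N - 3)%N; move: hB; rewrite polygonP => hB; last (apply/polygonP); lia.
Qed.

(** * The words in x and y *)

Definition word_step (l : 'I_2) (m : Z2) : Z2 :=
  if l == 0 then (- m.2, m.1 + m.2) else (- (m.1 + m.2), m.1 - 1).

(** The exponent of the monomial that is the value of a word. *)
Definition exponent (u : seq 'I_2) : Z2 := foldr word_step 0 u.
Definition weight (u : seq 'I_2) : nat := (\sum_(i <- u) (nat_of_ord i).+1)%N.

Lemma weight_cons l u : weight (l :: u) = (l.+1 + weight u)%N.
Proof. by rewrite /weight big_cons. Qed.

Lemma letterP (l : 'I_2) : l = 0 \/ l = 1.
Proof. by case: l => [[|[|//]]] h; [left | right]; apply/val_inj. Qed.

Lemma polygon_word u : polygon (weight u) (exponent u).
Proof.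
elim: u => [|l u IHu] /=; first by rewrite /weight big_nil; apply/polygonP.
rewrite weight_cons; case: (exponent u) IHu => a b h.
by case: (letterP l) => ->; [exact: polygon_x | exact: polygon_y].
Qed.

(** Left divisibility by x or y gives the letters one by one. *)
Lemma word_exists n m : polygon n m -> exists u, weight u = n /\ exponent u = m.
Proof.
have [N] := ubnP n; elim: N n m => // N IHN n [a b] nN h.
case: n nN h => [|n] nN h.
  exists [::]; rewrite /weight big_nil; split=> //.
  by move/polygonP: h => h; congr pair; lia.
have [h'|[n' nE h']] := polygon_divides h.
  have [u [uw ue]] := IHN _ _ nN h'; exists (lx :: u); rewrite weight_cons uw /= ue.
  by split=> //; congr pair => /=; ring.
have [|u [uw ue]] := IHN _ _ _ h'; first by lia.
exists (ly :: u); rewrite weight_cons uw /= ue nE.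
by split=> //; congr pair => /=; ring.
Qed.

Section WordValues.
Variables (A : pzRingType) (x y : A).
Hypothesis rel1 : x ^+ 5 = y * x * y.
Hypothesis rel2 : y ^+ 2 = x * y * x.

Definition word_value (u : seq 'I_2) : A := \prod_(l <- u) (if l == 0 then x else y).

Lemma word_value_cons l u : word_value (l :: u) = (if l == 0 then x else y) * word_value u.
Proof. by rewrite /word_value big_cons. Qed.

(** Induction on the weight.  If two words with the same weight and the same
    exponent begin with the same letter, cancel it.  If not, their common monomial
    is divisible by the two sides of one of the relations, and by induction the
    words can be replaced by words that begin with these sides. *)
Lemma word_value_unique u v :
  weight u = weight v -> exponent u = exponent v -> word_value u = word_value v.
Proof.
have [N] := ubnP (weight u); elim: N u v => // N IHN.
have mixed u v : (weight (lx :: u) < N.+1)%N -> weight (lx :: u) = weight (ly :: v) ->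
    exponent (lx :: u) = exponent (ly :: v) ->
    word_value (lx :: u) = word_value (ly :: v).
  rewrite !weight_cons /= => uN wuv.
  have wu : weight u = (weight v).+1 by move: wuv => /=; lia.
  have pu := polygon_word u; have pv := polygon_word v; rewrite wu in pu.
  case Eu: (exponent u) pu => [a0 b0] pu; case Ev: (exponent v) pv => [a1 b1] pv.
  rewrite /word_step /= => -[E1 E2].
  have [] := @polygon_common (weight v) (- b0) (a0 + b0).
  - by have -> : (- b0 + (a0 + b0), - - b0) = (a0, b0) by congr pair; ring.
  - suff -> : (a0 + b0 + 1, - (- b0 + (a0 + b0) + 1)) = (a1, b1) by [].
    by congr pair; lia.
  - move=> [p vE /word_exists[t [tw te]]].
    have -> : word_value (lx :: u) = x ^+ 5 * word_value t.
      rewrite word_value_cons (IHN u [:: lx, lx, lx, lx & t]) ?weight_cons ?wu ?tw.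
      + by rewrite !word_value_cons /= !exprS expr0 mulr1 !mulrA.
      + by lia.
      + by rewrite vE /=; lia.
      + by rewrite Eu /= te /word_step /=; congr pair; ring.
    rewrite word_value_cons (IHN v [:: lx, ly & t]) ?weight_cons ?tw.
    + by rewrite !word_value_cons /= rel1 !mulrA.
    + by move: wuv; rewrite wu /=; lia.
    + by rewrite vE /=; lia.
    + by rewrite Ev /= te /word_step /=; congr pair; lia.
  - move=> [p vE /word_exists[t [tw te]]].
    have -> : word_value (lx :: u) = x * y * x * word_value t.
      rewrite word_value_cons (IHN u [:: ly, lx & t]) ?weight_cons ?wu ?tw.
      + by rewrite !word_value_cons /= !mulrA.
      + by lia.
      + by rewrite vE /=; lia.
      + by rewrite Eu /= te /word_step /=; congr pair; ring.
    rewrite word_value_cons (IHN v [:: ly & t]) ?weight_cons ?tw.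
    + by rewrite !word_value_cons /= -rel2 expr2 !mulrA.
    + by move: wuv; rewrite wu /=; lia.
    + by rewrite vE /=; lia.
    + by rewrite Ev /= te /word_step /=; congr pair; lia.
case=> [|l u] [|l' v] uN wuv euv //.
- by move: wuv; rewrite weight_cons /weight big_nil; lia.
- by move: wuv; rewrite weight_cons /weight big_nil; lia.
have [ll'|ll'] := eqVneq l l'.
  rewrite -{}ll' in wuv euv *; rewrite !word_value_cons; congr (_ * _); apply: IHN.
  - by move: uN; rewrite weight_cons; lia.
  - by move: wuv; rewrite !weight_cons; lia.
  move: euv; rewrite /= /word_step.
  by case: (exponent u) (exponent v) => [a b] [a' b'] /=; case: ifP => _ [E1 E2]; congr pair; lia.
case: (letterP l) (letterP l') => lE [] l'E; rewrite lE l'E ?eqxx // in ll' uN wuv euv *.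
  exact: mixed.
by apply/esym/mixed => //; rewrite -wuv.
Qed.

End WordValues.

(** * The isomorphism *)

Section FreeAlgebra.
Variable C : closedFieldType.
Local Notation FA := {malg C[{fmonom 'I_2}]}.

Definition word_monomial (u : seq 'I_2) : FA := monalg.mkmalgU (FMonom u) 1.

Lemma malgU_mul (a b : C) (k l : {fmonom 'I_2}) :
  (monalg.mkmalgU k a : FA) * monalg.mkmalgU l b =
  monalg.mkmalgU (FMonom (fmonom_val k ++ fmonom_val l)) (a * b).
Proof. by rewrite malgM_def fgmulUU -fmmulE. Qed.

Lemma word_monomial_cons l u :
  word_monomial (l :: u) = (if l == 0 then gen_x C else gen_y C) * word_monomial u.
Proof.
rewrite /gen_x /gen_y; case: (letterP l) => -> /=;
by rewrite malgU_mul fmuE mulr1.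
Qed.

Lemma malg_scale (a : C) (k : {fmonom 'I_2}) :
  (monalg.mkmalgU k a : FA) = a *: monalg.mkmalgU k 1.
Proof. by apply/malgP => l; rewrite monalg.mcoeffZ !monalg.mcoeffU mulrnAr mulr1. Qed.

Lemma algR_pi_word u : algR_pi (word_monomial u) =
  word_value (algR_pi (gen_x C)) (algR_pi (gen_y C)) u.
Proof.
elim: u => [|l u IHu]; first by rewrite /word_value big_nil /word_monomial -fmoneE /algR_pi -[monalg.mkmalgU _ _]/(1 : FA) rmorph1.
rewrite word_monomial_cons word_value_cons -IHu /algR_pi rmorphM.
by case: ifP.
Qed.

Lemma algR_pi_lift (g : FA) : algR_pi g =
  malg_lift (fun m : {fmonom 'I_2} => word_value (algR_pi (gen_x C)) (algR_pi (gen_y C)) m) g.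
Proof.
rewrite {1}(malg_sum g) /algR_pi raddf_sum; apply: eq_bigr => m _.
by rewrite -algR_pi_word /algR_pi /= malg_scale qa_pi_scalable; case: m.
Qed.

Lemma algR_rel1 : algR_pi (gen_x C) ^+ 5 =
  algR_pi (gen_y C) * algR_pi (gen_x C) * algR_pi (gen_y C).
Proof.
rewrite /algR_pi -rmorphXn -!rmorphM; apply/qa_eq.
exists 1%N, (fun=> 1), (fun=> gen_x C ^+ 5 - gen_y C * gen_x C * gen_y C), (fun=> 1).
by split=> [_|]; [left | rewrite big_ord1 mul1r mulr1].
Qed.

Lemma algR_rel2 : algR_pi (gen_y C) ^+ 2 =
  algR_pi (gen_x C) * algR_pi (gen_y C) * algR_pi (gen_x C).
Proof.
rewrite /algR_pi -rmorphXn -!rmorphM; apply/qa_eq.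
exists 1%N, (fun=> 1), (fun=> gen_y C ^+ 2 - gen_x C * gen_y C * gen_x C), (fun=> 1).
by split=> [_|]; [right | rewrite big_ord1 mul1r mulr1].
Qed.

(** Words with the same weight and the same exponent have the same image in the
    algebra, so their coefficients can be added up. *)
Lemma algR_pi_eq0 (g : FA) :
  (forall n e, \sum_(m <- monalg.msupp g)
     (monalg.mcoeff m g *+ ((weight (fmonom_val m) == n) && (exponent (fmonom_val m) == e))) = 0) ->
  algR_pi g = 0.
Proof.
move=> g0; pose W := word_value (algR_pi (gen_x C)) (algR_pi (gen_y C)).
pose key (u : seq 'I_2) : nat * Z2 := (weight u, exponent u).
have ex (k : nat * Z2) : exists a, forall u, key u = k -> W u = a.
  have [[u uk]|nk] := pselect (exists u, key u = k).
    exists (W u) => v vk; have [] : key v = key u by rewrite uk.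
    exact: (word_value_unique algR_rel1 algR_rel2).
  by exists 0 => u uk; case: nk; exists u.
have [V VP] := choice ex.
pose h : {malg C[(nat * Z2)%type]} :=
  \sum_(m <- monalg.msupp g) monalg.mkmalgU (key (fmonom_val m)) (monalg.mcoeff m g).
have h0 : h = 0.
  apply/malgP => -[n e]; rewrite monalg.mcoeff0 -[RHS](g0 n e) raddf_sum /=.
  by apply: eq_bigr => m _; rewrite monalg.mcoeffU.
have -> : algR_pi g = malg_lift V h.
  rewrite algR_pi_lift malg_lift_sum; apply: eq_bigr => m _.
  by rewrite malg_liftU -(VP _ _ erefl).
by rewrite h0 malg_lift0.
Qed.

End FreeAlgebra.

Section Isomorphism.
Variables (C : closedFieldType) (X : variety C) (c : nat -> C * C -> pt X).
Hypothesis ax : hex_atlas c.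
Variable w : nat -> ratfun X.
Hypothesis hw : hex_coordinates c w.
Variable s : automorphism X.
Hypothesis rot : forall j, s @^-1` edge c j = edge c j.+1.
Hypothesis sw : forall k, pullback s (w k) = w k.+1.
Local Notation L := (divisor_sheaf (edge c 0)).
Local Notation B := (thcr L s).
Local Notation FA := {malg C[{fmonom 'I_2}]}.

Definition homog_fun n (v : ratfun X) (k : nat) : ratfun X := if k == n then v else 0.

Lemma homog_section n v : global_sections (twisted_power L s n) v ->
  forall k, global_sections (twisted_power L s k) (homog_fun n v k).
Proof. by move=> vL k; rewrite /homog_fun; case: eqP => [->|_] //; exact: sections0. Qed.

Lemma homog_finite n v : exists N, forall k, (N <= k)%N -> homog_fun n v k = 0.
Proof. by exists n.+1 => k nk; rewrite /homog_fun gtn_eqF. Qed.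

Definition homog_elt n v (vL : global_sections (twisted_power L s n) v) : B :=
  Thcr (homog_section vL) (homog_finite n v).

Lemma laurent_section n m : polygon n m ->
  global_sections (twisted_power L s n) (laurent w m).
Proof.
move=> nm; apply/(twisted_sections ax hw rot); exists (monalg.mkmalgU m 1).
rewrite laurent_combU scale1r; split=> // m'; rewrite monalg.mcoeffU.
by have [<- //|_] := eqVneq m m'; rewrite mulr0n eqxx.
Qed.

Lemma polygon_letter_x : polygon 1 (0, 0). Proof. by apply/polygonP. Qed.
Lemma polygon_letter_y : polygon 2 (0, -1). Proof. by apply/polygonP. Qed.

Definition elt_x : B := homog_elt (laurent_section polygon_letter_x).
Definition elt_y : B := homog_elt (laurent_section polygon_letter_y).

(** Only the component of degree n of the left factor contributes. *)
Lemma homog_mulE n v (vL : global_sections (twisted_power L s n) v) (b : B) k :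
  (homog_elt vL * b) k = if (n <= k)%N then v * iter n (pullback s) (b (k - n)%N) else 0.
Proof.
rewrite -[LHS]/(\sum_(i < k.+1) homog_fun n v i * iter i (pullback s) (b (k - i)%N)).
case: leqP => [nk|kn].
  rewrite (bigD1 (Ordinal (nk : (n < k.+1)%N))) //= /homog_fun eqxx big1 ?addr0 // => i.
  by rewrite -val_eqE /= => /negPf ->; rewrite mul0r.
rewrite big1 // => i _; rewrite /homog_fun ltn_eqF ?mul0r //.
by apply: leq_ltn_trans kn; rewrite -ltnS.
Qed.

Lemma word_value_thcr (u : seq 'I_2) n : word_value elt_x elt_y u n =
  homog_fun (weight u) (laurent w (exponent u)) n.
Proof.
have pl := pullback_laurent hw sw.
elim: u n => [|l u IHu] n.
  rewrite /word_value /weight !big_nil /homog_fun laurent0.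
  by case: n.
rewrite word_value_cons weight_cons; case: (letterP l) => ->; rewrite homog_mulE IHu /homog_fun.
  rewrite -[iter _ _ _]/(pullback s _); case: ifPn => [n1|lt]; last by rewrite ltn_eqF // (leq_trans (n := 1)) ?leq_addr // ltnNge.
  rewrite -(eqn_add2r 1) subnK // [(_ + 1)%N]addnC; case: eqP => _; last by rewrite pullback0 mulr0.
  by rewrite laurent0 mul1r pl.
rewrite -[iter _ _ _]/(pullback s (pullback s _)); case: ifPn => [n2|lt]; last by rewrite ltn_eqF // (leq_trans (n := 2)) ?leq_addr // ltnNge.
rewrite -(eqn_add2r 2) subnK // [(_ + 2)%N]addnC; case: eqP => _; last by rewrite !pullback0 mulr0.
rewrite !pl -(laurentD hw); congr (laurent w _); rewrite /exponent /= /word_step /=.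
rewrite -/(exponent u); case: (exponent u) => a b; rewrite /rotate_exponent /=.
by congr pair => /=; ring.
Qed.

Definition twisted_eval (g : FA) : B :=
  malg_lift (fun m : {fmonom 'I_2} => word_value elt_x elt_y m) g.

Lemma thcr_sumE (I : Type) (r : seq I) (P : pred I) (F : I -> B) n :
  (\sum_(i <- r | P i) F i) n = \sum_(i <- r | P i) F i n.
Proof. by apply: (big_morph (fun a : B => a n)). Qed.

Lemma twisted_evalE g n : twisted_eval g n = \sum_(m <- monalg.msupp g)
  monalg.mcoeff m g *: homog_fun (weight (fmonom_val m)) (laurent w (exponent (fmonom_val m))) n.
Proof.
rewrite /twisted_eval /malg_lift thcr_sumE; apply: eq_bigr => m _.
by rewrite -word_value_thcr.
Qed.

Lemma thcr_scaleAr (a : C) (b d : B) : b * (a *: d) = a *: (b * d).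
Proof.
apply: thcr_eq => n; rewrite -[RHS]/(a *: (\sum_(i < n.+1) b i * iter i (pullback s) (d (n - i)%N))).
rewrite scaler_sumr -[LHS]/(\sum_(i < n.+1) b i * iter i (pullback s) (a *: d (n - i)%N)).
have itZ j u : iter j (pullback s) (a *: u) = a *: iter j (pullback s) u.
  by elim: j => //= j ->; rewrite pullbackZ.
by apply: eq_bigr => i _; rewrite itZ mulrC ratfun_scaleAl mulrC.
Qed.

Lemma twisted_evalM g h : twisted_eval (g * h) = twisted_eval g * twisted_eval h.
Proof.
rewrite malgME /twisted_eval malg_lift_sum [malg_lift _ g in RHS]/malg_lift mulr_suml.
apply: eq_bigr => k _; rewrite malg_lift_sum [malg_lift _ h]/malg_lift mulr_sumr.
apply: eq_bigr => l _; rewrite malg_liftU fmM /word_value big_cat /=.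
by rewrite -thcr_scaleAl thcr_scaleAr scalerA.
Qed.

Lemma twisted_eval1 : twisted_eval 1 = 1.
Proof.
rewrite -[1]/(monalg.mkmalgU (fmone _) 1) /twisted_eval malg_liftU scale1r fmoneE.
by rewrite /word_value big_nil.
Qed.

Lemma twisted_evalD : {morph twisted_eval : g h / g + h}. Proof. exact: malg_liftD. Qed.
Lemma twisted_evalZ a g : twisted_eval (a *: g) = a *: twisted_eval g. Proof. exact: malg_liftZ. Qed.
Lemma twisted_evalB g h : twisted_eval (g - h) = twisted_eval g - twisted_eval h.
Proof. by rewrite twisted_evalD -scaleN1r twisted_evalZ scaleN1r. Qed.

Lemma twisted_eval_x : twisted_eval (gen_x C) = elt_x.
Proof. by rewrite /twisted_eval malg_liftU scale1r fmuE /word_value big_seq1. Qed.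
Lemma twisted_eval_y : twisted_eval (gen_y C) = elt_y.
Proof. by rewrite /twisted_eval malg_liftU scale1r fmuE /word_value big_seq1. Qed.

Lemma twisted_eval_word_eq u v : weight u = weight v -> exponent u = exponent v ->
  word_value elt_x elt_y u = word_value elt_x elt_y v.
Proof. by move=> uv euv; apply: thcr_eq => n; rewrite !word_value_thcr uv euv. Qed.

Lemma twisted_evalX (g : FA) k : twisted_eval (g ^+ k) = twisted_eval g ^+ k.
Proof.
elim: k => [|k IHk]; first by rewrite !expr0 twisted_eval1.
by rewrite exprS twisted_evalM IHk exprS.
Qed.

Lemma twisted_eval_ideal g : two_sided_ideal (@the_relations C) g -> twisted_eval g = 0.
Proof.
move=> [n [u [r [v [rP ->]]]]]; rewrite (big_morph twisted_eval twisted_evalD (malg_lift0 _)) big1 // => i _.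
have -> : twisted_eval (u i * r i * v i) = twisted_eval (u i) * twisted_eval (r i) * twisted_eval (v i) by rewrite !twisted_evalM.
have rel1 : elt_x ^+ 5 = elt_y * elt_x * elt_y.
  have : word_value elt_x elt_y [:: lx; lx; lx; lx; lx] = word_value elt_x elt_y [:: ly; lx; ly].
    by apply: twisted_eval_word_eq; rewrite // /weight !big_cons !big_nil.
  by rewrite /word_value !big_cons !big_nil /= !mulr1 !exprS expr0 mulr1 !mulrA.
have rel2 : elt_y ^+ 2 = elt_x * elt_y * elt_x.
  have : word_value elt_x elt_y [:: ly; ly] = word_value elt_x elt_y [:: lx; ly; lx].
    by apply: twisted_eval_word_eq; rewrite // /weight !big_cons !big_nil.
  by rewrite /word_value !big_cons !big_nil /= !mulr1 expr2 !mulrA.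
suff -> : twisted_eval (r i) = 0 by rewrite mulr0 mul0r.
have [rE|rE] : r i = gen_x C ^+ 5 - gen_y C * gen_x C * gen_y C \/
    r i = gen_y C ^+ 2 - gen_x C * gen_y C * gen_x C by exact: rP.
  rewrite rE twisted_evalB; apply/eqP; rewrite subr_eq0; apply/eqP.
  rewrite [LHS]twisted_evalX [RHS]twisted_evalM (twisted_evalM (gen_y C)).
  by rewrite twisted_eval_x twisted_eval_y rel1.
rewrite rE twisted_evalB; apply/eqP; rewrite subr_eq0; apply/eqP.
rewrite [LHS]twisted_evalX [RHS]twisted_evalM (twisted_evalM (gen_x C)).
by rewrite twisted_eval_x twisted_eval_y rel2.
Qed.

Lemma twisted_eval_repr g : twisted_eval (repr (algR_pi g)) = twisted_eval g.
Proof.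
apply/eqP; rewrite -subr_eq0 -twisted_evalB; apply/eqP/twisted_eval_ideal/qa_eq.
exact: qa_reprK.
Qed.

(** In each degree distinct exponents give linearly independent sections, so the
    coefficients of the words with a given weight and a given exponent add up to
    zero. *)
Lemma twisted_eval_inj0 g : twisted_eval g = 0 -> algR_pi g = 0.
Proof.
move=> g0; apply: algR_pi_eq0 => n e.
pose h : {malg C[Z2]} := \sum_(m <- monalg.msupp g)
  monalg.mkmalgU (exponent (fmonom_val m)) (monalg.mcoeff m g *+ (weight (fmonom_val m) == n)).
have h0 : h = 0.
  apply: (laurent_comb_inj0 ax hw); rewrite /laurent_comb malg_lift_sum.
  have := congr1 (fun b : B => b n) g0; rewrite twisted_evalE => E.
  rewrite -[RHS]E; apply: eq_bigr => m _; rewrite malg_liftU /homog_fun eq_sym.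
  by case: (_ == _); rewrite ?mulr1n ?mulr0n ?scale0r ?scaler0.
have := congr1 (monalg.mcoeff e) h0; rewrite monalg.mcoeff0 raddf_sum /= => E.
rewrite -[RHS]E; apply: eq_bigr => m _; rewrite monalg.mcoeffU.
by rewrite -mulrnA mulnb.
Qed.

(** A section of degree n is a combination of monomials, each of which is the
    value of a word of weight n. *)
Lemma twisted_eval_homog n b : thcr_homog n b -> exists2 g, free_homog n g & twisted_eval g = b.
Proof.
move=> bn; have /(twisted_sections ax hw rot)[h [bh hP]] := comp_section b n.
have ex m : exists u : seq 'I_2, polygon n m -> weight u = n /\ exponent u = m.
  have [nm|nm] := pselect (polygon n m); last by exists [::].
  by have [u uP] := word_exists nm; exists u.
have [u uP] := choice ex.
have uS m : m \in monalg.msupp h -> weight (u m) = n /\ exponent (u m) = m.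
  by move=> mh; apply/uP/hP; rewrite monalg.mcoeff_neq0.
exists (\sum_(m <- monalg.msupp h) monalg.mkmalgU (FMonom (u m)) (monalg.mcoeff m h)).
  move=> l; rewrite raddf_sum /= => l0.
  have [m mh ml] : exists2 m, m \in monalg.msupp h & FMonom (u m) = l.
    apply: contrapT => nl; move: l0; rewrite big_seq big1 ?eqxx // => m mh.
    by rewrite monalg.mcoeffU; case: eqP => // E; case: nl; exists m.
  by have [wm _] := uS m mh; rewrite -ml.
apply: thcr_eq => k; rewrite /twisted_eval malg_lift_sum thcr_sumE.
have [->|kn] := eqVneq k n.
  rewrite bh /laurent_comb big_seq [RHS]big_seq; apply: eq_bigr => m /uS[um em].
  rewrite malg_liftU -[LHS]/(_ *: word_value elt_x elt_y (u m) n).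
  by rewrite word_value_thcr um em /homog_fun eqxx.
rewrite bn // big_seq big1 // => m /uS[um em].
rewrite malg_liftU -[LHS]/(_ *: word_value elt_x elt_y (u m) k).
by rewrite word_value_thcr um /homog_fun (negPf kn) scaler0.
Qed.

Lemma twisted_eval_surj b : exists g, twisted_eval g = b.
Proof.
have [N bN] := comp_finite b.
have hb n : thcr_homog n (homog_elt (comp_section b n)).
  by move=> m mn; rewrite /= /homog_fun (negPf mn).
have ex n : exists g, twisted_eval g = homog_elt (comp_section b n).
  by have [g _ gE] := twisted_eval_homog (hb n); exists g.
have [g gE] := choice ex; exists (\sum_(n < N) g n).
rewrite (big_morph twisted_eval twisted_evalD (malg_lift0 _)); apply: thcr_eq => k.
rewrite thcr_sumE; have [Nk|kN] := leqP N k.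
  rewrite bN // big1 // => n _; rewrite gE /= /homog_fun gtn_eqF //.
  exact: leq_trans (ltn_ord n) Nk.
rewrite (bigD1 (Ordinal kN)) //= gE /= /homog_fun eqxx big1 ?addr0 // => n.
by rewrite -val_eqE /= gE /= /homog_fun eq_sym => /negPf ->.
Qed.

Definition iso_fun (a : algR C) : B := twisted_eval (repr a).

Lemma iso_funE g : iso_fun (algR_pi g) = twisted_eval g.
Proof. exact: twisted_eval_repr. Qed.

Lemma iso_zmod_morphism : zmod_morphism iso_fun.
Proof.
move=> a b; rewrite -[a]qa_reprK -[b]qa_reprK -raddfB.
by rewrite -/(algR_pi _) -/(algR_pi _) -/(algR_pi _) !iso_funE twisted_evalB.
Qed.

Lemma iso_monoid_morphism : monoid_morphism iso_fun.
Proof.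
split=> [|a b]; first by rewrite -[1]/(algR_pi 1) iso_funE twisted_eval1.
rewrite -[a]qa_reprK -[b]qa_reprK -rmorphM.
by rewrite -/(algR_pi _) -/(algR_pi _) -/(algR_pi _) !iso_funE twisted_evalM.
Qed.

Lemma twisted_ring_iso : exists f : {rmorphism algR C -> B},
  [/\ scalable f, bijective f & forall n a, algR_homog n a <-> thcr_homog n (f a)].
Proof.
pose f : {rmorphism algR C -> B} := HB.pack iso_fun
  (GRing.isZmodMorphism.Build _ _ iso_fun iso_zmod_morphism)
  (GRing.isMonoidMorphism.Build _ _ iso_fun iso_monoid_morphism).
have piK (a : algR C) : algR_pi (repr a) = a by exact: qa_reprK.
have inj : injective f.
  move=> a b ab; apply/eqP; rewrite -subr_eq0 -[a]piK -[b]piK /algR_pi -raddfB.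
  by apply/eqP/twisted_eval_inj0; rewrite twisted_evalB; apply/eqP; rewrite subr_eq0; apply/eqP.
exists f; split.
- move=> k a; rewrite -[a]piK /algR_pi -qa_pi_scalable -/(algR_pi _) -/(algR_pi _).
  by rewrite /= !iso_funE twisted_evalZ.
- have [g gE] := choice twisted_eval_surj.
  exists (fun b => algR_pi (g b)) => b; last by rewrite /= iso_funE.
  by apply: inj; rewrite /= iso_funE gE.
move=> n a; split=> [[g gn <-]|fn].
  move=> k kn; rewrite /= iso_funE twisted_evalE big_seq big1 // => m.
  rewrite -monalg.mcoeff_neq0 => /gn wm.
  have -> : weight (fmonom_val m) = n by exact: wm.
  by rewrite /homog_fun (negPf kn) scaler0.
have [g gn gE] := twisted_eval_homog fn; exists g => //.
by apply: inj; rewrite /= iso_funE.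
Qed.

End Isomorphism.

(** * The hexagon on the blow-up of three points *)

(** Homogeneous coordinates, in the frame given by the three points, of a point
    of the plane and of its three lines, in terms of the Cox coordinates
    z_0, ..., z_5, one for each edge: the exceptional curves have even indices
    and the strict transforms of the lines have odd indices. *)
Definition cox_rows (R : comNzRingType) (z : nat -> R) : seq (seq R) :=
  [:: [:: z 2 * z 3 * z 4; z 0 * z 1 * z 2; z 0 * z 4 * z 5];
      [:: 0; z 5 * z 4; - (z 2 * z 1)];
      [:: - (z 0 * z 5); 0; z 3 * z 2];
      [:: z 1 * z 0; - (z 4 * z 3); 0]].

Definition cox_matrix (R : comNzRingType) (z : nat -> R) : 'M[R]_(4, 3) :=
  \matrix_(i, j) nth 0 (nth [::] (cox_rows z) i) j.

Definition n_row (j : nat) : 'I_4 :=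
  match (j %% 6)%N with
  | 0 | 3 => Ordinal (isT : 2 < 4)%N | 1 | 4 => Ordinal (isT : 3 < 4)%N
  | _ => Ordinal (isT : 1 < 4)%N end.
Definition n_col (j : nat) : 'I_3 :=
  match (j %% 6)%N with
  | 0 | 1 => Ordinal (isT : 0 < 3)%N | 2 | 3 => Ordinal (isT : 2 < 3)%N
  | _ => Ordinal (isT : 1 < 3)%N end.
Definition n_sign (R : comNzRingType) (j : nat) : R := if odd (j %% 6) then 1 else - 1.

(** The products z_j z_(j-1), read off from the three lines. *)
Definition n_coord (R : comNzRingType) (K : 'M[R]_(4, 3)) (j : nat) : R :=
  n_sign R j * K (n_row j) (n_col j).

Lemma n_coord_cox (R : comNzRingType) (z : nat -> R) j : (j < 6)%N ->
  n_coord (cox_matrix z) j = z j * z ((j + 5) %% 6)%N.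
Proof.
by case: j => [|[|[|[|[|[|//]]]]]] _; rewrite /n_coord /n_sign mxE /=; ring.
Qed.

Lemma cox_matrix_map (R S : comNzRingType) (f : {rmorphism R -> S}) (z : nat -> R) i j :
  f (cox_matrix z i j) = cox_matrix (f \o z) i j.
Proof.
rewrite !mxE; case: i => [[|[|[|[|//]]]] hi]; case: j => [[|[|[|//]]] hj] /=;
by rewrite ?rmorphN ?rmorphM ?rmorphM ?rmorph0.
Qed.

Lemma n_coord_mod (R : comNzRingType) (K : 'M[R]_(4, 3)) j :
  n_coord K (j %% 6) = n_coord K j.
Proof. by rewrite /n_coord /n_sign /n_row /n_col modn_mod. Qed.

Lemma n_coord_scale (R : closedFieldType) (D : 'I_4 -> R) K j :
  n_coord (row_scale D K) j = D (n_row j) * n_coord K j.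
Proof. by rewrite /n_coord mxE mulrCA. Qed.

Section BlowUp.
Variables (C : closedFieldType) (p : 'I_3 -> pt (projective_space C 2)).
Hypothesis ncp : non_collinear p.
Local Notation X := (blow_up3 p).
Local Notation e2 := (@eval2 C).

Definition frame : 'M[C]_3 := \matrix_(i, j) sval (p i) 0 j.

Lemma frame_unit : frame \in unitmx.
Proof.
rewrite unitmxE unitfE; apply/negP => /eqP det0; apply: ncp.
have /det0P[v v0 vP] : \det frame^T == 0 by rewrite det_tr det0.
exists v; split=> // i; apply/matrixP => k j; rewrite !ord1 !mxE.
have := congr1 (fun A : 'rV_3 => A 0 i) vP; rewrite !mxE => E.
by rewrite -[RHS]E; apply: eq_bigr => l _; rewrite !mxE.
Qed.

(** Points of the plane are row vectors and lines are dual vectors, so they are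
    transformed by inverse transposed matrices. *)
Definition basis (i : 'I_4) : 'M[C]_3 := if i == 0 then invmx frame else frame^T.
Definition basisV (i : 'I_4) : 'M[C]_3 := if i == 0 then frame else (invmx frame)^T.

Lemma basisK i : basis i *m basisV i = 1%:M.
Proof.
rewrite /basis /basisV; case: ifP => _; first by rewrite mulVmx ?frame_unit.
by rewrite -trmx_mul mulVmx ?frame_unit // trmx1.
Qed.

Lemma basisVK i : basisV i *m basis i = 1%:M.
Proof.
rewrite /basis /basisV; case: ifP => _; first by rewrite mulmxV ?frame_unit.
by rewrite -trmx_mul mulmxV ?frame_unit // trmx1.
Qed.

Definition to_frame (A : 'M[C]_(4, 3)) : 'M[C]_(4, 3) :=
  \matrix_(i, j) (row i A *m basis i) 0 j.
Definition of_frame (A : 'M[C]_(4, 3)) : 'M[C]_(4, 3) :=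
  \matrix_(i, j) (row i A *m basisV i) 0 j.

Lemma row_to_frame A i : row i (to_frame A) = row i A *m basis i.
Proof. by apply/rowP => j; rewrite !mxE. Qed.
Lemma row_of_frame A i : row i (of_frame A) = row i A *m basisV i.
Proof. by apply/rowP => j; rewrite !mxE. Qed.

Lemma to_frameK A : of_frame (to_frame A) = A.
Proof. by apply/row_matrixP => i; rewrite row_of_frame row_to_frame -mulmxA basisK mulmx1. Qed.
Lemma of_frameK A : to_frame (of_frame A) = A.
Proof. by apply/row_matrixP => i; rewrite row_to_frame row_of_frame -mulmxA basisVK mulmx1. Qed.

Lemma row_row_scale (D : 'I_4 -> C) (A : 'M[C]_(4, 3)) i : row i (row_scale D A) = D i *: row i A.
Proof. by apply/rowP => j; rewrite !mxE. Qed.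

Lemma to_frame_scale D A : to_frame (row_scale D A) = row_scale D (to_frame A).
Proof.
by apply/row_matrixP => i; rewrite row_to_frame !row_row_scale row_to_frame scalemxAl.
Qed.

Lemma mem_blow_up A : @vmem C X A <-> forall i : 'I_3,
  to_frame A (lift ord0 i) i = 0 /\
  \sum_j to_frame A (lift ord0 i) j * to_frame A 0 j = 0.
Proof.
have E i : basis (lift ord0 i) = frame^T by [].
have inc i : (row (lift ord0 i) A *m (sval (p i))^T) 0 0 = to_frame A (lift ord0 i) i.
  by rewrite mxE [RHS]mxE E mxE; apply: eq_bigr => j _; rewrite !mxE.
have ort i : (row (lift ord0 i) A *m (row ord0 A)^T) 0 0 =
    \sum_j to_frame A (lift ord0 i) j * to_frame A 0 j.
  transitivity ((row (lift ord0 i) (to_frame A) *m (row 0 (to_frame A))^T) 0 0).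
    rewrite !row_to_frame E trmx_mul /basis /= -mulmxA [frame^T *m _]mulmxA.
    by rewrite -trmx_mul mulVmx ?frame_unit // trmx1 mul1mx.
  by rewrite mxE; apply: eq_bigr => j _; rewrite !mxE.
split=> [AX i|AX i].
  by have [h1 h2] := AX i; rewrite -inc -ort h1 h2 !mxE.
by have [h1 h2] := AX i; split; apply/matrixP => a b; rewrite !ord1 [RHS]mxE ?inc ?ort.
Qed.

Definition frame_coords (a : pt X) : 'M[C]_(4, 3) := to_frame (sval a).
Local Notation nc a j := (n_coord (frame_coords a) j).

Definition chart_cox (k : nat) (t : C * C) : 'M[C]_(4, 3) :=
  cox_matrix (fun j => e2 t (edge_poly C j k)).

Lemma edge_poly_mod j k : edge_poly C (j %% 6) k = edge_poly C j k.
Proof. by rewrite /edge_poly modnDml. Qed.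

Lemma edge_poly_modr j k : edge_poly C j (k %% 6) = edge_poly C j k.
Proof. by rewrite /edge_poly -modnDmr modnMmr modnDmr. Qed.

Lemma blow_up_param : exists (c : nat -> C * C -> pt X) (D : nat -> C * C -> 'I_4 -> C),
  (forall k t i, D k t i != 0) /\
  forall k t, sval (c k t) = row_scale (D k t) (of_frame (chart_cox k t)).
Proof.
have [||c [D [D0 cE]]] := @pt_of_matrix C X _ (fun kt : nat * (C * C) => of_frame (chart_cox kt.1 kt.2)).
- move=> [k [x y]] i /=.
  have [h|nh] := pselect (exists j, of_frame (chart_cox k (x, y)) i j != 0); first exact: h.
  have r0 : row i (chart_cox k (x, y)) = 0.
    rewrite -[chart_cox _ _]of_frameK row_to_frame.
    suff -> : row i (of_frame (chart_cox k (x, y))) = 0 by rewrite mul0mx.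
    apply/rowP => j; rewrite [LHS]mxE [RHS]mxE; apply/eqP; apply: contraT => h.
    by case: nh; exists j.
  exfalso; pose z j := e2 (x, y) (edge_poly C j k).
  have zE j : z j = match ((j + 5 * (k %% 6)) %% 6)%N with 0 => x | 1 => y | _ => 1 end.
    by rewrite /z -edge_poly_modr edge_poly_val.
  have E (j : 'I_3) : nth 0 (nth [::] (cox_rows z) i) (val j) = 0.
    by have := congr1 (fun A : 'rV_3 => A 0 j) r0; rewrite !mxE.
  have := E (Ordinal (isT : 0 < 3)%N); have := E (Ordinal (isT : 1 < 3)%N).
  have := E (Ordinal (isT : 2 < 3)%N); have kP := ltn_pmod k (isT : (0 < 6)%N).
  have := zE 0; have := zE 1; have := zE 2; have := zE 3; have := zE 4; have := zE 5.
  move: z {zE E r0 nh} => z; move: (k %% 6)%N kP i => r.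
  case: r => [|[|[|[|[|[|//]]]]]] _ [[|[|[|[|//]]]] hi] /= Z5 Z4 Z3 Z2 Z1 Z0;
    rewrite ?Z0 ?Z1 ?Z2 ?Z3 ?Z4 ?Z5 ?mulr1 ?mul1r => /eqP E1 /eqP E2 /eqP E3;
    move: E1 E2 E3; rewrite ?oppr_eq0 ?oner_eq0 //.
- move=> [k t] D D0 /=; apply/mem_blow_up; rewrite to_frame_scale of_frameK => i.
  by case: i => [[|[|[|//]]] hi]; split; rewrite ?(big_ord_recl, big_ord0) !mxE /=; ring.
exists (fun k t => c (k, t)), (fun k t => D (k, t)).
by split=> [k t|k t]; [exact: D0 | exact: cE].
Qed.

Lemma of_frame_scale D A : of_frame (row_scale D A) = row_scale D (of_frame A).
Proof.
by apply/row_matrixP => i; rewrite row_of_frame !row_row_scale row_of_frame scalemxAl.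
Qed.

(** The incidence of the i-th line with the i-th point of the frame makes the
    diagonal coefficients zero. *)
Definition point_rows (a : pt X) : seq (seq C) :=
  [:: [:: frame_coords a 0 (Ordinal (isT : 0 < 3)%N);
          frame_coords a 0 (Ordinal (isT : 1 < 3)%N);
          frame_coords a 0 (Ordinal (isT : 2 < 3)%N)];
      [:: 0; nc a 5; - nc a 2]; [:: - nc a 0; 0; nc a 3]; [:: nc a 1; - nc a 4; 0]].

Lemma frame_coordsE a i j : frame_coords a i j = nth 0 (nth [::] (point_rows a) i) j.
Proof.
have /mem_blow_up aX : @vmem C X (sval a) by case: (svalP a).
rewrite -/(frame_coords a) in aX.
have diag k l : val k = (val l).+1 -> frame_coords a k l = 0.
  move=> kl; have [<- _] := aX l; congr (to_frame _ _ _).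
  by apply/val_inj; rewrite kl.
case: i => [[|[|[|[|//]]]] hi]; case: j => [[|[|[|//]]] hj] /=;
  rewrite /n_coord /n_sign /= ?mul1r ?mulN1r ?opprK;
  try (by rewrite diag); congr (frame_coords _ _ _); exact/val_inj.
Qed.

(** The point of the plane lies on the three lines. *)
Lemma point_relations a :
  [/\ nc a 5 * frame_coords a 0 (Ordinal (isT : 1 < 3)%N) =
      nc a 2 * frame_coords a 0 (Ordinal (isT : 2 < 3)%N),
      nc a 3 * frame_coords a 0 (Ordinal (isT : 2 < 3)%N) =
      nc a 0 * frame_coords a 0 (Ordinal (isT : 0 < 3)%N)
    & nc a 1 * frame_coords a 0 (Ordinal (isT : 0 < 3)%N) =
      nc a 4 * frame_coords a 0 (Ordinal (isT : 1 < 3)%N)].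
Proof.
have /mem_blow_up aX : @vmem C X (sval a) by case: (svalP a).
split.
- have [_] := aX (Ordinal (isT : 0 < 3)%N).
  rewrite -/(frame_coords a) !big_ord_recl big_ord0 !frame_coordsE /= => E.
  by apply/eqP; rewrite -subr_eq0 -E; apply/eqP; ring.
- have [_] := aX (Ordinal (isT : 1 < 3)%N).
  rewrite -/(frame_coords a) !big_ord_recl big_ord0 !frame_coordsE /= => E.
  by apply/eqP; rewrite -subr_eq0 -E; apply/eqP; ring.
- have [_] := aX (Ordinal (isT : 2 < 3)%N).
  rewrite -/(frame_coords a) !big_ord_recl big_ord0 !frame_coordsE /= => E.
  by apply/eqP; rewrite -subr_eq0 -E; apply/eqP; ring.
Qed.

Lemma frame_coords_row a i : exists j, frame_coords a i j != 0.
Proof.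
have [h|nh] := pselect (exists j, frame_coords a i j != 0); first exact: h.
have r0 : row i (sval a) = 0.
  rewrite -[sval a]to_frameK row_of_frame.
  suff -> : row i (to_frame (sval a)) = 0 by rewrite mul0mx.
  apply/rowP => j; rewrite [LHS]mxE [RHS]mxE; apply/eqP; apply: contraT => h.
  by case: nh; exists j.
have [[nA _] _] := (svalP a, tt); have [j [aj _]] := nA i.
have := congr1 (fun A : 'rV_3 => A 0 j) r0; rewrite !mxE aj => /eqP.
by rewrite oner_eq0.
Qed.

Lemma n_coord_pair a j : (nc a j != 0) || (nc a (j + 3) != 0).
Proof.
rewrite -(n_coord_mod _ j) -(n_coord_mod _ (j + 3)) -[((j + 3) %% 6)%N]modnDml.
have := ltn_pmod j (isT : (0 < 6)%N); move: (j %% 6)%N => r.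
have row i : exists l : 'I_3, nth 0 (nth [::] (point_rows a) (val (i : 'I_4))) l != 0.
  by have [l] := frame_coords_row a i; rewrite frame_coordsE; exists l.
have [l1] := row (Ordinal (isT : 1 < 4)%N); have [l2] := row (Ordinal (isT : 2 < 4)%N).
have [l3] := row (Ordinal (isT : 3 < 4)%N).
case: r => [|[|[|[|[|[|//]]]]]] + + + _ /=;
case: l1 => [[|[|[|//]]] ?]; case: l2 => [[|[|[|//]]] ?]; case: l3 => [[|[|[|//]]] ?] /=;
by rewrite ?oppr_eq0 ?eqxx // => *; apply/orP; auto.
Qed.

Variables (c : nat -> C * C -> pt X) (D : nat -> C * C -> 'I_4 -> C).
Hypothesis D0 : forall k t i, D k t i != 0.
Hypothesis cE : forall k t, sval (c k t) = row_scale (D k t) (of_frame (chart_cox k t)).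

Lemma frame_coords_chart k t : frame_coords (c k t) = row_scale (D k t) (chart_cox k t).
Proof. by rewrite /frame_coords cE to_frame_scale of_frameK. Qed.

Lemma n_coord_chart k t j : nc (c k t) j =
  D k t (n_row j) * (e2 t (edge_poly C j k) * e2 t (edge_poly C (j + 5) k)).
Proof.
rewrite frame_coords_chart n_coord_scale -(n_coord_mod _ j) n_coord_cox ?ltn_mod //.
by rewrite edge_poly_mod modnDml edge_poly_mod.
Qed.

Lemma point_eq a k t E : (forall i j, frame_coords a i j = E i * chart_cox k t i j) -> a = c k t.
Proof.
move=> aE; apply: (@pt_proportional C X a (c k t) (fun=> 1) (D k t) E (sval a) _ (D0 k t) _ (cE k t)).
  by apply/matrixP => i j; rewrite mxE mul1r.
move=> i j; rewrite -{1}[sval a]to_frameK.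
have -> : to_frame (sval a) = row_scale E (chart_cox k t).
  by apply/matrixP => u v; rewrite -[LHS]/(frame_coords a u v) aE row_scaleE.
by rewrite of_frame_scale row_scaleE.
Qed.

(** On the open set where the denominators of the coordinates do not vanish, the
    first two coordinate quotients determine two of the lines, hence the point of
    the plane, hence the third line. *)
Lemma blow_up_onto a k : nc a (k + 3) != 0 -> nc a (k + 5) != 0 ->
  a = c k (nc a k / nc a (k + 3), nc a (k + 2) / nc a (k + 5)).
Proof.
have [Q P R] := point_relations a; have [l xi0] := frame_coords_row a 0.
rewrite frame_coordsE in xi0.
move: (frame_coordsE a) xi0.
rewrite -(n_coord_mod _ k) -!(n_coord_mod _ (k + _)) -![((k + _) %% 6)%N]modnDml /point_rows.
set x0 := frame_coords a 0 (Ordinal (isT : 0 < 3)%N) in Q P R *.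
set x1 := frame_coords a 0 (Ordinal (isT : 1 < 3)%N) in Q P R *.
set x2 := frame_coords a 0 (Ordinal (isT : 2 < 3)%N) in Q P R *.
move=> aE xi0 h3 h5; set x := _ / _; set y := _ / _.
have zE j : e2 (x, y) (edge_poly C j k) =
    match ((j + 5 * (k %% 6)) %% 6)%N with 0 => x | 1 => y | _ => 1 end.
  by rewrite -edge_poly_modr edge_poly_val.
have xE : nc a (k %% 6) = x * nc a ((k %% 6 + 3) %% 6) by rewrite /x divfK.
have yE : nc a ((k %% 6 + 2) %% 6) = y * nc a ((k %% 6 + 5) %% 6) by rewrite /y divfK.
have step u v n n' z : n' != 0 -> n * u = n' * v -> n = z * n' -> v = z * u :> C.
  by move=> n'0 uv nz; apply: (mulfI n'0); rewrite -uv nz mulrCA mulrA.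
have last n n' u v z : u != 0 -> n * u = n' * v -> v = z * u -> n = z * n' :> C.
  by move=> u0 uv vz; apply: (mulIf u0); rewrite uv vz; ring.
have := ltn_pmod k (isT : (0 < 6)%N); move: (k %% 6)%N h3 h5 xE yE zE.
case=> [|[|[|[|[|[|//]]]]]] /= h3 h5 xE yE zE _.
- have e1 := step _ _ _ _ _ h3 (esym P) xE; have e2 := step _ _ _ _ _ h5 (esym Q) yE.
  have b0 : x0 != 0.
    by apply: contraNneq xi0 => b0; move: e1 e2; rewrite b0 ?mulr0 => -> ->; rewrite ?mulr0; case: (l) => [[|[|[|//]]] ?] /=.
  have e3 : nc a 1 = x * y * nc a 4.
    by apply: last b0 R _; rewrite ?e1 ?e2 ?e1; ring.
  apply: (point_eq (E := fun i => nth 0 [:: x0; nc a 5; nc a 3; nc a 4] i)) => i j.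
  rewrite aE mxE; case: i => [[|[|[|[|//]]]] hi]; case: j => [[|[|[|//]]] hj] /=;
  rewrite ?zE /= ?e1 ?e2 ?e1 ?xE ?yE ?e3; ring.
- have e1 := step _ _ _ _ _ h3 R xE; have e2 := step _ _ _ _ _ h5 P yE.
  have b0 : x2 != 0.
    by apply: contraNneq xi0 => b0; move: e1 e2; rewrite b0 ?mulr0 => -> ->; rewrite ?mulr0; case: (l) => [[|[|[|//]]] ?] /=.
  have e3 : nc a 2 = x * y * nc a 5.
    by apply: last b0 (esym Q) _; rewrite ?e1 ?e2 ?e1; ring.
  apply: (point_eq (E := fun i => nth 0 [:: x2; nc a 5; nc a 0; nc a 4] i)) => i j.
  rewrite aE mxE; case: i => [[|[|[|[|//]]]] hi]; case: j => [[|[|[|//]]] hj] /=;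
  rewrite ?zE /= ?e1 ?e2 ?e1 ?xE ?yE ?e3; ring.
- have e1 := step _ _ _ _ _ h3 (esym Q) xE; have e2 := step _ _ _ _ _ h5 (esym R) yE.
  have b0 : x2 != 0.
    by apply: contraNneq xi0 => b0; move: e1 e2; rewrite b0 ?mulr0 => -> ->; rewrite ?mulr0; case: (l) => [[|[|[|//]]] ?] /=.
  have e3 : nc a 3 = x * y * nc a 0.
    by apply: last b0 P _; rewrite ?e1 ?e2 ?e1; ring.
  apply: (point_eq (E := fun i => nth 0 [:: x2; nc a 5; nc a 0; nc a 1] i)) => i j.
  rewrite aE mxE; case: i => [[|[|[|[|//]]]] hi]; case: j => [[|[|[|//]]] hj] /=;
  rewrite ?zE /= ?e1 ?e2 ?e1 ?xE ?yE ?e3; ring.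
- have e1 := step _ _ _ _ _ h3 P xE; have e2 := step _ _ _ _ _ h5 Q yE.
  have b0 : x1 != 0.
    by apply: contraNneq xi0 => b0; move: e1 e2; rewrite b0 ?mulr0 => -> ->; rewrite ?mulr0; case: (l) => [[|[|[|//]]] ?] /=.
  have e3 : nc a 4 = x * y * nc a 1.
    by apply: last b0 (esym R) _; rewrite ?e1 ?e2 ?e1; ring.
  apply: (point_eq (E := fun i => nth 0 [:: x1; nc a 2; nc a 0; nc a 1] i)) => i j.
  rewrite aE mxE; case: i => [[|[|[|[|//]]]] hi]; case: j => [[|[|[|//]]] hj] /=;
  rewrite ?zE /= ?e1 ?e2 ?e1 ?xE ?yE ?e3; ring.
- have e1 := step _ _ _ _ _ h3 (esym R) xE; have e2 := step _ _ _ _ _ h5 (esym P) yE.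
  have b0 : x1 != 0.
    by apply: contraNneq xi0 => b0; move: e1 e2; rewrite b0 ?mulr0 => -> ->; rewrite ?mulr0; case: (l) => [[|[|[|//]]] ?] /=.
  have e3 : nc a 5 = x * y * nc a 2.
    by apply: last b0 Q _; rewrite ?e1 ?e2 ?e1; ring.
  apply: (point_eq (E := fun i => nth 0 [:: x1; nc a 2; nc a 3; nc a 1] i)) => i j.
  rewrite aE mxE; case: i => [[|[|[|[|//]]]] hi]; case: j => [[|[|[|//]]] hj] /=;
  rewrite ?zE /= ?e1 ?e2 ?e1 ?xE ?yE ?e3; ring.
- have e1 := step _ _ _ _ _ h3 Q xE; have e2 := step _ _ _ _ _ h5 R yE.
  have b0 : x0 != 0.
    by apply: contraNneq xi0 => b0; move: e1 e2; rewrite b0 ?mulr0 => -> ->; rewrite ?mulr0; case: (l) => [[|[|[|//]]] ?] /=.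
  have e3 : nc a 0 = x * y * nc a 3.
    by apply: last b0 (esym P) _; rewrite ?e1 ?e2 ?e1; ring.
  apply: (point_eq (E := fun i => nth 0 [:: x0; nc a 2; nc a 3; nc a 4] i)) => i j.
  rewrite aE mxE; case: i => [[|[|[|[|//]]]] hi]; case: j => [[|[|[|//]]] hj] /=;
  rewrite ?zE /= ?e1 ?e2 ?e1 ?xE ?yE ?e3; ring.
Qed.

Lemma n_row3 j : n_row (j + 3) = n_row j.
Proof.
rewrite /n_row -modnDml; have := ltn_pmod j (isT : (0 < 6)%N).
by case: (j %% 6)%N => [|[|[|[|[|[|//]]]]]].
Qed.

Definition cox_value (t : C * C) (m : nat) : C :=
  match (m %% 6)%N with 0 => t.1 | 1 => t.2 | _ => 1 end.

Lemma n_coord_value k t m : nc (c k t) (k + m) =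
  D k t (n_row (k + m)) * (cox_value t m * cox_value t (m + 5)).
Proof.
rewrite n_coord_chart !edge_poly_val /cox_value.
have -> : ((k + m + 5 * k) %% 6 = m %% 6)%N by lia.
by have -> : ((k + m + 5 + 5 * k) %% 6 = (m + 5) %% 6)%N by lia.
Qed.

Lemma blow_up_range k : range (c k) = [set a | nc a (k + 3) != 0] `&` [set a | nc a (k + 5) != 0].
Proof.
apply/seteqP; split=> a; last first.
  by move=> [h3 h5]; rewrite (blow_up_onto h3 h5); eexists.
move=> [t _ <-]; split; rewrite /= n_coord_value /cox_value /= !mulr1; exact: D0.
Qed.

Definition n_form j (l : 'I_3) : C := n_sign C j * basis (n_row j) l (n_col j).

Lemma n_formE (a : pt X) j : \sum_l n_form j l * sval a (n_row j) l = nc a j.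
Proof.
rewrite /n_coord /frame_coords mxE mxE mulr_sumr; apply: eq_bigr => l _.
by rewrite /n_form [row _ _ _ _]mxE; ring.
Qed.

Lemma n_open j : zopen [set a : pt X | nc a j != 0].
Proof.
have := @zopen_linear C X (n_row j) (n_form j).
suff -> : [set a : pt X | nc a j != 0] =
  [set a : pt X | \sum_l n_form j l * sval a (n_row j) l != 0] by [].
by apply/seteqP; split=> a; rewrite /= n_formE.
Qed.

Lemma blow_up_chart k : chart e2 (c k).
Proof.
have oc : zopen (range (c k)) by rewrite blow_up_range; apply: zopenI; exact: n_open.
pose M : 'M[{poly {poly C}}]_(4, 3) := \matrix_(i, j)
  \sum_l cox_matrix (fun j => edge_poly C j k) i l * (basisV i l j)%:P%:P.
apply: (@polynomial_chart2 C X (c k) M (D k)) => [t i|t|||].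
- exact: D0.
- rewrite cE; congr (row_scale _ _); apply/matrixP => i j; rewrite !mxE rmorph_sum.
  apply: eq_bigr => l _; rewrite rmorphM eval2C mxE; congr (_ * _).
  by rewrite cox_matrix_map; congr (cox_matrix _ _ _).
- exact: oc.
- apply: (extends_ratio oc (i := n_row k) (v := n_form k) (w := n_form (k + 3))) => t.
    by rewrite -{1}(n_row3 k) n_formE n_coord_value /cox_value /= !mulr1 D0.
  have v0 := n_coord_value k t 0; rewrite addn0 in v0.
  rewrite n_formE -{1}(n_row3 k) n_formE v0 n_coord_value eval2X /cox_value /=.
  by rewrite n_row3; ring.
apply: (extends_ratio oc (i := n_row (k + 2)) (v := n_form (k + 2)) (w := n_form (k + 5))) => t.
  by rewrite -{1}(n_row3 (k + 2)) -addnA n_formE n_coord_value /cox_value /= !mulr1 D0.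
rewrite n_formE -{1}(n_row3 (k + 2)) -addnA n_formE !n_coord_value eval2Y /cox_value /=.
have -> : (k + 5 = k + 2 + 3)%N by lia.
by rewrite n_row3; ring.
Qed.

(** None of the three pairs of opposite coordinates of the lines is (0, 0), and the
    product of the three coordinates with even index equals the product of the
    three with odd index, because the three incidences are linear equations with
    a nonzero solution.  So two coordinates at distance two are nonzero. *)
Lemma blow_up_cover a : exists k t, a = c k t.
Proof.
suff [k [h3 h5]] : exists k, nc a (k + 3) != 0 /\ nc a (k + 5) != 0.
  by exists k; eexists; exact: blow_up_onto h3 h5.
have Z0 : (nc a 0 != 0) || (nc a 3 != 0) := n_coord_pair a 0.
have Z1 : (nc a 1 != 0) || (nc a 4 != 0) := n_coord_pair a 1.
have Z2 : (nc a 2 != 0) || (nc a 5 != 0) := n_coord_pair a 2.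
have prod : nc a 1 * nc a 3 * nc a 5 = nc a 0 * nc a 2 * nc a 4.
  have [Q P R] := point_relations a; have [l xi0] := frame_coords_row a 0.
  rewrite frame_coordsE in xi0; apply/eqP; rewrite -subr_eq0; apply: contraT => d0.
  set x0 := frame_coords a 0 (Ordinal (isT : 0 < 3)%N) in Q P R.
  set x1 := frame_coords a 0 (Ordinal (isT : 1 < 3)%N) in Q P R.
  set x2 := frame_coords a 0 (Ordinal (isT : 2 < 3)%N) in Q P R.
  set d := (X in X != 0) in d0.
  have e0 : d * x0 = 0.
    rewrite /d mulrBl; apply/eqP; rewrite subr_eq0; apply/eqP.
    transitivity (nc a 3 * nc a 5 * (nc a 1 * x0)); first by ring.
    rewrite R; transitivity (nc a 3 * nc a 4 * (nc a 5 * x1)); first by ring.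
    rewrite Q; transitivity (nc a 2 * nc a 4 * (nc a 3 * x2)); first by ring.
    by rewrite P; ring.
  have e1 : d * x1 = 0.
    rewrite /d mulrBl; apply/eqP; rewrite subr_eq0; apply/eqP.
    transitivity (nc a 1 * nc a 3 * (nc a 5 * x1)); first by ring.
    rewrite Q; transitivity (nc a 1 * nc a 2 * (nc a 3 * x2)); first by ring.
    rewrite P; transitivity (nc a 0 * nc a 2 * (nc a 1 * x0)); first by ring.
    by rewrite R; ring.
  have e2 : d * x2 = 0.
    rewrite /d mulrBl; apply/eqP; rewrite subr_eq0; apply/eqP.
    transitivity (nc a 1 * nc a 5 * (nc a 3 * x2)); first by ring.
    rewrite P; transitivity (nc a 0 * nc a 5 * (nc a 1 * x0)); first by ring.
    rewrite R; transitivity (nc a 0 * nc a 4 * (nc a 5 * x1)); first by ring.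
    by rewrite Q; ring.
  move: e0 e1 e2 => /eqP + /eqP + /eqP.
  rewrite !mulf_eq0 (negPf d0) /= => /eqP e0 /eqP e1 /eqP e2.
  by move: xi0; rewrite /point_rows -/x0 -/x1 -/x2 e0 e1 e2; case: l => [[|[|[|//]]] ?] /=; rewrite eqxx.
have Z : (nc a 1 * nc a 3 * nc a 5 == 0) = (nc a 0 * nc a 2 * nc a 4 == 0) by rewrite prod.
move: Z; rewrite !mulf_eq0.
suff H : (exists k, (k < 6)%N /\ nc a ((k + 3) %% 6) != 0 /\ nc a ((k + 5) %% 6) != 0) -> exists k, nc a (k + 3) != 0 /\ nc a (k + 5) != 0.
  move=> Z; apply: H; move: Z Z0 Z1 Z2.
  case E0: (nc a 0 == 0); case E1: (nc a 1 == 0); case E2: (nc a 2 == 0);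
  case E3: (nc a 3 == 0); case E4: (nc a 4 == 0); case E5: (nc a 5 == 0) => //= _ _ _ _;
  solve [exists 0%N; rewrite /= ?E3 ?E5 //| exists 1%N; rewrite /= ?E4 ?E0 // | exists 2%N; rewrite /= ?E5 ?E1 //
    | exists 3%N; rewrite /= ?E0 ?E2 // | exists 4%N; rewrite /= ?E1 ?E3 // | exists 5%N; rewrite /= ?E2 ?E4 //].
by move=> [k [_ h]]; exists k; rewrite -!(n_coord_mod _ (k + _)).
Qed.

Lemma blow_up_hex_atlas_of_param : hex_atlas c.
Proof.
split=> [k|a|k t|k x y x0|j k k' t t' tt'].
- exact: blow_up_chart.
- exact: blow_up_cover.
- apply: (point_eq (E := D (k + 6)%N t)) => i j; rewrite frame_coords_chart mxE; congr (_ * _).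
  rewrite !mxE /chart_cox; congr (nth 0 (nth [::] (cox_rows _) i) j).
  by apply/funext => l; rewrite -(edge_poly_modr l (k + 6)) modnDr edge_poly_modr.
- have v m := n_coord_value k (x, y) m.
  have n3 m : n_row (k + (m + 3)) = n_row (k + m) by rewrite addnA n_row3.
  have v6 : nc (c k (x, y)) (k + 6) = D k (x, y) (n_row k) * x.
    by rewrite v /cox_value /= mulr1 (n3 3) (n3 0) addn0.
  rewrite (@blow_up_onto (c k (x, y)) k.+1); first congr (c k.+1 (_, _)).
  + rewrite -addn1 -addnA !v (n3 1) /cox_value /= mulr1.
    by field; exact: D0.
  + rewrite -addn1 -!addnA v6 v (n3 0) addn0 /cox_value /= !mulr1.
    by field; rewrite x0; exact: D0.
  + by rewrite -addn1 -addnA v /cox_value /= !mulr1 D0.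
  + by rewrite -addn1 -addnA v6 mulf_neq0 ?D0.
have e m : nc (c k t) m = nc (c k' t') m by rewrite tt'.
move=> z0; apply/eqP; apply: contraT => z'0.
have := e j; have := e j.+1; rewrite !n_coord_chart z0 mul0r mulr0 addSnnS.
rewrite -(edge_poly_mod (j + 6)) modnDr edge_poly_mod z0 !mulr0.
rewrite -[edge_poly C (j + 6) k']edge_poly_mod modnDr edge_poly_mod.
move=> /esym/eqP + /esym/eqP; rewrite !mulf_eq0 !(negPf (D0 _ _ _)) (negPf z'0) ?orbF ?orFb.
rewrite !edge_poly_val.
case E1: ((j.+1 + 5 * k') %% 6)%N => [|[|r]]; last by rewrite oner_eq0.
  case E2: ((j + 5 + 5 * k') %% 6)%N => [|[|r']]; first by lia.
    by lia.
  by rewrite oner_eq0.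
case E2: ((j + 5 + 5 * k') %% 6)%N => [|[|r']]; first by lia.
  by lia.
by rewrite oner_eq0.
Qed.

End BlowUp.

Lemma blow_up_hex_atlas (C : closedFieldType) (p : 'I_3 -> pt (projective_space C 2)) :
  non_collinear p -> exists c : nat -> C * C -> pt (blow_up3 p), hex_atlas c.
Proof.
move=> ncp; have [c [D [D0 cE]]] := blow_up_param ncp.
by exists c; exact: blow_up_hex_atlas_of_param D0 cE.
Qed.

(** * Automorphisms that permute the six lines cyclically *)

Section CyclicAutomorphisms.
Variables (C : closedFieldType) (X : variety C) (c : nat -> C * C -> pt X).
Hypothesis ax : hex_atlas c.
Variable s : automorphism X.

Lemma aut_inj : injective s. Proof. exact: can_inj (aut_funK s). Qed.

Lemma aut_image_inj A B : s @` A = s @` B -> A = B.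
Proof.
move=> AB; have sub P Q : s @` P = s @` Q -> P `<=` Q.
  move=> PQ a Pa; have : (s @` P) (s a) by exists a.
  by rewrite PQ => -[b Qb /aut_inj <-].
by apply/seteqP; split; apply: sub.
Qed.

Lemma aut_preimage A B : s @` A = B -> s @^-1` B = A.
Proof.
by move=> <-; apply/seteqP; split=> [a [b Ab /aut_inj <-]|a Aa] //; exists a.
Qed.

Hypothesis cyc : cyclically_permutes_six s (@minus_one_curve C X).

(** The six edges are distinct (-1)-curves and there are only six of these. *)
Lemma minus_one_curve_edge Z : minus_one_curve Z -> exists j, Z = edge c j.
Proof.
move: cyc => [K [Kinj KE _]].
have ex (i : 'I_6) : exists k, K k = edge c i.
  have : minus_one_curve (edge c i) by exact: edge_minus_one.
  by rewrite KE => -[k _ kE]; exists k.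
have [k kE] := choice ex; have kinj : injective k.
  move=> i j ij; have := kE j; rewrite -ij kE => /(edge_inj ax).
  by rewrite !modn_small // => /val_inj.
have [g _ gK] := injF_bij kinj.
by rewrite KE => -[l _ <-]; exists (g l); rewrite -kE gK.
Qed.

Lemma edge_permutation : exists f : nat -> nat,
  (forall j, s @` edge c j = edge c (f j)) /\
  forall j m, (0 < m < 6)%N -> iter m f j != j %[mod 6].
Proof.
have cyc' := cyc; move: cyc' => [K [Kinj KE sK]].
have toK j : exists k, K k = edge c j.
  have : minus_one_curve (edge c j) by exact: edge_minus_one.
  by rewrite KE => -[k _ kE]; exists k.
have ex j : exists j', s @` edge c j = edge c j'.
  have [k <-] := toK j; rewrite sK; apply: minus_one_curve_edge.
  by rewrite KE; exists (ordS k).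
have [f fE] := choice ex; exists f; split=> // j m m6; apply/eqP => E.
have [k kE] := toK j.
have it n : K (iter n (@ordS 6) k) = edge c (iter n f j).
  by elim: n => //= n IHn; rewrite -sK IHn fE.
have valit n : val (iter n (@ordS 6) k) = ((k + n) %% 6)%N.
  elim: n => [|n IHn]; first by rewrite addn0 modn_small.
  by rewrite iterS /= -[nat_of_ord (iter _ _ _)]/(val _) IHn; lia.
have := it m; rewrite (edge_mod c E) -kE => /Kinj /(congr1 val); rewrite valit /=.
by have := ltn_ord k; lia.
Qed.

(** The permutation of the six edges preserves adjacency and is a 6-cycle, hence
    it is one of the two rotations of the hexagon by one step. *)
Lemma edge_rotation :
  (forall j, s @` edge c j = edge c (j + 1)) \/
  (forall j, s @` edge c j = edge c (j + 5)).
Proof.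
have [f [fE fcyc]] := edge_permutation.
have finj i j : (f i = f j %[mod 6])%N -> (i = j %[mod 6])%N.
  by move=> ij; apply: (edge_inj ax); apply: aut_image_inj; rewrite !fE (edge_mod c ij).
have adj j : ((f j).+1 = f j.+1 %[mod 6] \/ f j = (f j.+1).+1 %[mod 6])%N.
  have [a [aj aj1]] : edge c j `&` edge c j.+1 !=set0.
    by apply/(edge_meet ax); constructor 2.
  have : edge c (f j) `&` edge c (f j.+1) !=set0.
    by exists (s a); rewrite -!fE; split; exists a.
  by move=> /(edge_meet ax)[/finj|h|h]; [lia | left | right].
have [up|down] := adj 0.
  have fS j : (f j = f 0 + j %[mod 6])%N.
    have [] : (f j = f 0 + j %[mod 6])%N /\ ((f j).+1 = f j.+1 %[mod 6])%N => //.
    elim: j => [|j [IH1 IH2]]; first by rewrite addn0.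
    split; first by lia.
    by have [//|h] := adj j.+1; have : (j = j.+2 %[mod 6])%N by [apply: finj; lia]; lia.
  have it m : (iter m f 0 = m * f 0 %[mod 6])%N.
    by elim: m => //= m IHm; rewrite fS mulSn -modnDmr IHm modnDmr.
  have c1 := fcyc 0 1 isT; have c2 := fcyc 0 2 isT; have c3 := fcyc 0 3 isT.
  rewrite !it in c1 c2 c3.
  have [h|h] : (f 0 = 1 %[mod 6] \/ f 0 = 5 %[mod 6])%N by lia.
    by left=> j; rewrite fE; apply: edge_mod; rewrite fS; lia.
  by right=> j; rewrite fE; apply: edge_mod; rewrite fS; lia.
have fS j : (f j + j = f 0 %[mod 6])%N.
  have [] : (f j + j = f 0 %[mod 6])%N /\ (f j = (f j.+1).+1 %[mod 6])%N => //.
  elim: j => [|j [IH1 IH2]]; first by rewrite addn0.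
  split; first by lia.
  by have [h|//] := adj j.+1; have : (j = j.+2 %[mod 6])%N by [apply: finj; lia]; lia.
by have := fcyc 0 2 isT; rewrite /= => /eqP[]; have := fS (f 0); lia.
Qed.

(** According to the direction of the rotation, the hexagon is relabelled by a
    shift or by a reflection. *)
Lemma rotated_atlas j0 : exists2 c' : nat -> C * C -> pt X, hex_atlas c' &
  edge c' 0 = edge c j0 /\ forall j, s @^-1` edge c' j = edge c' j.+1.
Proof.
have [up|down] := edge_rotation; last first.
  exists (fun k => c (k + j0)%N); first exact: hex_shift.
  split=> [|j]; rewrite !edge_shift //.
  by apply: aut_preimage; rewrite down; apply: edge_mod; lia.
have ax1 := hex_shift (j0 + 5) ax.
exists (hex_flip (fun k => c (k + (j0 + 5))%N)); first exact: hex_flip_atlas.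
split=> [|j]; rewrite !edge_flip // !edge_shift //; first by apply: edge_mod; lia.
by apply: aut_preimage; rewrite up; apply: edge_mod; lia.
Qed.

End CyclicAutomorphisms.

Theorem theorem1p2 (R : realType)
  (p : 'I_3 -> pt (projective_space R[i] 2))
  (E : set (pt (blow_up3 p)))
  (s : automorphism (blow_up3 p)) :
  non_collinear p ->
  minus_one_curve E ->
  has_order s 6 ->
  cyclically_permutes_six s (@minus_one_curve _ (blow_up3 p)) ->
  exists f : {rmorphism algR R[i] -> thcr (divisor_sheaf E) s},
    [/\ scalable f, bijective f
      & forall n a, algR_homog n a <-> thcr_homog n (f a)].
Proof.
move=> ncp mE _ cyc; have [c ax] := blow_up_hex_atlas ncp.
have [j0 EE] := minus_one_curve_edge ax cyc mE.
have [c' ax' [e0 rot]] := rotated_atlas ax cyc j0.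
have [c'' [w [ax'' hw eE sw]]] := rotation_coordinates ax' rot.
have -> : E = edge c'' 0 by rewrite eE e0.
apply: (twisted_ring_iso ax'' hw _ sw) => j.
by rewrite !eE.
Qed.
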